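(* Let $n\in\mathbb{N}$ and let $f:\mathbb{C}^n\to\mathbb{C}$ be uniformly continuous, i.e. $f\in\mathrm{UC}(\mathbb{C}^n)$. Then $\lim_{t\to 0}\|H_f^{(t)}\|_t=0$. In particular, $$\lim_{t\to 0}\big\|T_f^{(t)}T_g^{(t)}-T_{fg}^{(t)}\big\|_t=0$$ for all $g\in L^\infty(\mathbb{C}^n)$ and for all $g\in \mathrm{UC}(\mathbb{C}^n)$.
   Context: For $t>0$ let $d\mu_t(z)=\frac{1}{(4\pi t)^n}e^{-|z|^2/(4t)}\,dv(z)$ on $\mathbb{C}^n$, where $dv$ is Lebesgue measure, let $L_t^2=L^2(\mathbb{C}^n,d\mu_t)$ with norm $\|\cdot\|_t$, let $H_t^2$ be the closed subspace of entire functions in $L_t^2$, and let $P^{(t)}:L_t^2\to H_t^2$ be the orthogonal projection. For a measurable function $f$ on $\mathbb{C}^n$ and $h\in H_t^2$ with $fh\in L_t^2$, define the Toeplitz operator $T_f^{(t)}h=P^{(t)}(fh)$ and the Hankel operator $H_f^{(t)}h=(I-P^{(t)})(fh)$. For a linear operator $X$ with domain and range in $L_t^2$, $\|X\|_t=\sup\{\|Xh\|_t/\|h\|_t : h\neq 0 \text{ in the domain of } X\}$. $\mathrm{UC}(\mathbb{C}^n)$ denotes the space of all (not necessarily bounded) uniformly continuous complex-valued functions on $\mathbb{C}^n$. When symbols are unbounded, each operator is taken on its natural domain: $T_f^{(t)}$ and $H_f^{(t)}$ on $\{h\in H_t^2: fh\in L_t^2\}$, and $T_f^{(t)}T_g^{(t)}-T_{fg}^{(t)}$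 on $\{h\in H_t^2: gh\in L_t^2,\ fP^{(t)}(gh)\in L_t^2,\ fgh\in L_t^2\}$. *)

(* Defs.v *)
From HB Require Import structures.
From mathcomp Require Import all_boot all_order all_algebra.
From mathcomp Require Import complex.
From mathcomp Require Import all_classical all_reals all_analysis.
From mathcomp Require Import measurable_realfun.

Set Implicit Arguments.
Unset Strict Implicit.
Unset Printing Implicit Defensive.
Import Order.TTheory GRing.Theory Num.Theory.
Import numFieldNormedType.Exports.
Local Open Scope classical_set_scope.
Local Open Scope ring_scope.
Local Open Scope complex_scope.

(* R[i] with its usual topology, as a normed space over itself. *)
HB.instance Definition _ (R : realType) := NormedModule.copy R[i] R[i]^o.

(* The library's sigma-finite structure on products is shadowed by the one for
   subprobabilities, hence this explicit packing. *)
Section product_measure.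
Context d1 d2 (T1 : measurableType d1) (T2 : measurableType d2) {R : realType}.
Variables (m1 : {sigma_finite_measure set T1 -> \bar R})
  (m2 : {sigma_finite_measure set T2 -> \bar R}).

Lemma product_measure_sigma_finite : sigma_finite setT (m1 \x m2)%E.
Proof.
have /sigma_finiteP[F [TF ndF Foo]] := sigma_finiteT m1.
have /sigma_finiteP[G [TG ndG Goo]] := sigma_finiteT m2.
exists (fun n => F n `*` G n).
  rewrite -setXTT TF TG predeqE => -[x y]; split.
    move=> [/= [n _ Fnx] [k _ Gky]]; exists (maxn n k) => //; split.
    - by move: x Fnx; exact/subsetPset/ndF/leq_maxl.
    - by move: y Gky; exact/subsetPset/ndG/leq_maxr.
  by move=> [n _ []/= ? ?]; split; exists n.
move=> k; have [? ?] := Foo k; have [? ?] := Goo k.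
split; first exact: measurableX.
by rewrite product_measure1E// lte_mul_pinfty// ge0_fin_numE.
Qed.

Definition product_measure : {sigma_finite_measure set (T1 * T2)%type -> \bar R} :=
  HB.pack (m1 \x m2)%E
    (Measure_isSigmaFinite.Build _ _ _ (m1 \x m2)%E product_measure_sigma_finite).

End product_measure.

(* The n-fold product of a sigma-finite measure m, on n.-tuple T. *)
Section tuple_measure.
Context {d} {T : measurableType d} {R : realType}.
Variable m : {sigma_finite_measure set T -> \bar R}.

Section cons_measure.
Variables (n : nat) (mn : {sigma_finite_measure set (n.-tuple T) -> \bar R}).

Let cons_pair (p : T * n.-tuple T) : n.+1.-tuple T := [tuple of p.1 :: p.2].

Let measurable_cons_pair : measurable_fun [set: T * n.-tuple T] cons_pair.
Proof. by apply: measurable_cons. Qed.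

Definition cons_measure : set (n.+1.-tuple T) -> \bar R :=
  pushforward (m \x mn)%E (fun p => [tuple of p.1 :: p.2]).

Let cons_measure0 : cons_measure set0 = 0%E.
Proof. by rewrite /cons_measure /pushforward preimage_set0 measure0. Qed.

Let cons_measure_ge0 A : (0 <= cons_measure A)%E.
Proof. exact: measure_ge0. Qed.

Let mpre (A : set (n.+1.-tuple T)) : measurable A ->
  measurable (cons_pair @^-1` A).
Proof. by move=> mA; rewrite -[X in measurable X]setTI; exact: measurable_cons_pair. Qed.

Let cons_measure_sigma_additive : semi_sigma_additive cons_measure.
Proof.
move=> F mF tF mUF; rewrite /cons_measure /pushforward preimage_bigcup.
apply: measure_semi_sigma_additive.
- by move=> k; exact: mpre.
- apply/trivIsetP => /= i j _ _ ij; rewrite -preimage_setI.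
  by move/trivIsetP : tF => /(_ _ _ _ _ ij) ->//; rewrite preimage_set0.
- by rewrite -preimage_bigcup; exact: mpre.
Qed.

HB.instance Definition _ := isMeasure.Build _ _ _ cons_measure
  cons_measure0 cons_measure_ge0 cons_measure_sigma_additive.

Let cons_measure_sigma_finite : sigma_finite setT cons_measure.
Proof.
have [F TF Foo] := product_measure_sigma_finite m mn.
pose split_tuple (t : n.+1.-tuple T) : T * n.-tuple T :=
  (thead t, [tuple of behead t]).
have msplit : measurable_fun setT split_tuple.
  by apply/measurable_fun_pair; [exact: measurable_tnth|exact: measurable_behead].
have splitK p : split_tuple (cons_pair p) = p.
  by case: p => x t; congr pair; exact: val_inj.
exists (fun k => split_tuple @^-1` F k).
  by rewrite -preimage_bigcup -TF preimage_setT.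
move=> k; have [mFk Fkoo] := Foo k; split.
  by rewrite -[X in measurable X]setTI; exact: msplit.
rewrite /cons_measure /pushforward (_ : _ @^-1` _ = F k)//.
by apply/seteqP; split => p /=; rewrite -/(cons_pair p) splitK.
Qed.

HB.instance Definition _ := Measure_isSigmaFinite.Build _ _ _ cons_measure
  cons_measure_sigma_finite.

End cons_measure.

Fixpoint tuple_measure n : {sigma_finite_measure set (n.-tuple T) -> \bar R} :=
  if n is n'.+1 then cons_measure (tuple_measure n') else \d_ [tuple].

End tuple_measure.

Section complex_space.
Context {R : realType} {n : nat}.

Let real_pair : Type := (measurableTypeR R * measurableTypeR R)%type.

Definition complex_of_tuple
    (x : n.-tuple (measurableTypeR R * measurableTypeR R)) : 'rV[R[i]]_n :=
  \row_j ((tnth x j).1 +i* (tnth x j).2).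

(* complex_of_tuple is a bijection, so this transports the Borel
   sigma-algebra of (R^2)^n to C^n. *)
Definition Cn_measurable : set (set 'rV[R[i]]_n) :=
  [set A | measurable (complex_of_tuple @^-1` A)].

Let Cn_measurable0 : Cn_measurable set0.
Proof. by rewrite /Cn_measurable/= preimage_set0. Qed.

Let Cn_measurableC A : Cn_measurable A -> Cn_measurable (~` A).
Proof. by rewrite /Cn_measurable/= preimage_setC; exact: measurableC. Qed.

Let Cn_measurable_bigcup (F : (set 'rV[R[i]]_n)^nat) :
  (forall k, Cn_measurable (F k)) -> Cn_measurable (\bigcup_k F k).
Proof.
by move=> mF; rewrite /Cn_measurable/= preimage_bigcup; apply: bigcup_measurable => k _; exact: mF.
Qed.

HB.instance Definition _ := @isMeasurable.Build default_measure_display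
  'rV[R[i]]_n Cn_measurable Cn_measurable0 Cn_measurableC Cn_measurable_bigcup.

Lemma measurable_complex_of_tuple : measurable_fun setT complex_of_tuple.
Proof. by move=> _ A mA; rewrite setTI. Qed.

Definition lebesgue_Cn : set 'rV[R[i]]_n -> \bar R :=
  pushforward (tuple_measure (product_measure lebesgue_measure lebesgue_measure) n)
    complex_of_tuple.

Let lebesgue_Cn0 : lebesgue_Cn set0 = 0%E.
Proof. by rewrite /lebesgue_Cn /pushforward preimage_set0 measure0. Qed.

Let lebesgue_Cn_ge0 A : (0 <= lebesgue_Cn A)%E.
Proof. by rewrite /lebesgue_Cn /pushforward measure_ge0. Qed.

Let lebesgue_Cn_sigma_additive : semi_sigma_additive lebesgue_Cn.
Proof.
move=> F mF tF mUF; rewrite /lebesgue_Cn /pushforward preimage_bigcup.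
apply: measure_semi_sigma_additive.
- by move=> k; exact: mF.
- apply/trivIsetP => /= i j _ _ ij; rewrite -preimage_setI.
  by move/trivIsetP : tF => /(_ _ _ _ _ ij) ->//; rewrite preimage_set0.
- by rewrite -preimage_bigcup; exact: mUF.
Qed.

HB.instance Definition _ := isMeasure.Build _ _ _ lebesgue_Cn
  lebesgue_Cn0 lebesgue_Cn_ge0 lebesgue_Cn_sigma_additive.

Definition sqnorm (z : 'rV[R[i]]_n) : R :=
  \sum_j ComplexField.Normc.normc (z ord0 j) ^+ 2.

Lemma measurable_sqnorm : measurable_fun setT sqnorm.
Proof.
have : measurable_fun setT (sqnorm \o complex_of_tuple).
  apply: (eq_measurable_fun (fun x : n.-tuple real_pair =>
      \sum_j ((tnth x j).1 ^+ 2 + (tnth x j).2 ^+ 2) : R)) => [x _|].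
    apply: eq_bigr => j _; rewrite mxE /= sqr_sqrtr//.
    by rewrite addr_ge0// sqr_ge0.
  apply: measurable_sum => j; apply: measurable_funD.
  - apply: (measurable_funX 2).
    exact: (measurableT_comp measurable_fst (measurable_tnth j)).
  - apply: (measurable_funX 2).
    exact: (measurableT_comp measurable_snd (measurable_tnth j)).
by move=> + _ A mA => /(_ measurableT A mA); rewrite !setTI.
Qed.

(* The absolute value has no effect for t > 0; it keeps the density
   nonnegative, and hence gauss_measure t a measure, for every real t. *)
Definition gauss_density (t : R) (z : 'rV[R[i]]_n) : R :=
  ((4 * pi * `|t|) ^+ n)^-1 * expR (- sqnorm z / (4 * t)).

Lemma gauss_density_ge0 t z : 0 <= gauss_density t z.
Proof.
by rewrite mulr_ge0 ?expR_ge0// invr_ge0 exprn_ge0// !mulr_ge0// pi_ge0.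
Qed.

Lemma measurable_gauss_density t : measurable_fun setT (gauss_density t).
Proof.
apply: measurable_funM; first exact: measurable_cst.
apply: measurableT_comp => //; apply: measurable_funM => //.
by apply: measurableT_comp => //; exact: measurable_sqnorm.
Qed.

Definition gauss_measure (t : R) (A : set 'rV[R[i]]_n) : \bar R :=
  (\int[lebesgue_Cn]_(z in A) (gauss_density t z)%:E)%E.

Section gauss_measure.
Variable t : R.

Let gauss_measure0 : gauss_measure t set0 = 0%E.
Proof. exact: integral_set0. Qed.

Let gauss_measure_ge0 A : (0 <= gauss_measure t A)%E.
Proof. by apply: integral_ge0 => z _; rewrite lee_fin gauss_density_ge0. Qed.

Let gauss_measure_sigma_additive : semi_sigma_additive (gauss_measure t).
Proof.
move=> F mF tF mUF; rewrite /gauss_measure ge0_integral_bigcup//; last 2 first.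
- apply/measurable_EFinP/measurable_funTS; exact: measurable_gauss_density.
- by move=> z _; rewrite lee_fin gauss_density_ge0.
apply: is_cvg_ereal_nneg_natsum => k _.
by apply: integral_ge0 => z _; rewrite lee_fin gauss_density_ge0.
Qed.

HB.instance Definition _ := isMeasure.Build _ _ _ (gauss_measure t)
  gauss_measure0 gauss_measure_ge0 gauss_measure_sigma_additive.

End gauss_measure.
End complex_space.

Section operators.
Context {R : realType} {n : nat}.
Implicit Types (t : R) (f g h u v p : 'rV[R[i]]_n -> R[i]).

Definition cmeasurable f : Prop :=
  measurable_fun setT (fun z => complex.Re (f z)) /\
  measurable_fun setT (fun z => complex.Im (f z)).

Definition cLnorm (mu : {measure set 'rV[R[i]]_n -> \bar R}) (q : \bar R) u :
    \bar R :=
  ('N[mu]_q[EFin \o (@ComplexField.Normc.normc R \o u)])%E.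

Definition Linfty : set ('rV[R[i]]_n -> R[i]) :=
  [set g | cmeasurable g /\ (cLnorm lebesgue_Cn +oo%E g < +oo)%E].

Definition norm2 t u : \bar R := cLnorm (gauss_measure t) 2%:E u.

Definition L2t t : set ('rV[R[i]]_n -> R[i]) :=
  [set u | cmeasurable u /\ (norm2 t u < +oo)%E].

Definition entire u : Prop := forall z, differentiable u z.

(* Two entire functions that agree almost everywhere are equal, so elements of
   H2t t are honest functions. *)
Definition H2t t : set ('rV[R[i]]_n -> R[i]) :=
  [set h | entire h /\ L2t t h].

Definition inner t u v : R[i] :=
  (\int[gauss_measure t]_z complex.Re (u z * (v z)^*))%R +i*
  (\int[gauss_measure t]_z complex.Im (u z * (v z)^*))%R.

Definition is_orth_proj t u p : Prop :=
  H2t t p /\ forall q, H2t t q -> inner t (u \- p) q = 0.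

(* Meaningful for u in L2t t, where is_orth_proj t u has exactly one element. *)
Definition fock_proj t u : 'rV[R[i]]_n -> R[i] :=
  xget (fun=> 0) [set p | is_orth_proj t u p].

(* A partial operator is a map X together with its domain D. The supremum is
   taken in [0, +oo], i.e. it is 0 if D contains no nonzero function. *)
Definition opnorm t (D : set ('rV[R[i]]_n -> R[i]))
    (X : ('rV[R[i]]_n -> R[i]) -> ('rV[R[i]]_n -> R[i])) : \bar R :=
  ereal_sup (0%E |` [set (norm2 t (X h) / norm2 t h)%E
                    | h in D `\ (fun=> 0)]).

Definition toeplitz t f h := fock_proj t (f \* h).

Definition hankel t f h := (f \* h) \- fock_proj t (f \* h).

Definition mult_dom t f : set ('rV[R[i]]_n -> R[i]) :=
  [set h | H2t t h /\ L2t t (f \* h)].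

Definition semicommutator t f g h :=
  toeplitz t f (toeplitz t g h) \- toeplitz t (f \* g) h.

Definition semicommutator_dom t f g : set ('rV[R[i]]_n -> R[i]) :=
  [set h | [/\ H2t t h, L2t t (g \* h), L2t t (f \* fock_proj t (g \* h)) &
               L2t t (f \* g \* h)]].

End operators.

(* Main.v *)
Require Import Defs.
From HB Require Import structures.
From mathcomp Require Import all_boot all_order all_algebra.
From mathcomp Require Import complex.
From mathcomp Require Import all_classical all_reals all_analysis.
From mathcomp Require Import measurable_realfun ess_sup_inf.
From mathcomp Require Import ring lra.
Import Order.TTheory GRing.Theory Num.Theory.
Import numFieldNormedType.Exports.
Local Open Scope classical_set_scope.
Local Open Scope ring_scope.
Local Open Scope complex_scope.

Set Implicit Arguments.
Unset Strict Implicit.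
Unset Printing Implicit Defensive.

(* Write K(z, w) = exp(<z, w> / 4t) for the reproducing kernel of H2t. As
   (P u)(z) is the integral of u(w) K(z, w), both operators have explicit kernels:
     (H_f h)(z) = int (f z - f w) h(w) K(z, w) dmu(w), because h = P h, and
     (T_f T_g h - T_{fg} h)(z) = - P(f u)(z) = int (f z - f w) u(w) K(z, w) dmu(w)
   with u = H_g h, because P u = 0.
   Uniform continuity gives |f z - f w| <= e + M |z - w|, and Schur's test with the
   weight exp(|z|^2 / 8t) bounds both operators by C e + C' M sqrt t.
   The reproducing formula follows from the mean value property int h dmu = h(0),
   transported by the Weyl translations; the mean value property itself follows
   from the invariance of mu under z |-> e^{i theta} z and from the constancy in s of
   the mean of h(e^{s + i theta} z) over theta, which is Goursat's theorem on the
   rectangle [s0, s1] x [-pi, pi]. *)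

(** The constants are uniform in t because every integral in Schur's test is exactly Gaussian. Since
    |z - w| <= 4 sqrt t exp(|z - w|^2 / 16t), it suffices to treat the positive kernel (a + b exp(|z
    - w|^2 / 16t)) |K(z, w)|, and a Weyl translation shows that the weight exp(|z|^2 / 8t) is an
    eigenfunction of it, with eigenvalue 2^n a + 4^n b. For the semicommutator there remains to
    bound H_g uniformly for t < 1: for uniformly continuous g this is the same estimate, for bounded
    g it follows from the boundedness of the projection. The obstacle is the passage from the
    projection, which is chosen by its orthogonality property, to the integral against K. Being
    entire is mere complex differentiability at each point, with neither a power series nor
    continuity of the derivative given, hence Goursat's bisection argument. Rotations are reduced to
    shears because the invariance under shears follows from Tonelli and translations of the line
    alone. *)

Local Notation normc := ComplexField.Normc.normc.
Local Notation Re := complex.Re.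
Local Notation Im := complex.Im.

(** * The complex exponential *)

Section complex_modulus.
Context {R : realType}.
Implicit Types z w : R[i].

Lemma normrE z : `|z| = (normc z)%:C.
Proof. by case: z => x y; rewrite normc_def. Qed.

Lemma normc_ge0 z : 0 <= normc z.
Proof. by case: z => x y; exact: sqrtr_ge0. Qed.

Lemma sqr_normcE z : normc z ^+ 2 = Re z ^+ 2 + Im z ^+ 2.
Proof. by case: z => x y /=; rewrite sqr_sqrtr// addr_ge0// sqr_ge0. Qed.

Lemma normr_Re_le z : `|Re z| <= normc z.
Proof.
rewrite -(@ler_pXn2r _ 2)// ?nnegrE ?normc_ge0//.
by rewrite sqr_normcE real_normK ?num_real// lerDl sqr_ge0.
Qed.

Lemma normr_Im_le z : `|Im z| <= normc z.
Proof.
rewrite -(@ler_pXn2r _ 2)// ?nnegrE ?normc_ge0//.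
by rewrite sqr_normcE real_normK ?num_real// lerDr sqr_ge0.
Qed.

Lemma normc_le_ReIm z : normc z <= `|Re z| + `|Im z|.
Proof.
rewrite -(@ler_pXn2r _ 2)// ?nnegrE ?normc_ge0 ?addr_ge0//.
rewrite sqr_normcE sqrrD !real_normK ?num_real//.
by rewrite -addrA lerD2l lerDr mulrn_wge0// mulr_ge0.
Qed.

Lemma normc_conj z : normc (z^*) = normc z.
Proof. by case: z => x y /=; rewrite sqrrN. Qed.

Lemma normcB z w : normc (z - w) = normc (w - z).
Proof. by rewrite -opprB normcN. Qed.

Lemma normc_real (x : R) : normc x%:C = `|x|.
Proof. by rewrite /= expr0n addr0 sqrtr_sqr. Qed.

Lemma normc_sum n (F : 'I_n -> R[i]) :
  normc (\sum_i F i) <= \sum_i normc (F i).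
Proof.
elim/big_ind2 : _ => //=; first by rewrite expr0n addr0 sqrtr0.
by move=> x a y b xa yb; exact: le_trans (le_normcD _ _) (lerD xa yb).
Qed.

Lemma ReD z w : Re (z + w) = Re z + Re w. Proof. by case: z; case: w. Qed.
Lemma ImD z w : Im (z + w) = Im z + Im w. Proof. by case: z; case: w. Qed.
Lemma ReB z w : Re (z - w) = Re z - Re w. Proof. by case: z; case: w. Qed.
Lemma ImB z w : Im (z - w) = Im z - Im w. Proof. by case: z; case: w. Qed.
Lemma ReM z w : Re (z * w) = Re z * Re w - Im z * Im w.
Proof. by case: z; case: w. Qed.
Lemma ImM z w : Im (z * w) = Re z * Im w + Im z * Re w.
Proof. by case: z => a b; case: w => c d; rewrite /= addrC. Qed.
Lemma Re_conj z : Re (z^*) = Re z. Proof. by case: z. Qed.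
Lemma Im_conj z : Im (z^*) = - Im z. Proof. by case: z. Qed.
Lemma Re_sum n (F : 'I_n -> R[i]) : Re (\sum_i F i) = \sum_i Re (F i).
Proof. by elim/big_ind2 : _ => // x a y b <- <-; exact: ReD. Qed.
Lemma Im_sum n (F : 'I_n -> R[i]) : Im (\sum_i F i) = \sum_i Im (F i).
Proof. by elim/big_ind2 : _ => // x a y b <- <-; exact: ImD. Qed.

Lemma complexP z w : Re z = Re w -> Im z = Im w -> z = w.
Proof. by case: z => a b; case: w => c d /= -> ->. Qed.

End complex_modulus.

(** * The complex exponential and its second-order Taylor bound *)

Section complex_exponential.
Context {R : realType}.
Implicit Types (x y : R) (z w b : R[i]).

Definition cexp z : R[i] :=
  (expR (Re z) * cos (Im z)) +i* (expR (Re z) * sin (Im z)).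

Lemma cexpD z w : cexp (z + w) = cexp z * cexp w.
Proof.
apply: complexP; rewrite ?ReM ?ImM /cexp /= ReD ImD expRD ?cosD ?sinD; ring.
Qed.

Lemma cexp0 : cexp 0 = 1.
Proof. by rewrite /cexp/= expR0 cos0 sin0 mulr1 mulr0. Qed.

Lemma normc_cexp z : normc (cexp z) = expR (Re z).
Proof.
by rewrite /= !exprMn -mulrDr cos2Dsin2 mulr1 sqrtr_sqr ger0_norm// expR_ge0.
Qed.

Lemma cexp_conj z : (cexp z)^* = cexp (z^*).
Proof. by rewrite /cexp /= Re_conj Im_conj cosN sinN mulrN. Qed.

Lemma expR_ge1r x : (1 <= expR x) = (0 <= x).
Proof. by rewrite -[1]expR0 ler_expR. Qed.

Lemma expR_B1_le x : expR x - 1 <= x * expR x.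
Proof.
have := expR_ge1Dx (- x); rewrite expRN.
by rewrite -(ler_pM2r (expR_gt0 x)) mulVf ?gt_eqF ?expR_gt0//; lra.
Qed.

Lemma normr_expR1_le x : `|expR x - 1| <= `|x| * expR `|x|.
Proof.
have [x0|x0] := leP 0 x.
  rewrite (ger0_norm x0) ger0_norm ?subr_ge0 ?expR_ge1r//.
  exact: expR_B1_le.
rewrite ler0_norm ?subr_le0 ?expR_le1 ?(ltW x0)// (ltr0_norm x0).
have := expR_ge1Dx x; have : 1 <= expR (- x) by rewrite expR_ge1r oppr_ge0 ltW.
nra.
Qed.

Lemma normr_expR2_le x : `|expR x - 1 - x| <= x ^+ 2 * expR `|x|.
Proof.
have h := expR_ge1Dx x.
rewrite ger0_norm; last by lra.
have h2 := expR_B1_le x.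
have [x0|x0] := leP 0 x.
  by rewrite (ger0_norm x0); nra.
have : 1 <= expR `|x| by rewrite expR_ge1r.
nra.
Qed.

Lemma normr_sin_le x : `|sin x| <= `|x|.
Proof.
wlog x0 : x / 0 <= x => [hw|].
  have [/hw//|x0] := leP 0 x.
  by rewrite -normrN -sinN -(normrN x) hw// oppr_ge0 ltW.
have [->|xn0] := eqVneq x 0; first by rewrite sin0.
have xp : 0 < x by rewrite lt_def xn0.
have [] := @MVT_segment _ sin cos 0 x x0 (fun y _ => _).
  by apply: continuous_subspaceT; exact: continuous_sin.
move=> c _; rewrite sin0 !subr0 => ->; rewrite normrM ler_piMl//; exact: cos_max.
Qed.

Lemma normr_cos1_le x : `|cos x - 1| <= `|x|.
Proof.
wlog x0 : x / 0 <= x => [hw|].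
  have [/hw//|x0] := leP 0 x.
  by rewrite -cosN -(normrN x) hw// oppr_ge0 ltW.
have [->|xn0] := eqVneq x 0; first by rewrite cos0 subrr normr0.
have [] := @MVT_segment _ cos (- sin) 0 x x0 (fun y _ => _).
  by apply: continuous_subspaceT; exact: continuous_cos.
move=> c _; rewrite cos0 !subr0 => ->; rewrite normrM ler_piMl//= normrN; exact: sin_max.
Qed.

Lemma normr_cos1_le2 x : `|cos x - 1| <= x ^+ 2.
Proof.
wlog x0 : x / 0 <= x => [hw|].
  have [/hw//|x0] := leP 0 x.
  by rewrite -cosN -(sqrrN x) hw// oppr_ge0 ltW.
have [->|xn0] := eqVneq x 0; first by rewrite cos0 subrr normr0 expr0n.
have [] := @MVT_segment _ cos (- sin) 0 x x0 (fun y _ => _).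
  by apply: continuous_subspaceT; exact: continuous_cos.
move=> c; rewrite in_itv/= => /andP[c0 cx].
rewrite cos0 !subr0 => ->; rewrite normrM expr2 (ger0_norm x0) ler_wpM2r//=.
by rewrite normrN (le_trans (normr_sin_le _))// ger0_norm.
Qed.

Lemma normr_sinB_le2 x : `|sin x - x| <= x ^+ 2.
Proof.
wlog x0 : x / 0 <= x => [hw|].
  have [/hw//|x0] := leP 0 x.
  rewrite -normrN opprB -(sqrrN x) (_ : x - _ = sin (- x) - - x).
    by rewrite hw// oppr_ge0 ltW.
  by rewrite sinN opprK addrC.
have [] := @MVT_segment _ (fun y : R => sin y - y) (fun y => cos y - 1) 0 x x0 (fun y _ => _).
  by apply: continuous_subspaceT => y; apply: cvgB; [exact: continuous_sin|exact: cvg_id].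
move=> c; rewrite in_itv/= => /andP[c0 cx].
rewrite sin0 !subr0 => ->; rewrite normrM expr2 (ger0_norm x0) ler_wpM2r//=.
by rewrite (le_trans (normr_cos1_le _))// ger0_norm.
Qed.

(** With b = x + i y, the real part is e^x (cos y - 1) + (e^x - 1 - x) and the imaginary part e^x
    (sin y - y) + (e^x - 1) y; the real estimates above bound each term by a quadratic expression
    times exp |b|, and |x| |y| is absorbed into x^2 + y^2. The constant 4 is not sharp. *)
Lemma cexp_taylor1 b :
  normc (cexp b - 1 - b) <= 4 * normc b ^+ 2 * expR (normc b).
Proof.
set x := Re b; set y := Im b.
have E1 : 1 <= expR (normc b) by rewrite expR_ge1r normc_ge0.
have Ex : expR `|x| <= expR (normc b) by rewrite ler_expR normr_Re_le.
have Ex' : expR x <= expR (normc b).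
  by rewrite ler_expR (le_trans (ler_norm _))// normr_Re_le.
have xb := normr_Re_le b; have yb := normr_Im_le b.
have x2 : x ^+ 2 = `|x| ^+ 2 by rewrite real_normK// num_real.
have y2 : y ^+ 2 = `|y| ^+ 2 by rewrite real_normK// num_real.
have hx : 0 <= `|x| by []. have hy : 0 <= `|y| by [].
have n2 : normc b ^+ 2 = `|x| ^+ 2 + `|y| ^+ 2 by rewrite sqr_normcE -x2 -y2.
have e0 := expR_gt0 x.
apply: (le_trans (normc_le_ReIm _)).
have -> : Re (cexp b - 1 - b) = expR x * (cos y - 1) + (expR x - 1 - x).
  by rewrite !ReB /cexp /= -/x -/y; ring.
have -> : Im (cexp b - 1 - b) = expR x * (sin y - y) + (expR x - 1) * y.
  by rewrite !ImB /cexp /= -/x -/y; ring.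
apply: (@le_trans _ _ ((expR x * y ^+ 2 + x ^+ 2 * expR `|x|) +
   (expR x * y ^+ 2 + `|x| * expR `|x| * `|y|))).
  apply: lerD; apply: (le_trans (ler_normD _ _)); apply: lerD.
  - by rewrite normrM (gtr0_norm e0) ler_wpM2l ?(ltW e0)// normr_cos1_le2.
  - exact: normr_expR2_le.
  - by rewrite normrM (gtr0_norm e0) ler_wpM2l ?(ltW e0)// normr_sinB_le2.
  - by rewrite normrM ler_wpM2r// normr_expR1_le.
rewrite x2 y2 n2.
set E := expR (normc b) in E1 Ex Ex' *.
have : expR x * `|y| ^+ 2 <= E * `|y| ^+ 2 by rewrite ler_wpM2r// sqr_ge0.
have : `|x| ^+ 2 * expR `|x| <= `|x| ^+ 2 * E by rewrite ler_wpM2l// sqr_ge0.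
have : `|x| * expR `|x| * `|y| <= `|x| * E * `|y|.
  by rewrite ler_wpM2r// ler_wpM2l.
have : 0 <= E * (`|x| - `|y|) ^+ 2.
  by rewrite mulr_ge0 ?sqr_ge0// (le_trans ler01).
have : 0 <= E * `|x| ^+ 2 by rewrite mulr_ge0 ?sqr_ge0// (le_trans ler01).
have : 0 <= E * `|y| ^+ 2 by rewrite mulr_ge0 ?sqr_ge0// (le_trans ler01).
nra.
Qed.

End complex_exponential.

(** * Goursat's theorem for closed forms on rectangles *)

Section bisection.
Context {R : realType}.
Variable good : R -> R -> R -> R -> Prop.
Hypothesis good_glue : forall a b c d, a <= b -> c <= d ->
  good a ((a + b) / 2) c ((c + d) / 2) ->
  good ((a + b) / 2) b c ((c + d) / 2) ->
  good a ((a + b) / 2) ((c + d) / 2) d ->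
  good ((a + b) / 2) b ((c + d) / 2) d -> good a b c d.
Hypothesis good_local : forall x y, exists2 e : R, 0 < e & forall a b c d,
  a <= x <= b -> c <= y <= d -> b - a < e -> d - c < e -> good a b c d.

Lemma nested_intervals (a b : R^nat) :
  (forall k, a k <= b k) -> (forall k, a k <= a k.+1) ->
  (forall k, b k.+1 <= b k) -> exists x, forall k, a k <= x <= b k.
Proof.
move=> ab a1 b1.
have am j k : (j <= k)%N -> a j <= a k.
  by move=> jk; have /nondecreasing_seqP := a1; apply.
have bm j k : (j <= k)%N -> b k <= b j.
  by move=> jk; have /nonincreasing_seqP := b1; apply.
have ajbk j k : a j <= b k.
  apply: (le_trans (am _ _ (leq_maxl j k))); apply: (le_trans (ab _)).
  exact: bm (leq_maxr j k).
exists (sup (range a)) => k; apply/andP; split.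
  by apply: ub_le_sup; [exists (b 0%N) => _ [j _ <-]|exists k].
by apply: ge_sup; [exists (a 0%N); exists 0%N|move=> _ [j _ <-]].
Qed.

(** If a rectangle is not good, gluing makes one of its quarters not good. Iterating gives nested
    bad rectangles that shrink to a point (x, y), where [good_local] is contradicted. *)
Lemma rect_bisection a b c d : a <= b -> c <= d -> good a b c d.
Proof.
move=> ab cd; apply: contrapT => ngood.
pose ok (r : R * R * (R * R)) := [/\ r.1.1 <= r.1.2, r.2.1 <= r.2.2 &
  ~ good r.1.1 r.1.2 r.2.1 r.2.2].
pose sub (r r' : R * R * (R * R)) :=
  [/\ r.1.1 <= r'.1.1, r'.1.2 <= r.1.2, r.2.1 <= r'.2.1 & r'.2.2 <= r.2.2] /\
  (r'.1.2 - r'.1.1 = (r.1.2 - r.1.1) / 2 /\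
   r'.2.2 - r'.2.1 = (r.2.2 - r.2.1) / 2).
(* Stated for every r, with [ok r] as a premise, so that [choice] yields a total successor function;
   its values off bad rectangles are arbitrary. *)
have step r : exists r', ok r -> ok r' /\ sub r r'.
  have [okr|nok] := pselect (ok r); last by exists r => /nok.
  case: (okr); case: r okr => -[a' b'] [c' d'] /= okr ab' cd' ng.
  suff [r' Hr'] : exists r', ok r' /\ sub (a', b', (c', d')) r' by exists r'.
  set m := (a' + b') / 2; set n := (c' + d') / 2.
  have am : a' <= m by rewrite /m; lra.
  have mb : m <= b' by rewrite /m; lra.
  have cn : c' <= n by rewrite /n; lra.
  have nd : n <= d' by rewrite /n; lra.
  have [h1|h1] := pselect (good a' m c' n); last first.
    by exists (a', m, (c', n)); split=> //; do ![split] => //=; rewrite /m /n; lra.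
  have [h2|h2] := pselect (good m b' c' n); last first.
    by exists (m, b', (c', n)); split=> //; do ![split] => //=; rewrite /m /n; lra.
  have [h3|h3] := pselect (good a' m n d'); last first.
    by exists (a', m, (n, d')); split=> //; do ![split] => //=; rewrite /m /n; lra.
  have [h4|h4] := pselect (good m b' n d'); last first.
    by exists (m, b', (n, d')); split=> //; do ![split] => //=; rewrite /m /n; lra.
  by exfalso; exact/ng/good_glue.
have [next nextP] := choice step.
pose r k := iter k next (a, b, (c, d)).
have okr k : ok (r k).
  by elim: k => [|k ih]; [split|have [] := nextP _ ih].
have subr k : sub (r k) (r k.+1) by have [] := nextP _ (okr k).
have [x xP] := @nested_intervals (fun k => (r k).1.1) (fun k => (r k).1.2)
  (fun k => let: And3 h _ _ := okr k in h)
  (fun k => let: And4 h _ _ _ := (subr k).1 in h)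
  (fun k => let: And4 _ h _ _ := (subr k).1 in h).
have [y yP] := @nested_intervals (fun k => (r k).2.1) (fun k => (r k).2.2)
  (fun k => let: And3 _ h _ := okr k in h)
  (fun k => let: And4 _ _ h _ := (subr k).1 in h)
  (fun k => let: And4 _ _ _ h := (subr k).1 in h).
have w1 k : (r k).1.2 - (r k).1.1 = (b - a) / 2 ^+ k.
  elim: k => [|k ih]; first by rewrite expr0 divr1.
  by rewrite (subr k).2.1 ih exprSr invfM mulrA.
have w2 k : (r k).2.2 - (r k).2.1 = (d - c) / 2 ^+ k.
  elim: k => [|k ih]; first by rewrite expr0 divr1.
  by rewrite (subr k).2.2 ih exprSr invfM mulrA.
have [e e0 eP] := good_local x y.
(* Since k < 2^k, the Archimedean bound of u / e serves as N. *)
have small (u : R) : 0 <= u -> exists N, forall k, (N <= k)%N -> u / 2 ^+ k < e.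
  move=> u0; exists (Num.bound (u / e)) => k Nk.
  rewrite ltr_pdivrMr ?exprn_gt0// -ltr_pdivrMl// mulrC.
  have := archi_boundP (divr_ge0 u0 (ltW e0)) => /lt_le_trans; apply.
  rewrite -natrX ler_nat (leq_trans Nk)// ltnW// ltn_expl//.
have [N1 h1] : exists N, forall k, (N <= k)%N -> (b - a) / 2 ^+ k < e by apply: small; rewrite subr_ge0.
have [N2 h2] : exists N, forall k, (N <= k)%N -> (d - c) / 2 ^+ k < e by apply: small; rewrite subr_ge0.
have [_ _] := okr (maxn N1 N2); apply; apply: eP => //.
  by rewrite w1 h1// leq_maxl.
by rewrite w2 h2// leq_maxr.
Qed.

End bisection.

(** * Integrals of continuous functions over a segment *)

Section segment_integral.
Context {R : realType}.
Implicit Types (f g : R -> R) (a b c : R).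

Definition segint f a b : R := \int[lebesgue_measure]_(x in `[a, b]) f x.

Lemma segment_integrable f a b : continuous f ->
  lebesgue_measure.-integrable `[a, b] (EFin \o f).
Proof.
move=> cf; apply: continuous_compact_integrable; first exact: segment_compact.
exact: continuous_subspaceT.
Qed.

Lemma segint_split f a b c : continuous f -> a <= b -> b <= c ->
  segint f a c = segint f a b + segint f b c.
Proof.
move=> cf ab bc; rewrite /segint.
have := @Rintegral_itvB _ f (BLeft a) (BRight c) b (segment_integrable a c cf).
rewrite !bnd_simp => /(_ ab bc) H.
rewrite -[X in _ + X]Rintegral_itv_obnd_cbnd; last first.
  apply: integrableS (segment_integrable b c cf) => //.
  exact: subset_itv_oc_cc.
by rewrite -H addrC subrK.
Qed.

Lemma segintB f g a b : continuous f -> continuous g ->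
  segint (fun x => f x - g x) a b = segint f a b - segint g a b.
Proof. by move=> cf cg; apply: RintegralB => //; exact: segment_integrable. Qed.

Lemma segint_cst k a b : a <= b -> segint (fun=> k) a b = k * (b - a).
Proof.
by move=> ab; rewrite /segint Rintegral_cst//= lebesgue_measure_itv/=; case: ltP => //=;
  rewrite lee_fin => ba; rewrite (_ : b - a = 0)//; apply/eqP; rewrite subr_eq0 eq_le ab andbT.
Qed.

Lemma segint_near_cst f k e a b : a <= b -> continuous f ->
  (forall x, a <= x <= b -> `|f x - k| <= e) ->
  `|segint f a b - k * (b - a)| <= e * (b - a).
Proof.
move=> ab cf fk; rewrite -(segint_cst k ab) -(segint_cst e ab) -segintB//; last first.
  by move=> x; exact: cvg_cst.
have cfk : continuous (fun x => f x - k).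
  by move=> x; apply: cvgB; [exact: cf|exact: cvg_cst].
apply: le_trans; first by apply: le_normr_Rintegral => //; exact: segment_integrable.
apply: le_Rintegral => //.
- apply: segment_integrable => x; apply: cvg_norm; exact: cfk.
- by apply: segment_integrable => x; exact: cvg_cst.
Qed.

End segment_integral.

(** * Closed forms on rectangles *)

Section goursat.
Context {R : realType}.
Variables P Q : R -> R -> R.

(* Total differentiability of P and Q at (x0, y0), with dP/dy = dQ/dx: the
   1-form P dx + Q dy is closed there, without any continuity of the partial
   derivatives. *)
Definition closed_form_at (x0 y0 : R) := exists p m q : R,
  forall e, 0 < e -> exists2 d, 0 < d & forall x y,
    `|x - x0| < d -> `|y - y0| < d ->
    `|P x y - P x0 y0 - (p * (x - x0) + m * (y - y0))|
      <= e * (`|x - x0| + `|y - y0|) /\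
    `|Q x y - Q x0 y0 - (m * (x - x0) + q * (y - y0))|
      <= e * (`|x - x0| + `|y - y0|).

Hypothesis closedPQ : forall x y, closed_form_at x y.
Hypothesis contP : forall y, continuous (P ^~ y).
Hypothesis contQ : forall x, continuous (Q x).

(** Counterclockwise integral of P dx + Q dy along the boundary of [a, b] x [c, d], with opposite
    sides paired. *)
Let circulation a b c d : R :=
  segint (fun x => P x c - P x d) a b + segint (fun y => Q b y - Q a y) c d.

Let cPB c d : continuous (fun x => P x c - P x d).
Proof. by move=> x; apply: cvgB; exact: contP. Qed.
Let cQB a b : continuous (fun y => Q b y - Q a y).
Proof. by move=> x; apply: cvgB; exact: contQ. Qed.

Let circulation_split a b c d m n : a <= m -> m <= b -> c <= n -> n <= d ->
  circulation a b c d = circulation a m c n + circulation m b c n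
    + circulation a m n d + circulation m b n d.
Proof.
move=> am mb cn nd; rewrite /circulation.
rewrite (segint_split (@cPB c d) am mb) (segint_split (@cQB a b) cn nd).
do ! rewrite segintB//.
ring.
Qed.

(** The affine part of the form has circulation 0: its horizontal sides give m (c - d) (b - a) and
    its vertical sides m (b - a) (d - c), with the same m because the form is closed. With s the
    half-perimeter, the remainder is at most e s on each pair of sides, whose lengths add up to
    s. *)
Let circulation_small e x y : 0 < e -> exists2 r : R, 0 < r & forall a b c d,
  a <= x <= b -> c <= y <= d -> b - a < r -> d - c < r ->
  `|circulation a b c d| <= e * ((b - a) + (d - c)) ^+ 2.
Proof.
move=> e0; have [p [m [q]]] := closedPQ x y.
have e2 : 0 < e / 2 by rewrite divr_gt0.
move=> /(_ _ e2)[r r0 H]; exists r => // a b c d /andP[ax xb] /andP[cy yd] bar dcr.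
have ab := le_trans ax xb; have cd := le_trans cy yd.
set s := (b - a) + (d - c).
have near u v : a <= u <= b -> c <= v <= d ->
    [/\ `|u - x| < r, `|v - y| < r & `|u - x| + `|v - y| <= s].
  move=> /andP[au ub] /andP[cv vd].
  have hu : `|u - x| <= b - a by rewrite ler_norml; apply/andP; split; lra.
  have hv : `|v - y| <= d - c by rewrite ler_norml; apply/andP; split; lra.
  split; [exact: le_lt_trans hu _|exact: le_lt_trans hv _|exact: lerD].
have HP u v : a <= u <= b -> c <= v <= d ->
    `|P u v - P x y - (p * (u - x) + m * (v - y))| <= e / 2 * s.
  move=> hu hv; have [h1 h2 h3] := near _ _ hu hv; have [h _] := H _ _ h1 h2.
  by apply: (le_trans h); rewrite ler_wpM2l// ltW.
have HQ u v : a <= u <= b -> c <= v <= d ->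
    `|Q u v - Q x y - (m * (u - x) + q * (v - y))| <= e / 2 * s.
  move=> hu hv; have [h1 h2 h3] := near _ _ hu hv; have [_ h] := H _ _ h1 h2.
  by apply: (le_trans h); rewrite ler_wpM2l// ltW.
have h1 : `|segint (fun x => P x c - P x d) a b - m * (c - d) * (b - a)|
    <= e * s * (b - a).
  apply: segint_near_cst => // u hu.
  have k1 := HP _ _ hu (introT andP (conj (lexx c) cd)).
  have k2 := HP _ _ hu (introT andP (conj cd (lexx d))).
  rewrite (_ : _ - _ = (P u c - P x y - (p * (u - x) + m * (c - y))) -
    (P u d - P x y - (p * (u - x) + m * (d - y)))); last by ring.
  apply: (le_trans (ler_normB _ _)); apply: (le_trans (lerD k1 k2)); lra.
have h2 : `|segint (fun y => Q b y - Q a y) c d - m * (b - a) * (d - c)|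
    <= e * s * (d - c).
  apply: segint_near_cst => // v hv.
  have k1 := HQ _ _ (introT andP (conj (lexx a) ab)) hv.
  have k2 := HQ _ _ (introT andP (conj ab (lexx b))) hv.
  rewrite (_ : _ - _ = (Q b v - Q x y - (m * (b - x) + q * (v - y))) -
    (Q a v - Q x y - (m * (a - x) + q * (v - y)))); last by ring.
  apply: (le_trans (ler_normB _ _)); apply: (le_trans (lerD k2 k1)); lra.
rewrite /circulation; set I1 := segint _ _ _ in h1 *; set I2 := segint _ _ _ in h2 *.
rewrite (_ : I1 + I2 = (I1 - m * (c - d) * (b - a)) + (I2 - m * (b - a) * (d - c))); last by ring.
by apply: (le_trans (ler_normD _ _)); apply: (le_trans (lerD h1 h2)); rewrite -mulrDr expr2 mulrA.
Qed.

Lemma goursat_rectangle a b c d : a <= b -> c <= d ->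
  segint (fun x => P x c) a b + segint (Q b) c d =
  segint (fun x => P x d) a b + segint (Q a) c d.
Proof.
move=> ab cd; suff : circulation a b c d = 0.
  by rewrite /circulation !segintB// => h; lra.
apply/eqP; rewrite -normr_le0; apply/ler_addgt0Pr => e e0; rewrite add0r.
(* The + 1 keeps the denominator positive for a degenerate rectangle. *)
pose e' := e / (((b - a) + (d - c)) ^+ 2 + 1).
have s2 : 0 < ((b - a) + (d - c)) ^+ 2 + 1 by rewrite ltr_wpDl ?sqr_ge0.
have e'0 : 0 < e' by rewrite divr_gt0.
apply: (@le_trans _ _ (e' * ((b - a) + (d - c)) ^+ 2)); last first.
  rewrite /e' mulrAC ler_pdivrMr// ler_pM2l//; lra.
apply: (@rect_bisection _ (fun a b c d =>
  `|circulation a b c d| <= e' * ((b - a) + (d - c)) ^+ 2)) => //; last first.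
  by move=> x y; exact: circulation_small.
move: e' e'0 => e' e'0 {ab cd s2} {}a {}b {}c {}d ab cd; set m := (a + b) / 2; set n := (c + d) / 2.
have am : a <= m by rewrite /m; lra.
have mb : m <= b by rewrite /m; lra.
have cn : c <= n by rewrite /n; lra.
have nd : n <= d by rewrite /n; lra.
rewrite (circulation_split am mb cn nd) => h1 h2 h3 h4.
apply: (le_trans (ler_normD _ _)); apply: (le_trans (lerD (ler_normD _ _) h4)).
apply: (le_trans (lerD (lerD (ler_normD _ _) h3) (lexx _))).
apply: (le_trans (lerD (lerD (lerD h1 h2) (lexx _)) (lexx _))).
(* The half-perimeter s of a quarter is half that of the whole, so the four bounds add up exactly: 4
   (s / 2)^2 = s^2. *)
by rewrite /m /n -!mulrDr ler_wpM2l ?(ltW e'0)//; lra.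
Qed.

End goursat.

(** * Complex differentiability on C^n *)

Section row_norm.
Context {R : realType} {n : nat}.
Implicit Types (z v : 'rV[R[i]]_n) (h : 'rV[R[i]]_n -> R[i]).

(** The norm of a row is the largest modulus of its entries, as an element of [R[i]]; its real part
    is the same number in [R]. *)
Definition rnorm z : R := Re `|z|.

Lemma rnormE z : `|z| = (rnorm z)%:C.
Proof. by have := normr_ge0 z; rewrite /rnorm; case: `|z| => x y; rewrite lecE/= => /andP[/eqP ->]. Qed.

Lemma rnorm_ge0 z : 0 <= rnorm z.
Proof. by rewrite -lecR -rnormE normr_ge0. Qed.

Lemma rnormZ (c : R[i]) z : rnorm (c *: z) = normc c * rnorm z.
Proof.
by apply: complexI; rewrite -rnormE normrZ normrE rnormE -rmorphM.
Qed.

Lemma normc_coord_le z j : normc (z ord0 j) <= rnorm z.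
Proof.
rewrite -lecR -normrE -rnormE [leRHS]/Num.norm/= mx_normE.
exact: (@le_bigmax _ {nonneg R[i]} _ _ (fun i => `|z i.1 i.2|%:nng) (ord0, j)).
Qed.

Lemma rnorm_lt z (e : R) : 0 < e -> (forall j, normc (z ord0 j) < e) ->
  rnorm z < e.
Proof.
move=> e0 H; rewrite -ltcR -rnormE.
have := @mx_norm_ball R[i] 1 n; rewrite /ball_ => Hb.
have : ball (0 : 'rV[R[i]]_n) e%:C (- z).
  split; first by rewrite ltcR.
  move=> i j; rewrite !mxE /ball/= sub0r opprK (ord1 i).
  by rewrite normrE ltcR.
by rewrite Hb /= sub0r opprK.
Qed.

Lemma nbhs0_rnormP (A : set 'rV[R[i]]_n) :
  nbhs (0 : 'rV[R[i]]_n) A <->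
  exists2 e : R, 0 < e & forall v, rnorm v < e -> A v.
Proof.
split=> [/nbhs_ballP[e /= e0 eA]|[e e0 eA]].
  have eE : e = (Re e)%:C by case: e e0 {eA} => a b; rewrite ltcE/= => /andP[/eqP ->].
  exists (Re e); first by rewrite -ltcR -eE.
  move=> v ve; apply: eA; rewrite mx_norm_ball /ball_/= sub0r normrN rnormE eE.
  by rewrite ltcR.
apply/nbhs_ballP; exists e%:C; first by rewrite /= ltcR.
move=> v; rewrite mx_norm_ball /ball_/= sub0r normrN rnormE ltcR; exact: eA.
Qed.

(** Translates the little-o of the differential, whose radii are positive elements of [R[i]], into
    epsilon-delta form over [R]. *)
Lemma entire_taylor1 h z : entire h ->
  exists D : {linear 'rV[R[i]]_n -> R[i]}, forall e : R, 0 < e ->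
  exists2 d : R, 0 < d & forall v, rnorm v < d ->
    normc (h (z + v) - h z - D v) <= e * rnorm v.
Proof.
move=> /(_ z) /diff_locallyP[_ /eqaddoP hD]; exists ('d h z) => e e0.
have /nbhs0_rnormP[d d0 dP] := hD e%:C (eq_ind_r is_true e0 (ltcR 0 e)).
exists d => // v vd.
have := dP v vd; rewrite /= !fctE /= /shift /= normrE rnormE -rmorphM lecR.
by rewrite opprD addrA [v + z]addrC.
Qed.

Lemma differentiable_taylor1 h z (D : {linear 'rV[R[i]]_n -> R[i]}) :
  continuous D -> (forall e : R, 0 < e ->
  exists2 d : R, 0 < d & forall v, rnorm v < d ->
    normc (h (z + v) - h z - D v) <= e * rnorm v) -> differentiable h z.
Proof.
move=> cD H.
have hD e : 0 < e -> \forall v \near (0 : 'rV[R[i]]_n),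
    `|(h \o shift z - (cst (h z) + D)) v| <= e * `|v|.
  move=> e0.
  have eE : e = (Re e)%:C by case: e e0 => a b; rewrite ltcE/= => /andP[/eqP ->].
  have [|d d0 dP] := H (Re e); first by rewrite -ltcR -eE.
  apply/nbhs0_rnormP; exists d => // v vd.
  have := dP v vd; rewrite eE /= !fctE /= /shift /= normrE rnormE -rmorphM lecR.
  by rewrite opprD addrA [v + z]addrC.
have E : 'd h z = D :> (_ -> _) by apply: (diff_unique cD); apply/eqaddoP.
by apply/diff_locallyP; split; rewrite E //; apply/eqaddoP.
Qed.

End row_norm.

(** * Circle means of entire functions *)

Section circle_mean.
Context {R : realType} {n : nat}.
Variables (h : 'rV[R[i]]_n -> R[i]) (z : 'rV[R[i]]_n).
Hypothesis entire_h : entire h.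

(** In these coordinates the circle of radius e^s through multiples of z becomes the segment
    [-pi, pi] at abscissa s. *)
Let u (s y : R) : R[i] := h (cexp (s +i* y) *: z).

(** Chain rule: with c = exp(s0 + i y0) and b the increment, e^b - 1 = b + r with r quadratic in b,
    so the derivative is D (c z). *)
Let u_differentiable s0 y0 : exists L : R[i], forall e : R, 0 < e ->
  exists2 d, 0 < d & forall s y, `|s - s0| < d -> `|y - y0| < d ->
    normc (u s y - u s0 y0 - L * ((s - s0) +i* (y - y0)))
      <= e * (`|s - s0| + `|y - y0|).
Proof.
set c := cexp (s0 +i* y0).
have [D DP] := entire_taylor1 (c *: z) entire_h.
exists (D (c *: z)) => e e0.
pose E : R := expR 1.
(* The displacement v = (e^b - 1) c z satisfies |v| <= M |b|, and [N] below bounds the contribution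
   of r by N |b|^2; each error is granted half of e. The + 1 in M + 1 and N + 1 avoids a zero
   denominator. *)
pose M := normc c * rnorm z * (1 + 4 * E).
have E0 : 0 < E := expR_gt0 1.
have M0 : 0 <= M by rewrite !mulr_ge0 ?normc_ge0 ?rnorm_ge0// addr_ge0// mulr_ge0// ltW.
have e10 : 0 < e / 2 / (M + 1) by rewrite !divr_gt0// ltr_wpDl.
have [d1 d10 d1P] := DP _ e10.
pose N := normc (D (c *: z)) * (4 * E).
have N0 : 0 <= N by rewrite mulr_ge0 ?normc_ge0// mulr_ge0// ltW.
(* Increments below d give |b| < 2 d. The bound 1 / 2 thus ensures |b| <= 1 and exp |b| <= E, the
   other two make M |b| < d1 and N |b| <= e / 2. *)
pose d := Num.min (1 / 2) (Num.min (d1 / (M + 1) / 2) (e / 2 / (N + 1) / 2)).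
have d0 : 0 < d.
  by rewrite !lt_min !divr_gt0//= ?ltr_wpDl.
exists d => // s y sd yd.
set b : R[i] := (s - s0) +i* (y - y0).
have b_le : normc b <= `|s - s0| + `|y - y0| := normc_le_ReIm b.
have b2d : normc b < 2 * d by apply: (le_lt_trans b_le); lra.
have dle1 : d <= 1 / 2 by rewrite /d ge_min lexx.
have dle2 : d <= d1 / (M + 1) / 2 by rewrite /d !ge_min lexx orbT.
have dle3 : d <= e / 2 / (N + 1) / 2 by rewrite /d !ge_min lexx !orbT.
have b1 : normc b <= 1 by lra.
have b0 := normc_ge0 b.
have Eb : expR (normc b) <= E by rewrite ler_expR.
pose r := cexp b - 1 - b.
have r_le : normc r <= 4 * E * normc b ^+ 2.
  apply: (le_trans (cexp_taylor1 b)).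
  by rewrite mulrAC ler_wpM2r ?sqr_ge0// ler_wpM2l.
have e1_le : normc (cexp b - 1) <= (1 + 4 * E) * normc b.
  have -> : cexp b - 1 = b + r by rewrite /r; ring.
  apply: (le_trans (le_normcD _ _)); apply: (le_trans (lerD (lexx _) r_le)).
  rewrite [leRHS]mulrDl mul1r lerD2l expr2 mulrA ler_piMr// !mulr_ge0//; exact: ltW.
pose v := (cexp b - 1) *: (c *: z).
have uE : u s y = h (c *: z + v).
  rewrite /u (_ : s +i* y = b + (s0 +i* y0)).
    rewrite cexpD -/c -scalerA /v scalerBl scale1r addrC subrK //.
  by apply: complexP; rewrite ?ReD ?ImD /= subrK.
have v_le : rnorm v <= M * normc b.
  rewrite /v !rnormZ /M.
  have -> : normc c * rnorm z * (1 + 4 * E) * normc b =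
     ((1 + 4 * E) * normc b) * (normc c * rnorm z) by ring.
  by rewrite ler_wpM2r// mulr_ge0 ?normc_ge0 ?rnorm_ge0.
have M1b : (M + 1) * normc b < d1.
  by rewrite -ltr_pdivlMl ?ltr_wpDl// mulrC; lra.
have N1b : (N + 1) * normc b <= e / 2.
  by rewrite -ler_pdivlMl ?ltr_wpDl// mulrC; lra.
have vd1 : rnorm v < d1 by apply: (le_lt_trans v_le); lra.
have := d1P v vd1; rewrite -uE -/(u s0 y0) => H1.
have -> : u s y - u s0 y0 - D (c *: z) * b =
   (u s y - u s0 y0 - D v) + D (c *: z) * r.
  have -> : D v = (cexp b - 1) * D (c *: z) by rewrite /v linearZ.
  by rewrite /r; ring.
apply: (le_trans (le_normcD _ _)).
apply: (@le_trans _ _ (e * normc b)); last by rewrite ler_wpM2l// ltW.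
have -> : e * normc b = e / 2 * normc b + e / 2 * normc b by field.
apply: lerD.
  apply: (le_trans H1).
  apply: (@le_trans _ _ (e / 2 / (M + 1) * ((M + 1) * normc b))); last first.
    by rewrite mulrA divfK// gt_eqF// ltr_wpDl.
  rewrite ler_wpM2l ?(ltW e10)//; lra.
rewrite ComplexField.Normc.normcM.
apply: (@le_trans _ _ (normc (D (c *: z)) * (4 * E * normc b ^+ 2))).
  by rewrite ler_wpM2l// normc_ge0.
rewrite mulrA -/N expr2 mulrA ler_wpM2r//; lra.
Qed.

Let u_continuous s0 y0 : exists2 K : R, 0 <= K & exists2 d : R, 0 < d &
  forall s y, `|s - s0| < d -> `|y - y0| < d ->
    normc (u s y - u s0 y0) <= K * (`|s - s0| + `|y - y0|).
Proof.
have [L LP] := u_differentiable s0 y0.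
have [d d0 dP] := LP 1 ltr01.
exists (normc L + 1); first by rewrite addr_ge0 ?normc_ge0.
exists d => // s y sd yd.
set b : R[i] := (s - s0) +i* (y - y0) in dP.
rewrite -(subrK (L * ((s - s0) +i* (y - y0))) (u s y - u s0 y0)).
apply: (le_trans (le_normcD _ _)); rewrite addrC mulrDl.
apply: lerD; last exact: dP.
rewrite ComplexField.Normc.normcM ler_wpM2l ?normc_ge0//.
exact: (normc_le_ReIm ((s - s0) +i* (y - y0))).
Qed.

Let continuous_lip (f : R -> R) x0 K d : 0 <= K -> 0 < d ->
  (forall x, `|x - x0| < d -> `|f x - f x0| <= K * `|x - x0|) ->
  {for x0, continuous f}.
Proof.
move=> K0 d0 H; apply/cvgrPdist_lt => e e0.
near=> x; rewrite distrC; apply: le_lt_trans (H _ _) _.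
  by rewrite distrC; near: x; exact: cvgr_dist_lt.
apply: (@le_lt_trans _ _ ((K + 1) * `|x - x0|)); first by rewrite ler_wpM2r// lerDl.
rewrite -ltr_pdivlMl ?ltr_wpDl// distrC; near: x; apply: cvgr_dist_lt => //.
by rewrite mulr_gt0// invr_gt0 ltr_wpDl.
Unshelve. all: by end_near. Qed.

Let contRe s : continuous (fun y => Re (u s y)).
Proof.
move=> y0; have [K K0 [d d0 dP]] := u_continuous s y0.
apply: (continuous_lip K0 d0) => y yd; rewrite -ReB.
apply: (le_trans (normr_Re_le _)); have := dP s y.
by rewrite subrr normr0 add0r; exact.
Qed.

Let contIm s : continuous (fun y => Im (u s y)).
Proof.
move=> y0; have [K K0 [d d0 dP]] := u_continuous s y0.
apply: (continuous_lip K0 d0) => y yd; rewrite -ImB.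
apply: (le_trans (normr_Im_le _)); have := dP s y.
by rewrite subrr normr0 add0r; exact.
Qed.

Let contRe' y : continuous (fun s => Re (u s y)).
Proof.
move=> s0; have [K K0 [d d0 dP]] := u_continuous s0 y.
apply: (continuous_lip K0 d0) => s yd; rewrite -ReB.
apply: (le_trans (normr_Re_le _)); have := dP s y.
by rewrite subrr normr0 addr0; exact.
Qed.

Let contIm' y : continuous (fun s => Im (u s y)).
Proof.
move=> s0; have [K K0 [d d0 dP]] := u_continuous s0 y.
apply: (continuous_lip K0 d0) => s yd; rewrite -ImB.
apply: (le_trans (normr_Im_le _)); have := dP s y.
by rewrite subrr normr0 addr0; exact.
Qed.

Lemma continuous_circle_Re :
  continuous (fun y : R => Re (h (cexp (0 +i* y) *: z))).
Proof. exact: contRe. Qed.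

Lemma continuous_circle_Im :
  continuous (fun y : R => Im (h (cexp (0 +i* y) *: z))).
Proof. exact: contIm. Qed.

Let u_per s : u s pi = u s (- pi).
Proof. by rewrite /u /cexp/= cosN sinN sinpi oppr0. Qed.

Let pi_le : - pi <= pi :> R. Proof. have := pi_ge0 R; lra. Qed.

Let circ_cancel (x y w : R) : x + y = x + w -> w = y.
Proof. by move/addrI. Qed.

(** Goursat for the closed form Im u ds + Re u dy, the imaginary part of u (ds + i dy). As u has
    period 2 pi in y, the two horizontal sides cancel and the two vertical ones agree. *)
Let segint_Re_cst a b : a <= b ->
  segint (fun y => Re (u a y)) (- pi) pi = segint (fun y => Re (u b y)) (- pi) pi.
Proof.
move=> ab.
have closed s0 y0 : closed_form_at (fun s y => Im (u s y)) (fun s y => Re (u s y)) s0 y0.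
  have [L LP] := u_differentiable s0 y0.
  exists (Im L), (Re L), (- Im L) => e e0; have [d d0 dP] := LP e e0.
  exists d => // s y sd yd; have := dP s y sd yd; set w := (X in normc X) => H.
  split; (apply: le_trans H; apply: le_trans; last first);
    [exact: (normr_Im_le w)| |exact: (normr_Re_le w)|].
  - by rewrite /w !ImB ImM /= le_eqVlt; apply/orP; left; apply/eqP; congr `|_|; ring.
  - by rewrite /w !ReB ReM /= le_eqVlt; apply/orP; left; apply/eqP; congr `|_|; ring.
have := @goursat_rectangle R (fun s y => Im (u s y)) (fun s y => Re (u s y))
  closed contIm' contRe a b (- pi) pi ab pi_le.
have -> : (fun x => Im (u x pi)) = (fun x => Im (u x (- pi))).
  by apply/funext => x; rewrite u_per.
exact: circ_cancel.
Qed.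

(** The same with minus the real part of u (ds + i dy), which is - Re u ds + Im u dy. *)
Let segint_Im_cst a b : a <= b ->
  segint (fun y => Im (u a y)) (- pi) pi = segint (fun y => Im (u b y)) (- pi) pi.
Proof.
move=> ab.
have closed s0 y0 : closed_form_at (fun s y => - Re (u s y)) (fun s y => Im (u s y)) s0 y0.
  have [L LP] := u_differentiable s0 y0.
  exists (- Re L), (Im L), (Re L) => e e0; have [d d0 dP] := LP e e0.
  exists d => // s y sd yd; have := dP s y sd yd; set w := (X in normc X) => H.
  split; (apply: le_trans H; apply: le_trans; last first);
    [exact: (normr_Re_le w)| |exact: (normr_Im_le w)|].
  - rewrite /w !ReB ReM /= le_eqVlt; apply/orP; left; apply/eqP.
    by rewrite -normrN; congr `|_|; ring.
  - by rewrite /w !ImB ImM /= le_eqVlt; apply/orP; left; apply/eqP; congr `|_|; ring.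
have contN y : continuous (fun s => - Re (u s y)).
  by move=> s; apply: cvgN; exact: contRe'.
have := @goursat_rectangle R (fun s y => - Re (u s y)) (fun s y => Im (u s y))
  closed contN contIm a b (- pi) pi ab pi_le.
have -> : (fun x => - Re (u x pi)) = (fun x => - Re (u x (- pi))).
  by apply/funext => x; rewrite u_per.
exact: circ_cancel.
Qed.

Let u_near0 e : 0 < e -> exists s0, s0 <= 0 /\ forall y, normc (u s0 y - h 0) <= e.
Proof.
move=> e0; have /cvgrPdist_le := differentiable_continuous (entire_h 0).
move=> /(_ e%:C); rewrite ltcR => /(_ e0) /nbhs0_rnormP[d d0 dP].
have rz : 0 < rnorm z + 1 by rewrite ltr_wpDl// rnorm_ge0.
(* With this s0 the whole circle lies within d / 2 of the origin; the minimum with 0 orders the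
   sides of the rectangle as s0 <= 0. *)
exists (Num.min 0 (ln (d / 2 / (rnorm z + 1)))); split; first by rewrite ge_min lexx.
move=> y; rewrite normcB -lecR -normrE; apply: dP.
rewrite rnormZ normc_cexp /=.
apply: (@le_lt_trans _ _ (d / 2)); last by lra.
apply: (@le_trans _ _ (d / 2 / (rnorm z + 1) * (rnorm z + 1))).
  apply: ler_pM; rewrite ?expR_ge0 ?rnorm_ge0//; last by lra.
  rewrite -[leRHS]lnK ?posrE ?divr_gt0// ler_expR ge_min lexx orbT //.
by rewrite divfK// gt_eqF.
Qed.

(** Constancy in s moves the mean to a circle so small that h differs from h 0 by at most e / (2 pi)
    on it. *)
Lemma circle_mean_Re :
  segint (fun y => Re (h (cexp (0 +i* y) *: z))) (- pi) pi = 2 * pi * Re (h 0).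
Proof.
have pi2 : pi - - pi = 2 * pi :> R by ring.
have pi0 : 0 < pi :> R := pi_gt0 R.
apply/eqP; rewrite -subr_eq0 -normr_le0; apply/ler_addgt0Pr => e e0; rewrite add0r.
have e'0 : 0 < e / (2 * pi) by rewrite divr_gt0// mulr_gt0.
have [s0 [s00 s0P]] := u_near0 e'0.
rewrite -/(u 0) -(segint_Re_cst s00) mulrC -pi2.
apply: (@le_trans _ _ (e / (2 * pi) * (pi - - pi))); last first.
  by rewrite pi2 divfK// gt_eqF// mulr_gt0.
apply: segint_near_cst => // y _; rewrite -ReB.
exact: le_trans (normr_Re_le _) (s0P y).
Qed.

Lemma circle_mean_Im :
  segint (fun y => Im (h (cexp (0 +i* y) *: z))) (- pi) pi = 2 * pi * Im (h 0).
Proof.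
have pi2 : pi - - pi = 2 * pi :> R by ring.
have pi0 : 0 < pi :> R := pi_gt0 R.
apply/eqP; rewrite -subr_eq0 -normr_le0; apply/ler_addgt0Pr => e e0; rewrite add0r.
have e'0 : 0 < e / (2 * pi) by rewrite divr_gt0// mulr_gt0.
have [s0 [s00 s0P]] := u_near0 e'0.
rewrite -/(u 0) -(segint_Im_cst s00) mulrC -pi2.
apply: (@le_trans _ _ (e / (2 * pi) * (pi - - pi))); last first.
  by rewrite pi2 divfK// gt_eqF// mulr_gt0.
apply: segint_near_cst => // y _; rewrite -ImB.
exact: le_trans (normr_Im_le _) (s0P y).
Qed.

End circle_mean.

(** * Product measures *)

Section tuple_measure_integral.
Context {d} {T : measurableType d} {R : realType}.
Variable m : {sigma_finite_measure set T -> \bar R}.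
Local Open Scope ereal_scope.

Lemma measurable_cons_tuple n :
  measurable_fun [set: T * n.-tuple T] (fun p => [tuple of p.1 :: p.2]).
Proof. by apply: measurable_cons. Qed.

Lemma ge0_integral_tuple_measureS n (phi : n.+1.-tuple T -> \bar R) :
  measurable_fun setT phi -> (forall t, 0 <= phi t) ->
  \int[tuple_measure m n.+1]_t phi t =
  \int[m]_x \int[tuple_measure m n]_y phi [tuple of x :: y].
Proof.
move=> mphi phi0; rewrite /=.
transitivity (\int[(m \x tuple_measure m n)]_p phi [tuple of p.1 :: p.2]).
  rewrite /cons_measure/= (ge0_integral_pushforward (@measurable_cons_tuple n))//.
rewrite fubini_tonelli1//.
by apply: measurableT_comp => //; exact: measurable_cons_tuple.
Qed.

Lemma ge0_integral_tuple_measure0 (phi : 0.-tuple T -> \bar R) :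
  measurable_fun setT phi -> (forall t, 0 <= phi t) ->
  \int[tuple_measure m 0]_t phi t = phi [tuple].
Proof. by move=> mphi phi0; rewrite integral_dirac// diracT mul1e. Qed.

(** Phrased with integrals of nonnegative functions rather than measures of sets, so that Tonelli
    passes invariance to products one coordinate at a time. *)
Definition preserves (f : T -> T) := measurable_fun setT f /\
  forall phi : T -> \bar R, measurable_fun setT phi -> (forall x, 0 <= phi x) ->
    \int[m]_x phi (f x) = \int[m]_x phi x.

Lemma measurable_tuple_map n (f : 'I_n -> T -> T) :
  (forall j, measurable_fun setT (f j)) ->
  measurable_fun setT (fun t : n.-tuple T => [tuple f j (tnth t j) | j < n]).
Proof.
move=> mf; apply/measurable_fun_tnthP => j.
rewrite (_ : _ \o _ = f j \o @tnth _ _ ^~ j).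
  by apply: measurableT_comp => //; exact: measurable_tnth.
by apply/funext => t /=; rewrite tnth_mktuple.
Qed.

(** Induction on n: Tonelli separates the head, invariance under the first map handles the outer
    integral, and the induction hypothesis the inner one. *)
Lemma ge0_integral_tuple_map n (f : 'I_n -> T -> T) (phi : n.-tuple T -> \bar R) :
  (forall j, preserves (f j)) ->
  measurable_fun setT phi -> (forall t, 0 <= phi t) ->
  \int[tuple_measure m n]_t phi [tuple f j (tnth t j) | j < n] =
  \int[tuple_measure m n]_t phi t.
Proof.
elim: n f phi => [|n ih] f phi pf mphi phi0.
  rewrite !ge0_integral_tuple_measure0//; first by rewrite tuple0.
  apply: measurableT_comp => //; apply: measurable_tuple_map => j.
  exact: (pf j).1.
rewrite !ge0_integral_tuple_measureS//; last first.
  apply: measurableT_comp => //; apply: measurable_tuple_map => j.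
  exact: (pf j).1.
have mphic : measurable_fun [set: T * n.-tuple T] (fun p => phi [tuple of p.1 :: p.2]).
  by apply: measurableT_comp => //; exact: measurable_cons_tuple.
rewrite -((pf ord0).2 (fun x => \int[tuple_measure m n]_y phi [tuple of x :: y])); last 2 first.
- exact: (@measurable_fun_fubini_tonelli_F _ _ _ _ _ (tuple_measure m n) _ mphic (fun=> phi0 _)).
- by move=> x; exact: integral_ge0.
apply: eq_integral => x _.
rewrite -(ih (fun j => f (lift ord0 j)) (fun y => phi [tuple of f ord0 x :: y]))//.
  apply: eq_integral => y _; congr phi; apply: eq_from_tnth => j.
  rewrite tnth_mktuple; case: (unliftP ord0 j) => [k ->|->].
    by rewrite !tnthS tnth_mktuple.
  by rewrite !tnth0.
exact: (measurableT_comp mphic (pair1_measurable (f ord0 x))).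
Qed.

Lemma ge0_integral_tuple_prod n (phi : T -> R) (I : R) :
  measurable_fun setT phi -> (forall t, 0 <= phi t)%R ->
  \int[m]_x (phi x)%:E = I%:E ->
  \int[tuple_measure m n]_t (\prod_j phi (tnth t j))%:E = (I ^+ n)%:E.
Proof.
move=> mphi phi0 phiI.
have mprod k : measurable_fun [set: k.-tuple T]
    (fun t => (\prod_j phi (tnth t j))%:E).
  apply/measurable_EFinP; apply: measurable_prod => j _.
  by apply: measurableT_comp => //; exact: measurable_tnth.
have prod0 k (t : k.-tuple T) : 0 <= (\prod_j phi (tnth t j))%:E.
  by rewrite lee_fin prodr_ge0.
elim: n => [|n ih]; first by rewrite ge0_integral_tuple_measure0// big_ord0.
rewrite ge0_integral_tuple_measureS//.
transitivity (\int[m]_x ((phi x)%:E * (I ^+ n)%:E)).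
  apply: eq_integral => x _; rewrite -ih -(ge0_integralZl _ measurableT (mprod n) (fun t _ => prod0 n t)) ?lee_fin//.
  apply: eq_integral => y _; rewrite big_ord_recl tnth0 -EFinM.
  by congr ((_ * _)%:E); apply: eq_bigr => j _; rewrite tnthS.
rewrite ge0_integralZr//; first by rewrite phiI exprS EFinM.
- exact/measurable_EFinP.
- by move=> x _; rewrite lee_fin.
- by rewrite lee_fin exprn_ge0// -lee_fin -phiI integral_ge0// => x _; rewrite lee_fin.
Qed.

End tuple_measure_integral.

(** * Invariance of planar Lebesgue measure under shears, translations and rotations *)

Section planar_lebesgue.
Context {R : realType}.
Local Open Scope ereal_scope.
Local Notation mu := (@lebesgue_measure R).
Local Notation mu2 := (product_measure mu mu).
Local Notation R2 := (measurableTypeR R * measurableTypeR R)%type.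

(** The image of Lebesgue measure under the shift gives half-open intervals their length, hence is
    Lebesgue measure by uniqueness. *)
Lemma ge0_integral_shift (a : R) (phi : R -> \bar R) :
  measurable_fun setT phi -> (forall x, 0 <= phi x) ->
  \int[mu]_x phi (x + a)%R = \int[mu]_x phi x.
Proof.
move=> mphi phi0.
have mshift : measurable_fun [set: measurableTypeR R]
   ((fun x => x + a)%R : measurableTypeR R -> measurableTypeR R).
  exact: measurable_funD.
rewrite -[LHS](ge0_integral_pushforward mshift mu measurableT)//.
apply: eq_measure_integral => A mA _; apply/esym/lebesgue_measure_unique => //=.
move=> _ [[b c]] _ <-; rewrite /pushforward/=.
rewrite (_ : _ @^-1` _ = `](b - a)%R, (c - a)%R]%classic); last first.
  by apply/seteqP; split=> x /=; rewrite !in_itv/= ltrBlDr lerBrDr.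
rewrite !lebesgue_measure_itv/= !lte_fin ltrD2r; case: ifP => // _.
by rewrite -!EFinB; congr (_%:E); ring.
Qed.

Lemma ge0_integral_prod2 (phi : R2 -> \bar R) :
  measurable_fun setT phi -> (forall x, 0 <= phi x) ->
  \int[mu2]_p phi p = \int[mu]_x \int[mu]_y phi (x, y).
Proof. by move=> mphi phi0; rewrite -fubini_tonelli1. Qed.

Lemma ge0_integral_prod2' (phi : R2 -> \bar R) :
  measurable_fun setT phi -> (forall x, 0 <= phi x) ->
  \int[mu2]_p phi p = \int[mu]_y \int[mu]_x phi (x, y).
Proof. by move=> mphi phi0; rewrite -fubini_tonelli2. Qed.

(** On each horizontal line a shear is a translation, so Tonelli reduces the claim to shifts of the
    line. *)
Lemma preserves_shear1 (f : R -> R) : measurable_fun setT f ->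
  preserves mu2 (fun p : R2 => (p.1 + f p.2, p.2)%R).
Proof.
move=> mf.
have ms : measurable_fun [set: R2] (fun p : R2 => (p.1 + f p.2, p.2)%R : R2).
  apply/measurable_fun_pair; last exact: measurable_snd.
  apply: measurable_funD; first exact: measurable_fst.
  by apply: measurableT_comp => //; exact: measurable_snd.
split=> // phi mphi phi0.
rewrite [LHS](ge0_integral_prod2' (phi := fun p : R2 => phi (p.1 + f p.2, p.2)%R))//; last first.
  exact: measurableT_comp.
rewrite ge0_integral_prod2'//; apply: eq_integral => y _ /=.
apply: (ge0_integral_shift (f y) (phi := fun x => phi (x, y))) => //.
exact: (measurableT_comp mphi (pair2_measurable y)).
Qed.

Lemma preserves_shear2 (f : R -> R) : measurable_fun setT f ->
  preserves mu2 (fun p : R2 => (p.1, p.2 + f p.1)%R).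
Proof.
move=> mf.
have ms : measurable_fun [set: R2] (fun p : R2 => (p.1, p.2 + f p.1)%R : R2).
  apply/measurable_fun_pair; first exact: measurable_fst.
  apply: measurable_funD; first exact: measurable_snd.
  by apply: measurableT_comp => //; exact: measurable_fst.
split=> // phi mphi phi0.
rewrite [LHS](ge0_integral_prod2 (phi := fun p : R2 => phi (p.1, p.2 + f p.1)%R))//; last first.
  exact: measurableT_comp.
rewrite ge0_integral_prod2//; apply: eq_integral => x _ /=.
apply: (ge0_integral_shift (f x) (phi := fun y => phi (x, y))) => //.
exact: (measurableT_comp mphi (pair1_measurable x)).
Qed.

Lemma preserves_comp (f g : R2 -> R2) :
  preserves mu2 f -> preserves mu2 g -> preserves mu2 (f \o g).
Proof.
move=> [mf pf] [mg pg]; split=> [|phi mphi phi0]; first exact: measurableT_comp.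
rewrite -(pf phi mphi phi0) -(pg (phi \o f) (measurableT_comp mphi mf))// => x.
exact: phi0.
Qed.

Lemma preserves_translation (a : R2) :
  preserves mu2 (fun p : R2 => (p.1 + a.1, p.2 + a.2)%R).
Proof.
exact: (preserves_comp (preserves_shear1 (measurable_cst a.1))
  (preserves_shear2 (measurable_cst a.2))).
Qed.

(* A rotation of angle different from pi is a product of three shears. *)
Lemma preserves_rotation (p q : R) : (p ^+ 2 + q ^+ 2 = 1)%R -> p != (-1)%R ->
  preserves mu2 (fun x : R2 => (p * x.1 - q * x.2, q * x.1 + p * x.2)%R).
Proof.
move=> pq p1.
have p1' : (1 + p)%R != 0%R by rewrite addrC -[X in (p + X)%R]opprK subr_eq0.
(* For p = cos theta and q = sin theta this is - tan(theta / 2), the slope of the first and third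
   shears; it is infinite at theta = pi. *)
pose a : R := (- q / (1 + p))%R.
have ml (k : R) : measurable_fun [set: R] (fun y : R => k * y)%R.
  by apply: measurable_funM.
have := preserves_comp (preserves_comp (preserves_shear1 (ml a)) (preserves_shear2 (ml q)))
  (preserves_shear1 (ml a)).
congr preserves; apply/funext => -[x y] /=.
have pa : (1 + q * a = p)%R.
  rewrite /a; apply: (mulIf p1'); rewrite mulrDl mulrA divfK//.
  by rewrite (_ : q * - q = p ^+ 2 - 1)%R; [ring|rewrite -pq; ring].
have qa : (a * (1 + p) = - q)%R by rewrite /a divfK.
congr pair.
  transitivity ((1 + q * a) * x + (a * (1 + (1 + q * a))) * y)%R; first by ring.
  by rewrite pa qa; ring.
transitivity (q * x + (1 + q * a) * y)%R; first by ring.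
by rewrite pa.
Qed.

End planar_lebesgue.

(** * Lebesgue and Gaussian measure on C^n *)

Section density.
Context {d} {T : measurableType d} {R : realType}.
Variables (mu nu : {measure set T -> \bar R}) (g : T -> R).
Hypotheses (mg : measurable_fun setT g) (g0 : forall x, 0 <= g x).
Local Open Scope ereal_scope.
Hypothesis nuE : forall A, measurable A -> nu A = \int[mu]_(x in A) (g x)%:E.

Import HBNNSimple.

Let ge0_integral_density_nnsfun (f : {nnsfun T >-> R}) :
  \int[nu]_x (f x)%:E = \int[mu]_x ((f x)%:E * (g x)%:E).
Proof.
under [RHS]eq_integral => x _.
  rewrite fimfunE -fsumEFin// ge0_mule_fsuml; last first.
    by move=> r; rewrite lee_fin; exact: nnfun_muleindic_ge0.
  over.
rewrite ge0_integral_fsum//; last 2 first.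
- move=> r; apply/measurable_EFinP/measurable_funM => //.
  by apply: measurable_funM => //; exact: measurable_indic.
- move=> r x _; apply: mule_ge0; last by rewrite lee_fin.
  by rewrite EFinM nnfun_muleindic_ge0.
rewrite integralT_nnsfun// sintegralE; apply: eq_fsbigr => r /[!inE] -[y _ <-].
rewrite nuE// [in LHS]integral_mkcond epatch_indic -ge0_integralZl//; last 3 first.
- apply/measurable_EFinP; apply: measurable_funM => //; exact: measurable_indic.
- by move=> x _; rewrite mule_ge0 ?lee_fin.
- by rewrite lee_fin.
by apply: eq_integral => x _ /=; rewrite EFinM -muleA; congr (_ * _); rewrite muleC.
Qed.

(** Holds for simple functions by [nuE] and linearity, then in general by monotone convergence on
    both sides. *)
Lemma ge0_integral_density (phi : T -> \bar R) :
  measurable_fun setT phi -> (forall x, 0 <= phi x) ->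
  \int[nu]_x phi x = \int[mu]_x (phi x * (g x)%:E).
Proof.
move=> mphi phi0; pose f_ := nnsfun_approx measurableT mphi.
have f_cvg x : (f_ n x)%:E @[n --> \oo] --> phi x.
  by apply: cvg_nnsfun_approx => // *; exact: phi0.
transitivity (limn (fun n => \int[nu]_x (f_ n x)%:E)).
  rewrite -monotone_convergence//.
  - by apply: eq_integral => x _; apply/esym/cvg_lim.
  - by move=> n; exact/measurable_EFinP.
  - by move=> n x _; rewrite lee_fin.
  - by move=> x _ m n mn; rewrite lee_fin; exact/lefP/nd_nnsfun_approx.
under eq_fun do rewrite ge0_integral_density_nnsfun.
rewrite -monotone_convergence//.
- apply: eq_integral => x _; apply/cvg_lim => //; apply: cvgeZr => //.
- move=> n; apply/measurable_EFinP; apply: measurable_funM => //.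
- by move=> n x _; rewrite mule_ge0 ?lee_fin.
- move=> x _ m n mn; rewrite lee_wpmul2r ?lee_fin//; exact/lefP/nd_nnsfun_approx.
Qed.

End density.

(** * Lebesgue measure on C^n: measurability, invariance and Gaussian integrals *)

Section lebesgue_Cn.
Context {R : realType} {n : nat}.
Local Notation lam := (@lebesgue_Cn R n).
Local Notation R2 := (measurableTypeR R * measurableTypeR R)%type.
Local Notation Cn := 'rV[R[i]]_n.

Lemma measurable_Re_coord (j : 'I_n) : measurable_fun setT (fun z : Cn => Re (z ord0 j)).
Proof.
have : measurable_fun setT ((fun z : Cn => Re (z ord0 j)) \o complex_of_tuple).
  apply: (eq_measurable_fun (fun x : n.-tuple R2 => (tnth x j).1)) => [x _|].
    by rewrite /= mxE.
  exact: (measurableT_comp measurable_fst (measurable_tnth j)).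
by move=> + _ A mA => /(_ measurableT A mA); rewrite !setTI.
Qed.

Lemma measurable_Im_coord (j : 'I_n) : measurable_fun setT (fun z : Cn => Im (z ord0 j)).
Proof.
have : measurable_fun setT ((fun z : Cn => Im (z ord0 j)) \o complex_of_tuple).
  apply: (eq_measurable_fun (fun x : n.-tuple R2 => (tnth x j).2)) => [x _|].
    by rewrite /= mxE.
  exact: (measurableT_comp measurable_snd (measurable_tnth j)).
by move=> + _ A mA => /(_ measurableT A mA); rewrite !setTI.
Qed.

Definition tuple_of_complex (z : Cn) : n.-tuple R2 :=
  [tuple (Re (z ord0 j), Im (z ord0 j)) | j < n].

Lemma tuple_of_complexK : cancel tuple_of_complex complex_of_tuple.
Proof. by move=> z; apply/rowP => j; rewrite mxE tnth_mktuple /=; case: (z _ _). Qed.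

(** The sigma-algebra of C^n is transported along [complex_of_tuple], so F is factored through
    (R^2)^n, where coordinates decide measurability. *)
Lemma measurable_fun_Cn d (T : measurableType d) (F : T -> Cn) :
  (forall j, measurable_fun setT (fun x => Re (F x ord0 j))) ->
  (forall j, measurable_fun setT (fun x => Im (F x ord0 j))) ->
  measurable_fun setT F.
Proof.
move=> mRe mIm; rewrite (_ : F = complex_of_tuple \o (tuple_of_complex \o F)).
  apply: measurableT_comp; first exact: measurable_complex_of_tuple.
  apply/measurable_fun_tnthP => j.
  apply: (eq_measurable_fun (fun x => (Re (F x ord0 j), Im (F x ord0 j)) : R2)).
    by move=> x _; rewrite /= tnth_mktuple.
  by apply/measurable_fun_pair; [exact: mRe|exact: mIm].
by apply/funext => x /=; rewrite tuple_of_complexK.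
Qed.

Local Open Scope ereal_scope.

Lemma ge0_integral_lebesgue_Cn (phi : Cn -> \bar R) :
  measurable_fun setT phi -> (forall z, 0 <= phi z) ->
  \int[lam]_z phi z =
  \int[tuple_measure (product_measure lebesgue_measure lebesgue_measure) n]_t
     phi (complex_of_tuple t).
Proof.
move=> mphi phi0.
exact: (ge0_integral_pushforward measurable_complex_of_tuple _ measurableT mphi (fun z _ => phi0 z)).
Qed.

Lemma ge0_integral_lebesgue_Cn_map (f : 'I_n -> R2 -> R2) (F : Cn -> Cn) (phi : Cn -> \bar R) :
  (forall j, preserves (product_measure lebesgue_measure lebesgue_measure) (f j)) ->
  (forall t, F (complex_of_tuple t) = complex_of_tuple [tuple f j (tnth t j) | j < n]) ->
  measurable_fun setT F ->
  measurable_fun setT phi -> (forall z, 0 <= phi z) ->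
  \int[lam]_z phi (F z) = \int[lam]_z phi z.
Proof.
move=> pf FE mF mphi phi0; rewrite !ge0_integral_lebesgue_Cn//; last exact: measurableT_comp.
rewrite -[RHS](ge0_integral_tuple_map pf (measurableT_comp mphi measurable_complex_of_tuple)); last by move=> t; exact: phi0.
by apply: eq_integral => t _; rewrite FE.
Qed.

Lemma measurable_translation (a : Cn) : measurable_fun setT (fun z : Cn => z + a)%R.
Proof.
apply: measurable_fun_Cn => j; under eq_fun do rewrite mxE ?ReD ?ImD.
  by apply: measurable_funD => //; exact: measurable_Re_coord.
by apply: measurable_funD => //; exact: measurable_Im_coord.
Qed.

Lemma measurable_Cn_scale (c : R[i]) : measurable_fun setT (fun z : Cn => c *: z)%R.
Proof.
have mR := measurable_Re_coord; have mI := measurable_Im_coord.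
apply: measurable_fun_Cn => j; under eq_fun do rewrite mxE ?ReM ?ImM.
  by apply: measurable_funB; apply: measurable_funM.
by apply: measurable_funD; apply: measurable_funM.
Qed.

Lemma ge0_integral_translation (a : Cn) (phi : Cn -> \bar R) :
  measurable_fun setT phi -> (forall z, 0 <= phi z) ->
  \int[lam]_z phi (z + a)%R = \int[lam]_z phi z.
Proof.
move=> mphi phi0.
apply: (@ge0_integral_lebesgue_Cn_map
  (fun j p => (p.1 + Re (a ord0 j), p.2 + Im (a ord0 j))%R) (fun z => z + a)%R) => //.
- move=> j; exact: (preserves_translation (Re (a ord0 j), Im (a ord0 j))).
- by move=> t; apply/rowP => j; rewrite !mxE tnth_mktuple; case: (a _ _).
- exact: measurable_translation.
Qed.

Lemma ge0_integral_rotation (c : R[i]) (phi : Cn -> \bar R) :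
  normc c = 1%R -> c != (- 1)%R ->
  measurable_fun setT phi -> (forall z, 0 <= phi z) ->
  \int[lam]_z phi (c *: z)%R = \int[lam]_z phi z.
Proof.
move=> c1 cN1 mphi phi0.
apply: (@ge0_integral_lebesgue_Cn_map
  (fun j p => (Re c * p.1 - Im c * p.2, Im c * p.1 + Re c * p.2)%R)
  (fun z => c *: z)%R) => //.
- move=> j; apply: preserves_rotation.
    by rewrite -sqr_normcE c1 expr1n.
  apply: contra cN1 => /eqP cE; have c0 : Im c = 0%R.
    apply/eqP; rewrite -sqrf_eq0; apply/eqP.
    by have := sqr_normcE c; rewrite c1 cE => h; lra.
  by apply/eqP; apply: complexP; rewrite ?cE ?c0/= ?oppr0.
- move=> t; apply/rowP => j; rewrite !mxE tnth_mktuple /=.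
  by apply: complexP; rewrite ?ReM ?ImM//= addrC.
- exact: measurable_Cn_scale.
Qed.

(** Total mass 1 of the normal density with mean 0 and variance s / 2. *)
Lemma integral_gauss1 (s : R) : (0 < s)%R ->
  \int[lebesgue_measure]_x (expR (- x ^+ 2 / s))%:E = (Num.sqrt (pi * s))%:E.
Proof.
move=> s0; pose sg := Num.sqrt (s / 2).
have sg2 : (sg ^+ 2 = s / 2)%R by rewrite sqr_sqrtr// divr_ge0// ltW.
have sg0 : sg != 0%R by rewrite gt_eqF// sqrtr_gt0 divr_gt0.
have := @integral_normal_pdf R 0%R sg; rewrite normal_pdfE//.
have E x : (normal_peak sg * normal_fun 0 sg x = (Num.sqrt (pi * s))^-1 * expR (- x ^+ 2 / s))%R.
  rewrite /normal_peak /normal_fun subr0 sg2.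
  have -> : (s / 2 * pi *+ 2 = pi * s)%R by rewrite -mulr_natr; field.
  by have -> : (s / 2 *+ 2 = s)%R by rewrite -mulr_natr; field.
under eq_integral do rewrite E EFinM.
rewrite ge0_integralZl//; last first.
  apply/measurable_EFinP; apply: measurableT_comp => //.
  by apply: measurable_funM => //; apply: measurableT_comp => //; exact: measurable_funX.
have q0 : (0 < Num.sqrt (pi * s))%R by rewrite sqrtr_gt0 mulr_gt0// pi_gt0.
move=> H; rewrite -[LHS]mul1e -[1]/(1%R%:E) -(mulfV (lt0r_neq0 q0)) EFinM -muleA H mule1 //.
Qed.

Lemma integral_gauss_Cn (s : R) : (0 < s)%R ->
  \int[lam]_z (expR (- sqnorm z / s))%:E = ((pi * s) ^+ n)%:E.
Proof.
move=> s0; rewrite ge0_integral_lebesgue_Cn; last 2 first.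
- apply/measurable_EFinP; apply: measurableT_comp => //; apply: measurable_funM => //.
  by apply: measurableT_comp => //; exact: measurable_sqnorm.
- by move=> z; rewrite lee_fin expR_ge0.
pose phi (p : R2) : R := (expR (- p.1 ^+ 2 / s) * expR (- p.2 ^+ 2 / s))%R.
have mg : measurable_fun [set: R] (fun x : R => expR (- x ^+ 2 / s))%R.
  apply: measurableT_comp => //; apply: measurable_funM => //.
  by apply: measurableT_comp => //; exact: measurable_funX.
have mphi : measurable_fun setT phi.
  apply: measurable_funM.
    exact: (measurableT_comp mg measurable_fst).
  exact: (measurableT_comp mg measurable_snd).
have phi0 p : (0 <= phi p)%R by rewrite mulr_ge0 ?expR_ge0.
rewrite -(@ge0_integral_tuple_prod _ _ _ (product_measure lebesgue_measure lebesgue_measure) n phi (pi * s)%R)//.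
  apply: eq_integral => t _; congr EFin; rewrite /sqnorm -sumrN mulr_suml expR_sum.
  apply: eq_bigr => j _; rewrite mxE sqr_normcE /phi -expRD; congr expR => /=.
  by ring.
rewrite (ge0_integral_prod2 (phi := fun p => (phi p)%:E)); last 2 first.
- exact/measurable_EFinP.
- by move=> p; rewrite lee_fin.
transitivity (\int[lebesgue_measure]_x ((expR (- x ^+ 2 / s))%:E * (Num.sqrt (pi * s))%:E)).
  apply: eq_integral => x _; rewrite -(integral_gauss1 s0) -ge0_integralZl//.
    exact/measurable_EFinP.
rewrite ge0_integralZr//; last exact/measurable_EFinP.
by rewrite integral_gauss1// -EFinM -expr2 sqr_sqrtr// mulr_ge0 ?pi_ge0// ltW.
Qed.

Lemma ge0_integral_gauss_measure (t : R) (phi : Cn -> \bar R) :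
  measurable_fun setT phi -> (forall z, 0 <= phi z) ->
  \int[gauss_measure t]_z phi z = \int[lam]_z (phi z * (gauss_density t z)%:E).
Proof.
move=> mphi phi0; apply: ge0_integral_density => //.
- exact: measurable_gauss_density.
- by move=> z; exact: gauss_density_ge0.
Qed.

End lebesgue_Cn.

(** * Complex-valued integrals *)

Section complex_measurability.
Context {d} {T : measurableType d} {R : realType}.
Implicit Types u v : T -> R[i].

(** The analogue of [cmeasurable] on an arbitrary measurable space; it is applied to C^n, to
    products and to the line of angles. *)
Definition cmeas u : Prop :=
  measurable_fun setT (fun x => Re (u x)) /\ measurable_fun setT (fun x => Im (u x)).

Lemma cmeas_cst c : cmeas (fun=> c).
Proof. by split; exact: measurable_cst. Qed.

Lemma cmeasD u v : cmeas u -> cmeas v -> cmeas (fun x => u x + v x).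
Proof.
move=> [ur ui] [vr vi]; split; [under eq_fun do rewrite ReD|under eq_fun do rewrite ImD];
  exact: measurable_funD.
Qed.

Lemma cmeasB u v : cmeas u -> cmeas v -> cmeas (fun x => u x - v x).
Proof.
move=> [ur ui] [vr vi]; split; [under eq_fun do rewrite ReB|under eq_fun do rewrite ImB];
  exact: measurable_funB.
Qed.

Lemma cmeasM u v : cmeas u -> cmeas v -> cmeas (fun x => u x * v x).
Proof.
move=> [ur ui] [vr vi]; split; [under eq_fun do rewrite ReM|under eq_fun do rewrite ImM].
  by apply: measurable_funB; exact: measurable_funM.
by apply: measurable_funD; exact: measurable_funM.
Qed.

Lemma cmeas_conj u : cmeas u -> cmeas (fun x => (u x)^*).
Proof.
move=> [ur ui]; split; [under eq_fun do rewrite Re_conj|under eq_fun do rewrite Im_conj] => //.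
exact: measurableT_comp.
Qed.

Lemma cmeas_real (f : T -> R) : measurable_fun setT f -> cmeas (fun x => (f x)%:C).
Proof. by move=> mf; split => //=; exact: measurable_cst. Qed.

Lemma cmeas_cexp u : cmeas u -> cmeas (fun x => cexp (u x)).
Proof.
move=> [ur ui]; split; apply: measurable_funM.
- exact: measurableT_comp.
- apply: measurableT_comp => //; apply: continuous_measurable_fun; exact: continuous_cos.
- exact: measurableT_comp.
- apply: measurableT_comp => //; apply: continuous_measurable_fun; exact: continuous_sin.
Qed.

Lemma cmeas_sum n (F : 'I_n -> T -> R[i]) :
  (forall j, cmeas (F j)) -> cmeas (fun x => \sum_j F j x).
Proof.
move=> mF; split; [under eq_fun do rewrite Re_sum|under eq_fun do rewrite Im_sum];
  apply: measurable_sum => j; [exact: (mF j).1|exact: (mF j).2].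
Qed.

Lemma measurable_normc u : cmeas u -> measurable_fun setT (fun x => normc (u x)).
Proof.
move=> [ur ui].
apply: (eq_measurable_fun (fun x => Num.sqrt (Re (u x) ^+ 2 + Im (u x) ^+ 2))) => [x _|].
  by case: (u x).
apply: measurableT_comp; first exact: (continuous_measurable_fun (@sqrt_continuous R)).
by apply: measurable_funD; exact: measurable_funX.
Qed.

End complex_measurability.

Lemma cmeasT_comp {d1 d2} {T1 : measurableType d1} {T2 : measurableType d2} {R : realType}
  (u : T2 -> R[i]) (f : T1 -> T2) : cmeas u -> measurable_fun setT f ->
  cmeas (fun x => u (f x)).
Proof.
by move=> [ur ui] mf; split; [exact: (measurableT_comp ur mf)|exact: (measurableT_comp ui mf)].
Qed.

(** * Integrability and linearity for complex-valued functions *)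

Section complex_integral.
Context {d} {T : measurableType d} {R : realType}.
Variable mu : {measure set T -> \bar R}.
Implicit Types (u v : T -> R[i]).

(** Real and imaginary parts are integrated separately, so that [inner] is an instance by
    computation. *)
Definition cint u : R[i] := (\int[mu]_x Re (u x)) +i* (\int[mu]_x Im (u x)).

Definition cintegrable u : Prop :=
  cmeas u /\ (\int[mu]_x (normc (u x))%:E < +oo)%E.

Lemma cintegrable_Re u : cintegrable u -> mu.-integrable setT (EFin \o (fun x => Re (u x))).
Proof.
move=> [mu_ ifin]; apply/integrableP; split; first exact/measurable_EFinP/mu_.1.
apply: le_lt_trans ifin; apply: ge0_le_integral => //.
- by apply: measurableT_comp => //; exact/measurable_EFinP/mu_.1.
- exact/measurable_EFinP/measurable_normc.
- by move=> x _; rewrite lee_fin normr_Re_le.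
Qed.

Lemma cintegrable_Im u : cintegrable u -> mu.-integrable setT (EFin \o (fun x => Im (u x))).
Proof.
move=> [mu_ ifin]; apply/integrableP; split; first exact/measurable_EFinP/mu_.2.
apply: le_lt_trans ifin; apply: ge0_le_integral => //.
- by apply: measurableT_comp => //; exact/measurable_EFinP/mu_.2.
- exact/measurable_EFinP/measurable_normc.
- by move=> x _; rewrite lee_fin normr_Im_le.
Qed.

Lemma ge0_integral_lty_le (f g : T -> R) :
  measurable_fun setT f -> measurable_fun setT g ->
  (forall x, 0 <= f x <= g x) -> (\int[mu]_x (g x)%:E < +oo)%E ->
  (\int[mu]_x (f x)%:E < +oo)%E.
Proof.
move=> mf mg fg; apply: le_lt_trans; apply: ge0_le_integral => //.
- by move=> x _; rewrite lee_fin; case/andP: (fg x).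
- exact/measurable_EFinP.
- exact/measurable_EFinP.
- by move=> x _; rewrite lee_fin; case/andP: (fg x).
Qed.

Lemma cintegrable_le u (g : T -> R) : cmeas u -> measurable_fun setT g ->
  (forall x, normc (u x) <= g x) -> (\int[mu]_x (g x)%:E < +oo)%E -> cintegrable u.
Proof.
move=> mu_ mg ug gfin; split=> //; apply: (ge0_integral_lty_le _ mg _ gfin).
  exact: measurable_normc.
by move=> x; rewrite normc_ge0 ug.
Qed.

Lemma ge0_integral_ltyD (f g : T -> R) :
  measurable_fun setT f -> measurable_fun setT g ->
  (forall x, 0 <= f x) -> (forall x, 0 <= g x) ->
  (\int[mu]_x (f x)%:E < +oo)%E -> (\int[mu]_x (g x)%:E < +oo)%E ->
  (\int[mu]_x (f x + g x)%:E < +oo)%E.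
Proof.
move=> mf mg f0 g0 fi gi; under eq_integral do rewrite EFinD.
rewrite ge0_integralD//; [exact: lte_add_pinfty| | | | ].
- by move=> x _; rewrite lee_fin.
- exact/measurable_EFinP.
- by move=> x _; rewrite lee_fin.
- exact/measurable_EFinP.
Qed.

Lemma ge0_integral_ltyZ (k : R) (f : T -> R) : 0 <= k ->
  measurable_fun setT f -> (forall x, 0 <= f x) ->
  (\int[mu]_x (f x)%:E < +oo)%E -> (\int[mu]_x (k * f x)%:E < +oo)%E.
Proof.
move=> k0 mf f0 fi; under eq_integral do rewrite EFinM.
rewrite ge0_integralZl_EFin//; last 2 first.
- by move=> x _; rewrite lee_fin.
- exact/measurable_EFinP.
by rewrite lte_mul_pinfty.
Qed.

Lemma cintegrableD u v : cintegrable u -> cintegrable v ->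
  cintegrable (fun x => u x + v x).
Proof.
move=> [mu_ iu] [mv iv]; apply: (@cintegrable_le _ (fun x => normc (u x) + normc (v x))).
- exact: cmeasD.
- by apply: measurable_funD; exact: measurable_normc.
- by move=> x; exact: le_normcD.
- apply: ge0_integral_ltyD => //; try exact: measurable_normc.
    by move=> x; exact: normc_ge0.
  by move=> x; exact: normc_ge0.
Qed.

Lemma cintegrableZ c u : cintegrable u -> cintegrable (fun x => c * u x).
Proof.
move=> [mu_ iu]; apply: (@cintegrable_le _ (fun x => normc c * normc (u x))).
- by apply: cmeasM => //; exact: cmeas_cst.
- by apply: measurable_funM => //; exact: measurable_normc.
- by move=> x; rewrite ComplexField.Normc.normcM.
- apply: ge0_integral_ltyZ => //; first exact: normc_ge0.
    exact: measurable_normc.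
  by move=> x; exact: normc_ge0.
Qed.

Lemma cintegrableB u v : cintegrable u -> cintegrable v ->
  cintegrable (fun x => u x - v x).
Proof.
move=> iu iv; have := cintegrableD iu (cintegrableZ (-1) iv).
by under [X in cintegrable X -> _]eq_fun do rewrite mulN1r.
Qed.

Lemma cintD u v : cintegrable u -> cintegrable v ->
  cint (fun x => u x + v x) = cint u + cint v.
Proof.
move=> iu iv; apply: complexP; rewrite ?ReD ?ImD /cint /=.
  rewrite -RintegralD//; try exact: cintegrable_Re.
  by congr fine; apply: eq_integral => x _; rewrite ReD.
rewrite -RintegralD//; try exact: cintegrable_Im.
by congr fine; apply: eq_integral => x _; rewrite ImD.
Qed.

Lemma cintZ c u : cintegrable u -> cint (fun x => c * u x) = c * cint u.
Proof.
move=> iu; have iR := cintegrable_Re iu; have iI := cintegrable_Im iu.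
have iRZ k : mu.-integrable setT (EFin \o (fun x => k * Re (u x))).
  exact: (integrableZl measurableT k iR).
have iIZ k : mu.-integrable setT (EFin \o (fun x => k * Im (u x))).
  exact: (integrableZl measurableT k iI).
apply: complexP; rewrite ?ReM ?ImM /cint /= -!RintegralZl//.
  rewrite -RintegralB//.
  by congr fine; apply: eq_integral => x _; rewrite ReM.
rewrite -RintegralD//.
by congr fine; apply: eq_integral => x _; rewrite ImM.
Qed.

Lemma cintB u v : cintegrable u -> cintegrable v ->
  cint (fun x => u x - v x) = cint u - cint v.
Proof.
move=> iu iv; rewrite -mulN1r -cintZ// -cintD//; last exact: cintegrableZ.
by congr cint; apply/funext => x; rewrite mulN1r.
Qed.

Lemma cint0 : cint (fun=> 0) = 0.
Proof.
by apply: complexP; rewrite /cint /= Rintegral_cst// mul0r.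
Qed.

Lemma cintegrable0 : cintegrable (fun=> 0).
Proof.
split; first exact: cmeas_cst.
by rewrite /= expr0n/= addr0 sqrtr0 integral0.
Qed.

Lemma cintegrable_sum n (F : 'I_n -> T -> R[i]) :
  (forall j, cintegrable (F j)) -> cintegrable (fun x => \sum_j F j x).
Proof.
elim: n F => [|n ih] F iF.
  by under eq_fun do rewrite big_ord0; exact: cintegrable0.
under eq_fun do rewrite big_ord_recr.
by apply: cintegrableD => //; apply: ih.
Qed.

Lemma cint_sum n (F : 'I_n -> T -> R[i]) :
  (forall j, cintegrable (F j)) -> cint (fun x => \sum_j F j x) = \sum_j cint (F j).
Proof.
elim: n F => [|n ih] F iF.
  by under eq_fun do rewrite big_ord0; rewrite big_ord0 cint0.
under eq_fun do rewrite big_ord_recr.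
rewrite cintD//; first by rewrite big_ord_recr ih.
exact: cintegrable_sum.
Qed.

Lemma cint_conj u : cintegrable u -> cint (fun x => (u x)^*) = (cint u)^*.
Proof.
move=> iu; apply: complexP; rewrite ?Re_conj ?Im_conj /cint /=.
  by congr fine; apply: eq_integral => x _; rewrite Re_conj.
rewrite -mulN1r -RintegralZl//; last exact: cintegrable_Im.
by congr fine; apply: eq_integral => x _; rewrite Im_conj mulN1r.
Qed.

Lemma eq_cint u v : u =1 v -> cint u = cint v.
Proof. by move=> uv; congr cint; apply/funext. Qed.

(** The factor 2 comes from bounding the real and imaginary parts separately by the modulus. It
    enters only the constants in front of bounds that tend to 0. *)
Lemma normc_cint_le u : cintegrable u ->
  ((normc (cint u))%:E <= 2%:E * \int[mu]_x (normc (u x))%:E)%E.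
Proof.
move=> iu; have [mu_ _] := iu.
apply: (@le_trans _ _ (`|\int[mu]_x Re (u x)| + `|\int[mu]_x Im (u x)|)%:E).
  by rewrite lee_fin; exact: (normc_le_ReIm (cint u)).
have -> : 2%:E = (1 + 1)%E :> \bar R by [].
rewrite EFinD ge0_muleDl// mul1e; apply: leeD.
  rewrite EFin_normr_Rintegral//; last exact: cintegrable_Re.
  apply: le_trans; first by apply: le_abse_integral => //; exact/measurable_EFinP/mu_.1.
  apply: ge0_le_integral => //.
  - by apply: measurableT_comp => //; exact/measurable_EFinP/mu_.1.
  - exact/measurable_EFinP/measurable_normc.
  - by move=> x _; rewrite lee_fin normr_Re_le.
rewrite EFin_normr_Rintegral//; last exact: cintegrable_Im.
apply: le_trans; first by apply: le_abse_integral => //; exact/measurable_EFinP/mu_.2.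
apply: ge0_le_integral => //.
- by apply: measurableT_comp => //; exact/measurable_EFinP/mu_.2.
- exact/measurable_EFinP/measurable_normc.
- by move=> x _; rewrite lee_fin normr_Im_le.
Qed.

End complex_integral.

(** * Change of variables for complex integrals *)

Section complex_integral_transfer.
Context {d1 d2} {T1 : measurableType d1} {T2 : measurableType d2} {R : realType}.
Variables (m1 : {measure set T1 -> \bar R}) (m2 : {measure set T2 -> \bar R}).
Variables (k : T1 -> R) (f : T2 -> T1).
Hypothesis k0 : forall x, 0 <= k x.
Hypothesis transfer : forall phi : T1 -> \bar R,
  measurable_fun setT phi -> (forall x, 0 <= phi x)%E ->
  (\int[m1]_x (phi x * (k x)%:E) = \int[m2]_y phi (f y))%E.

(** Positive and negative parts are transferred separately. The density k is that of a Weyl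
    translation in one application and the constant 1, for rotations, in the other. *)
Lemma integral_transfer (g : T1 -> R) : measurable_fun setT g ->
  (\int[m1]_x (g x * k x)%:E = \int[m2]_y (g (f y))%:E)%E.
Proof.
move=> mg; have /measurable_EFinP meg := mg.
rewrite integralE [in RHS]integralE; congr (_ - _)%E.
  transitivity (\int[m2]_y ((EFin \o g)^\+ (f y)))%E; last by apply: eq_integral => y _; rewrite ?funeposE ?funenegE.
  rewrite -transfer; [|exact: measurable_funepos|by move=> x; exact: funepos_ge0].
  by apply: eq_integral => x _; rewrite !funeposE EFinM maxe_pMl ?lee_fin// mul0e.
transitivity (\int[m2]_y ((EFin \o g)^\- (f y)))%E; last by apply: eq_integral => y _; rewrite ?funeposE ?funenegE.
  rewrite -transfer; [|exact: measurable_funeneg|by move=> x; exact: funeneg_ge0].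
by apply: eq_integral => x _; rewrite !funenegE EFinM -mulNe maxe_pMl ?lee_fin// mul0e.
Qed.

Lemma cint_transfer u : cmeas u -> cint m1 (fun x => u x * (k x)%:C) = cint m2 (u \o f).
Proof.
move=> [mR mI]; rewrite /cint; congr (_ +i* _); congr fine.
  apply: (eq_trans _ (integral_transfer mR)).
  by apply: eq_integral => x _; rewrite ReM /= mulr0 subr0.
apply: (eq_trans _ (integral_transfer mI)).
by apply: eq_integral => x _; rewrite ImM /= mulr0 add0r.
Qed.

End complex_integral_transfer.

(** * Fubini's theorem for complex integrals *)

Section complex_fubini.
Context {d1 d2} {T1 : measurableType d1} {T2 : measurableType d2} {R : realType}.
Variables (m1 : {sigma_finite_measure set T1 -> \bar R}).
Variables (m2 : {sigma_finite_measure set T2 -> \bar R}).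
Variable u : T1 * T2 -> R[i].
Hypothesis mu : cmeas u.
Hypothesis iu : (\int[m1]_x \int[m2]_y (normc (u (x, y)))%:E < +oo)%E.

Let prod_integrable (f : R[i] -> R) : (forall z, `|f z| <= normc z) ->
  measurable_fun setT (fun p => f (u p)) ->
  (m1 \x m2)%E.-integrable setT (EFin \o (fun p => f (u p))).
Proof.
move=> fle mf; apply/integrable12ltyP; first exact/measurable_EFinP.
have mn : measurable_fun setT (fun p => (normc (u p))%:E).
  exact/measurable_EFinP/measurable_normc.
have mfn : measurable_fun setT (fun p => (`|f (u p)|)%:E).
  by apply/measurable_EFinP; exact: measurableT_comp.
apply: le_lt_trans iu; apply: ge0_le_integral => //.
- by move=> x _; exact: integral_ge0.
- exact: (measurable_fun_fubini_tonelli_F _ mfn).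
- by apply: (measurable_fun_fubini_tonelli_F _ mn) => p; rewrite lee_fin normc_ge0.
- move=> x _; apply: ge0_le_integral => //.
  + exact: (measurable_fun_pair2 x mfn).
  + exact: (measurable_fun_pair2 x mn).
  + by move=> y _; rewrite lee_fin.
Qed.

Let iRe : (m1 \x m2)%E.-integrable setT (EFin \o (fun p => Re (u p))).
Proof. by apply: prod_integrable; [exact: normr_Re_le|exact: mu.1]. Qed.

Let iIm : (m1 \x m2)%E.-integrable setT (EFin \o (fun p => Im (u p))).
Proof. by apply: prod_integrable; [exact: normr_Im_le|exact: mu.2]. Qed.

Lemma cmeas_cint : cmeas (fun x => cint m2 (fun y => u (x, y))).
Proof.
split.
  exact: (measurableT_comp (@fine_measurable R setT measurableT) (measurable_fubini_F iRe)).
exact: (measurableT_comp (@fine_measurable R setT measurableT) (measurable_fubini_F iIm)).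
Qed.

(** Integrability of every section makes all inner integrals finite, so the [fine] hidden in [cint]
    can be removed pointwise before the real Fubini theorem is applied. *)
Lemma cint_fubini :
  (forall x, cintegrable m2 (fun y => u (x, y))) ->
  (forall y, cintegrable m1 (fun x => u (x, y))) ->
  cint m1 (fun x => cint m2 (fun y => u (x, y))) =
  cint m2 (fun y => cint m1 (fun x => u (x, y))).
Proof.
move=> i2 i1; rewrite /cint /=; congr (_ +i* _); rewrite /Rintegral.
  congr fine; transitivity (\int[m1]_x \int[m2]_y (Re (u (x, y)))%:E)%E.
    apply: eq_integral => x _; rewrite fineK//; apply: integrable_fin_num => //.
    exact: (cintegrable_Re (i2 x)).
  rewrite (Fubini iRe); apply: eq_integral => y _; rewrite fineK//.
  by apply: integrable_fin_num => //; exact: (cintegrable_Re (i1 y)).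
congr fine; transitivity (\int[m1]_x \int[m2]_y (Im (u (x, y)))%:E)%E.
  apply: eq_integral => x _; rewrite fineK//; apply: integrable_fin_num => //.
  exact: (cintegrable_Im (i2 x)).
rewrite (Fubini iIm); apply: eq_integral => y _; rewrite fineK//.
by apply: integrable_fin_num => //; exact: (cintegrable_Im (i1 y)).
Qed.

End complex_fubini.

(** * Schur's test *)

Section schur_test.
Context {d} {T : measurableType d} {R : realType}.
Variable mu : {sigma_finite_measure set T -> \bar R}.
Local Open Scope ereal_scope.

Lemma cauchy_schwarz_integral (f g : T -> R) :
  measurable_fun setT f -> measurable_fun setT g ->
  (forall x, 0 <= f x)%R -> (forall x, 0 <= g x)%R ->
  (\int[mu]_x (f x * g x)%:E) ^+ 2 <=
  (\int[mu]_x (f x ^+ 2)%:E) * (\int[mu]_x (g x ^+ 2)%:E).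
Proof.
move=> mf mg f0 g0.
have sq0 (h : T -> R) : 0 <= \int[mu]_x (h x ^+ 2)%:E.
  by apply: integral_ge0 => x _; rewrite lee_fin sqr_ge0.
have N2 (h : T -> R) : 'N[mu]_2%:E[EFin \o h] = sqrte (\int[mu]_x (h x ^+ 2)%:E).
  rewrite unlock poweR12_sqrt; last by apply: integral_ge0 => x _; exact: poweR_ge0.
  congr sqrte; apply: eq_integral => x _ /=.
  by rewrite powR_mulrn// real_normK// num_real.
have h12 : (2^-1 + 2^-1 = 1 :> R)%R by field.
have := hoelder mu mf mg (ltr0Sn R 1) (ltr0Sn R 1) h12.
rewrite Lnorm1 !N2 => H.
have -> : \int[mu]_x (f x * g x)%:E = \int[mu]_x `|(EFin \o (f \* g)%R) x|.
  by apply: eq_integral => x _; rewrite /= ger0_norm// mulr_ge0.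
rewrite -[leRHS]sqr_sqrte ?mule_ge0// sqrteM// !expe2.
by apply: lee_pmul => //; apply: integral_ge0 => x _.
Qed.

Variables (k : T * T -> R) (s : T -> R) (A : R).
Hypotheses (mk : measurable_fun setT k) (ms : measurable_fun setT s).
Hypotheses (k0 : forall p, (0 <= k p)%R) (A0 : (0 <= A)%R).
Hypothesis row : forall z, \int[mu]_w (k (z, w) * expR (s w))%:E <= (A * expR (s z))%:E.
Hypothesis col : forall w, \int[mu]_z (k (z, w) * expR (s z))%:E <= (A * expR (s w))%:E.

(** With e = exp s, write k u as (sqrt k sqrt e) (sqrt k u / sqrt e). Cauchy-Schwarz and the row
    bound give (int k u)^2 <= A e(z) int k u^2 / e. After integration in z and Tonelli, the column
    bound supplies the second factor A and cancels 1 / e. *)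
Lemma schur_test (u : T -> R) : measurable_fun setT u -> (forall x, 0 <= u x)%R ->
  \int[mu]_z (\int[mu]_w (k (z, w) * u w)%:E) ^+ 2 <=
  (A ^+ 2)%:E * \int[mu]_w (u w ^+ 2)%:E.
Proof.
move=> mu_ u0.
pose e x := expR (s x).
have e0 x : (0 < e x)%R by exact: expR_gt0.
have me : measurable_fun setT e by exact: measurableT_comp.
pose h x := expR (s x / 2).
have mh : measurable_fun setT h.
  by apply: measurableT_comp => //; apply: measurable_funM.
pose h' x := expR (- (s x / 2)).
have mh' : measurable_fun setT h'.
  by apply: measurableT_comp => //; apply: measurableT_comp => //; apply: measurable_funM.
have h0 x : (0 <= h x)%R by exact: expR_ge0.
have h'0 x : (0 <= h' x)%R by exact: expR_ge0.
have hh' x : (h x * h' x = 1)%R by rewrite /h /h' -expRD subrr expR0.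
have h2 x : (h x ^+ 2 = e x)%R by rewrite expr2 -expRD; congr expR; field.
have msk z : measurable_fun setT (fun w => Num.sqrt (k (z, w))).
  apply: measurableT_comp; first exact: (continuous_measurable_fun (@sqrt_continuous R)).
  exact: measurable_fun_pair2.
have mk1 z : measurable_fun setT (fun w => k (z, w)) by exact: measurable_fun_pair2.
have mk2 w : measurable_fun setT (fun z => k (z, w)) by exact: measurable_fun_pair1.
have mV : measurable_fun setT (fun z => \int[mu]_w (k (z, w) * u w)%:E).
  apply: (measurable_fun_fubini_tonelli_F (fun p => (k p * u p.2)%:E)) => [|p].
    apply/measurable_EFinP; apply: measurable_funM => //.
    exact: (measurableT_comp mu_ measurable_snd).
  by rewrite lee_fin mulr_ge0.
(* This is u^2 / e, the square of what remains of u in the second Cauchy-Schwarz factor. *)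
pose q w := (u w ^+ 2 * h' w ^+ 2)%R.
have q0 w : (0 <= q w)%R by rewrite mulr_ge0 ?sqr_ge0.
have mq : measurable_fun setT q.
  by apply: measurable_funM; exact: measurable_funX.
have mW : measurable_fun setT (fun p => (e p.1 * (k p * q p.2))%:E).
  apply/measurable_EFinP; apply: measurable_funM.
    exact: (measurableT_comp me measurable_fst).
  apply: measurable_funM => //; exact: (measurableT_comp mq measurable_snd).
have W0 p : 0 <= (e p.1 * (k p * q p.2))%:E by rewrite lee_fin !mulr_ge0// ltW.
apply: (@le_trans _ _ (\int[mu]_z (A%:E * \int[mu]_w (e z * (k (z, w) * q w))%:E))).
  apply: ge0_le_integral => //.
  - by move=> z _; exact: sqre_ge0.
  - by under eq_fun do rewrite expe2; exact: emeasurable_funM.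
  - apply: measurable_funeM.
    exact: (measurable_fun_fubini_tonelli_F (fun p => (e p.1 * (k p * q p.2))%:E) mW W0).
  move=> z _.
  have -> : \int[mu]_w (k (z, w) * u w)%:E =
      \int[mu]_w ((Num.sqrt (k (z, w)) * h w) * (Num.sqrt (k (z, w)) * (u w * h' w)))%:E.
    apply: eq_integral => w _; congr EFin.
    rewrite mulrACA -expr2 sqr_sqrtr// [(h w * _)%R]mulrCA hh' mulr1; reflexivity.
  apply: (le_trans (@cauchy_schwarz_integral (fun w => Num.sqrt (k (z, w)) * h w)%R
    (fun w => Num.sqrt (k (z, w)) * (u w * h' w))%R _ _ _ _)).
  - exact: measurable_funM.
  - by apply: measurable_funM => //; exact: measurable_funM.
  - by move=> w; rewrite mulr_ge0 ?sqrtr_ge0.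
  - by move=> w; rewrite !mulr_ge0 ?sqrtr_ge0.
  have -> : \int[mu]_w (e z * (k (z, w) * q w))%:E =
      (e z)%:E * \int[mu]_w (k (z, w) * q w)%:E.
    rewrite -ge0_integralZl//.
    - by apply/measurable_EFinP; exact: measurable_funM.
    - by move=> w _; rewrite lee_fin mulr_ge0.
    - by rewrite lee_fin ltW.
  rewrite muleA -EFinM; apply: lee_pmul.
  - by apply: integral_ge0 => w _; rewrite lee_fin sqr_ge0.
  - by apply: integral_ge0 => w _; rewrite lee_fin sqr_ge0.
  - apply: le_trans (row z); apply: ge0_le_integral => //.
    + by move=> w _; rewrite lee_fin sqr_ge0.
    + by apply/measurable_EFinP; apply: measurable_funX; exact: measurable_funM.
    + by apply/measurable_EFinP; exact: measurable_funM.
    + by move=> w _; rewrite lee_fin exprMn sqr_sqrtr// h2.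
  - apply: ge0_le_integral => //.
    + by move=> w _; rewrite lee_fin sqr_ge0.
    + apply/measurable_EFinP; apply: measurable_funX; apply: measurable_funM => //.
      exact: measurable_funM.
    + by apply/measurable_EFinP; exact: measurable_funM.
    + by move=> w _; rewrite lee_fin !exprMn !sqr_sqrtr.
rewrite ge0_integralZl//; last 2 first.
- exact: (measurable_fun_fubini_tonelli_F (fun p => (e p.1 * (k p * q p.2))%:E) mW W0).
- by move=> z _; apply: integral_ge0 => w _; exact: (W0 (z, w)).
rewrite (fubini_tonelli (fun p => (e p.1 * (k p * q p.2))%:E) mW W0) /=.
rewrite expr2 EFinM -muleA lee_wpmul2l ?lee_fin//.
rewrite -ge0_integralZl ?lee_fin//; last 2 first.
- by apply/measurable_EFinP; exact: measurable_funX.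
- by move=> w _; rewrite lee_fin sqr_ge0.
apply: ge0_le_integral => //.
- by move=> w _; apply: integral_ge0 => z _; exact: (W0 (z, w)).
- exact: (measurable_fun_fubini_tonelli_G (fun p => (e p.1 * (k p * q p.2))%:E) mW W0).
- by apply: measurable_funeM; apply/measurable_EFinP; exact: measurable_funX.
move=> w _.
have -> : \int[mu]_z (e z * (k (z, w) * q w))%:E =
    (q w)%:E * \int[mu]_z (k (z, w) * e z)%:E.
  rewrite -ge0_integralZl ?lee_fin//.
  - by apply: eq_integral => z _; rewrite -EFinM; congr EFin; ring.
  - by apply/measurable_EFinP; exact: measurable_funM.
  - by move=> z _; rewrite lee_fin mulr_ge0// ltW.
apply: (le_trans (lee_wpmul2l _ (col w))); first by rewrite lee_fin.
rewrite -!EFinM lee_fin /q -/(e w) -h2 le_eqVlt; apply/orP; left; apply/eqP.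
by rewrite -[RHS]mulr1 -(expr1n _ 2) -(hh' w) exprMn; ring.
Qed.

End schur_test.

(** * The reproducing kernel *)

Section fock_kernel.
Context {R : realType} {n : nat}.
Local Notation Cn := 'rV[R[i]]_n.
Implicit Types z w : Cn.

Definition dot z w : R[i] := \sum_j z ord0 j * (w ord0 j)^*.

Lemma dotDl z z' w : dot (z + z') w = dot z w + dot z' w.
Proof. by rewrite /dot -big_split; apply: eq_bigr => j _; rewrite mxE mulrDl. Qed.

Lemma dot_conj z w : (dot z w)^* = dot w z.
Proof.
rewrite /dot (raddf_sum (@conjc R)); apply: eq_bigr => j _ /=.
by rewrite rmorphM /= conjcK mulrC.
Qed.

Lemma dotDr z w w' : dot z (w + w') = dot z w + dot z w'.
Proof. by rewrite -dot_conj dotDl rmorphD /= !dot_conj. Qed.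

Lemma dot_self z : dot z z = (sqnorm z)%:C.
Proof.
rewrite /dot /sqnorm (raddf_sum (real_complex R)); apply: eq_bigr => j _ /=.
rewrite sqr_normcE; apply: complexP; rewrite ?ReM ?ImM Re_conj Im_conj /=; ring.
Qed.

Lemma sqnormD z w : sqnorm (z + w) = sqnorm z + sqnorm w + 2 * Re (dot z w).
Proof.
apply: complexI; rewrite -dot_self dotDl !dotDr !dot_self.
rewrite -[dot w z]dot_conj; apply: complexP; rewrite !(ReD, ImD) ?Re_conj ?Im_conj/=; ring.
Qed.

Lemma sqnormN z : sqnorm (- z) = sqnorm z.
Proof. by apply: eq_bigr => j _; rewrite mxE normcN. Qed.

Lemma sqnormZ (c : R[i]) z : sqnorm (c *: z) = normc c ^+ 2 * sqnorm z.
Proof.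
rewrite /sqnorm mulr_sumr; apply: eq_bigr => j _.
by rewrite mxE ComplexField.Normc.normcM exprMn.
Qed.

Lemma sqnorm_ge0 z : 0 <= sqnorm z.
Proof. by apply: sumr_ge0 => j _; rewrite sqr_ge0. Qed.

Lemma cmeas_coord (j : 'I_n) : cmeas (fun z : Cn => z ord0 j).
Proof. by split; [exact: measurable_Re_coord|exact: measurable_Im_coord]. Qed.

Lemma cmeas_dot : cmeas (fun p : Cn * Cn => dot p.1 p.2).
Proof.
apply: cmeas_sum => j; apply: cmeasM.
  exact: (cmeasT_comp (cmeas_coord j) measurable_fst).
apply: cmeas_conj; exact: (cmeasT_comp (cmeas_coord j) measurable_snd).
Qed.

Variable t : R.

Definition kern z w : R[i] := cexp ((4 * t)^-1%:C * dot z w).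

Lemma kern_conj z w : (kern z w)^* = kern w z.
Proof. by rewrite /kern cexp_conj rmorphM /= dot_conj oppr0. Qed.

Lemma normc_kern z w : normc (kern z w) = expR (Re (dot z w) / (4 * t)).
Proof. by rewrite normc_cexp ReM /= mul0r subr0 mulrC. Qed.

Lemma Re_dotC z w : Re (dot z w) = Re (dot w z).
Proof. by rewrite -dot_conj Re_conj. Qed.

Lemma normc_kernC z w : normc (kern z w) = normc (kern w z).
Proof. by rewrite !normc_kern Re_dotC. Qed.

Lemma cmeas_kern2 : cmeas (fun p : Cn * Cn => kern p.1 p.2).
Proof.
apply: cmeas_cexp; apply: cmeasM; [exact: cmeas_cst|exact: cmeas_dot].
Qed.

Lemma cmeas_kern z : cmeas (kern z).
Proof. exact: (cmeasT_comp cmeas_kern2 (pair1_measurable z)). Qed.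

Lemma cmeas_kernr z : cmeas (kern ^~ z).
Proof. exact: (cmeasT_comp cmeas_kern2 (pair2_measurable z)). Qed.

Hypothesis t0 : 0 < t.
Local Open Scope ereal_scope.
Local Notation mu := (@gauss_measure R n t).
Local Notation lam := (@lebesgue_Cn R n).

Let c0 : (0 < (4 * pi * t) ^+ n)%R.
Proof. by rewrite exprn_gt0// !mulr_gt0// pi_gt0. Qed.

Lemma gauss_densityE z : gauss_density t z =
  (((4 * pi * t) ^+ n)^-1 * expR (- sqnorm z / (4 * t)))%R.
Proof. by rewrite /gauss_density gtr0_norm. Qed.

(* For this a, the product of expR (a |z|^2) and the density of mu is a Gaussian
   whose variance is q times that of mu. *)
Lemma gauss_measure_expR (a : R) (q : nat) : (0 < q)%N ->
  (a = (4 * t)^-1 - (4 * q%:R * t)^-1)%R ->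
  \int[mu]_z (expR (a * sqnorm z))%:E = (q%:R ^+ n)%:E.
Proof.
move=> q0 aE; have q0' : (0 < q%:R :> R)%R by rewrite ltr0n.
have mE s : measurable_fun setT (fun z : Cn => expR (s * sqnorm z)).
  by apply: measurableT_comp => //; apply: measurable_funM => //; exact: measurable_sqnorm.
rewrite ge0_integral_gauss_measure; last 2 first.
- exact/measurable_EFinP.
- by move=> z; rewrite lee_fin expR_ge0.
transitivity (\int[lam]_z ((((4 * pi * t) ^+ n)^-1)%:E * (expR (- sqnorm z / (4 * q%:R * t)))%:E)).
  apply: eq_integral => z _; rewrite -!EFinM gauss_densityE mulrCA -expRD; congr (_ * expR _)%:E.
  by rewrite aE; field; rewrite ?gt_eqF.
rewrite ge0_integralZl//.
- rewrite integral_gauss_Cn ?mulr_gt0// -EFinM; congr EFin.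
  rewrite -exprVn -exprMn; congr (_ ^+ _)%R.
  have := lt0r_neq0 (pi_gt0 R); move: (@pi R) => p p0.
  by field; rewrite p0 gt_eqF.
- by apply/measurable_EFinP; under eq_fun do rewrite mulNr -mulrN mulrC; exact: mE.
- by rewrite lee_fin invr_ge0 ltW.
Qed.

Lemma gauss_measureT : mu setT = 1.
Proof.
have := @gauss_measure_expR 0 1 erefl; rewrite mulr1 subrr expr1n => /(_ erefl) <-.
rewrite -[LHS]mul1e -integral_cst//; apply: eq_integral => z _.
by rewrite mul0r expR0.
Qed.

Lemma gauss_measure_sigma_finite : sigma_finite setT mu.
Proof.
exists (fun=> setT); first by rewrite bigcup_const.
by move=> k; split => //; rewrite gauss_measureT ltry.
Qed.

(* sigma-finiteness is packed by hand since it depends on the hypothesis 0 < t *)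
Definition gauss : {sigma_finite_measure set Cn -> \bar R} :=
  HB.pack (@gauss_measure R n t)
    (Measure_isSigmaFinite.Build _ _ _ (@gauss_measure R n t) gauss_measure_sigma_finite).

Lemma ge0_integral_gauss_rotation (c : R[i]) (phi : Cn -> \bar R) :
  normc c = 1%R -> c != (- 1)%R -> measurable_fun setT phi -> (forall z, 0 <= phi z) ->
  \int[mu]_z phi (c *: z)%R = \int[mu]_z phi z.
Proof.
move=> c1 cN1 mphi phi0; have mc := @measurable_Cn_scale R n c.
rewrite (@ge0_integral_gauss_measure _ _ t phi)//.
rewrite (@ge0_integral_gauss_measure _ _ t (fun z => phi (c *: z)%R) (measurableT_comp mphi mc))//.
rewrite -(ge0_integral_rotation c1 cN1 (phi := fun z => phi z * (gauss_density t z)%:E)).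
- by apply: eq_integral => z _; rewrite /gauss_density sqnormZ c1 expr1n mul1r.
- by apply: emeasurable_funM => //; apply/measurable_EFinP; exact: measurable_gauss_density.
- by move=> z; rewrite mule_ge0// lee_fin gauss_density_ge0.
Qed.

(* Invariance of mu under the Weyl translations of the Fock space. *)
Lemma ge0_integral_weyl z (phi : Cn -> \bar R) :
  measurable_fun setT phi -> (forall w, 0 <= phi w) ->
  \int[mu]_w (phi w * (normc (kern z w) ^+ 2 * expR (- sqnorm z / (4 * t)))%:E) =
  \int[mu]_w phi (w + z)%R.
Proof.
move=> mphi phi0; have mz := measurable_translation z.
have mk : measurable_fun setT (fun w => normc (kern z w)).
  exact/measurable_normc/cmeas_kern.
have mphi' : measurable_fun setT
    (fun w => phi w * (normc (kern z w) ^+ 2 * expR (- sqnorm z / (4 * t)))%:E).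
  apply: emeasurable_funM => //; apply/measurable_EFinP; apply: measurable_funM => //.
  exact: measurable_funX.
have phi'0 w : 0 <= phi w * (normc (kern z w) ^+ 2 * expR (- sqnorm z / (4 * t)))%:E.
  by rewrite mule_ge0// lee_fin mulr_ge0 ?sqr_ge0 ?expR_ge0.
rewrite (ge0_integral_gauss_measure t mphi' phi'0).
rewrite (@ge0_integral_gauss_measure _ _ t (fun w => phi (w + z)%R) (measurableT_comp mphi mz))//.
rewrite -(ge0_integral_translation z (phi := fun w => _ * (gauss_density t w)%:E)).
- apply: eq_integral => w _; rewrite -muleA; congr (_ * _); rewrite -EFinM.
  congr EFin; rewrite !gauss_densityE mulrCA; congr (_ * _)%R.
  (* Completing the square: |K(z, w + z)|^2 exp(-|z|^2 / 4t) exp(-|w + z|^2 / 4t) = exp(-|w|^2 /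
     4t). *)
  rewrite normc_kern expr2 -!expRD; congr expR.
  rewrite sqnormD dotDr dot_self ReD /= (Re_dotC w z); field.
  by rewrite gt_eqF.
- by apply: emeasurable_funM => //; apply/measurable_EFinP; exact: measurable_gauss_density.
- by move=> w; rewrite mule_ge0// lee_fin gauss_density_ge0.
Qed.

Lemma cint_weyl z (u : Cn -> R[i]) : cmeas u ->
  cint mu (fun w => u w * (normc (kern z w) ^+ 2 * expR (- sqnorm z / (4 * t)))%:C)%R =
  cint mu (fun w => u (w + z)%R).
Proof.
move=> mu_.
apply: (cint_transfer (f := fun w => (w + z)%R)) mu_; last exact: ge0_integral_weyl.
by move=> w; rewrite mulr_ge0 ?sqr_ge0 ?expR_ge0.
Qed.

End fock_kernel.

(** * The mean value property *)

Section mean_value.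
Context {R : realType} {n : nat}.
Local Notation Cn := 'rV[R[i]]_n.
Variable t : R.
Hypothesis t0 : 0 < t.
Local Notation mu := (@gauss_measure R n t).
Local Notation leb := (@lebesgue_measure R).
Let cis (y : R) : R[i] := cexp (0 +i* y).

(** Open at both ends: the angles pi and -pi, where [cis] is -1, form a null set and lie outside the
    rotation invariance proved above. *)
Let D : set R := `]-pi, pi[%classic.

Let mD : measurable D. Proof. exact: measurable_itv. Qed.

Let cis_neqN1 y : D y -> cis y != -1.
Proof.
rewrite /D /= in_itv/= => /andP[y1 y2]; apply/eqP => /(congr1 (@complex.Re R)).
rewrite /cexp /= expR0 mul1r -cospi -cos_norm => h.
have yy : `|y| < pi by rewrite ltr_norml y1.
have : `|y| = pi.
  by apply: cos_inj => //; rewrite in_itv/= ?normr_ge0 ?(ltW yy) ?pi_ge0 ?lexx.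
by move=> e; rewrite e ltxx in yy.
Qed.

Let normc_cis y : normc (cis y) = 1.
Proof. by rewrite normc_cexp /= expR0. Qed.

Let leb_D : leb D = (2 * pi)%:E.
Proof.
rewrite /D lebesgue_measure_itv/= lte_fin (_ : - pi < pi = true).
  by rewrite -EFinB; congr EFin; ring.
by have := pi_gt0 R; lra.
Qed.

Let int_indic_D : (\int[leb]_y (\1_D y)%:E = (2 * pi)%:E)%E.
Proof. by rewrite integral_indic//; apply: etrans leb_D; rewrite setIT. Qed.

Let cmeas_indic : cmeas (fun y : measurableTypeR R => (\1_D y : R)%:C).
Proof. by apply: cmeas_real; exact: measurable_indic. Qed.

Variable h : Cn -> R[i].
Hypotheses (entire_h : entire h) (ih : cintegrable mu h).

(** The indicator restricts the angle to [D] while Fubini is applied on the whole line. *)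
Let g (p : measurableTypeR R * Cn) : R[i] := (\1_D p.1)%:C * h (cis p.1 *: p.2).

Let mh : cmeas h. Proof. by have [] := ih. Qed.

Let mact : measurable_fun setT (fun p : measurableTypeR R * Cn => cis p.1 *: p.2).
Proof.
have mc : cmeas (fun p : measurableTypeR R * Cn => cis p.1).
  apply: (cmeasT_comp _ measurable_fst); apply: cmeas_cexp.
  by split; [exact: measurable_cst|exact: measurable_id].
have mj j : cmeas (fun p : measurableTypeR R * Cn => cis p.1 * p.2 ord0 j).
  by apply: cmeasM => //; exact: (cmeasT_comp (cmeas_coord j) measurable_snd).
by apply: measurable_fun_Cn => j; under eq_fun do rewrite mxE; [exact: (mj j).1|exact: (mj j).2].
Qed.

Let mg : cmeas g.
Proof.
apply: cmeasM; first exact: (cmeasT_comp cmeas_indic measurable_fst).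
exact: (cmeasT_comp mh mact).
Qed.

Let int_rot y : D y -> (\int[mu]_z (normc (h (cis y *: z)))%:E = \int[mu]_z (normc (h z))%:E)%E.
Proof.
move=> Dy; have mn : measurable_fun setT (fun z => (normc (h z))%:E).
  exact/measurable_EFinP/measurable_normc.
have n0 z : (0 <= (normc (h z))%:E)%E by rewrite lee_fin normc_ge0.
exact: (ge0_integral_gauss_rotation _ (normc_cis y) (cis_neqN1 Dy) mn n0).
Qed.

Let int_g y : (\int[mu]_z (normc (g (y, z)))%:E =
  (\1_D y)%:E * \int[mu]_z (normc (h z))%:E)%E.
Proof.
rewrite /g /=; have [Dy|nDy] := pselect (D y).
  rewrite indicE mem_set//= mul1e -(int_rot Dy); apply: eq_integral => z _.
  by rewrite mul1r.
rewrite indicE memNset//= mul0e; apply: integral0_eq => z _.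
by rewrite mul0r ComplexField.Normc.normc0.
Qed.

Let sec1 (y : measurableTypeR R) : cintegrable mu (fun z => g (y, z)).
Proof.
split; first exact: (cmeasT_comp mg (pair1_measurable y)).
rewrite int_g lte_mul_pinfty ?lee_fin ?indicE//; exact: ih.2.
Qed.

Let seg_indic (f : R -> R) : continuous f ->
  leb.-integrable setT (EFin \o (fun y => \1_D y * f y)) /\
  \int[leb]_y (\1_D y * f y) = segint f (-pi) pi.
Proof.
move=> cf.
have i1 : leb.-integrable D (EFin \o f).
  apply: integrableS (segment_integrable (-pi) pi cf) => //.
  exact: subset_itv_oo_cc.
have E : (fun y => \1_D y * f y) = f \_ D.
  by apply/funext => y; rewrite patchE indicE; case: ifP => _; rewrite ?mul1r ?mul0r.
rewrite E; split.
  by rewrite -restrict_EFin; exact: ((integrable_mkcond (mu := leb) (EFin \o f) mD).1 i1).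
rewrite -Rintegral_mkcond /segint -Rintegral_itv_bndo_bndc; last first.
  apply: integrableS (segment_integrable (-pi) pi cf) => //.
  exact: subset_itv_co_cc.
by rewrite -Rintegral_itv_obnd_cbnd.
Qed.

Let Re_g y z : Re (g (y, z)) = \1_D y * Re (h (cis y *: z)).
Proof. by rewrite /g ReM /= mul0r subr0. Qed.

Let Im_g y z : Im (g (y, z)) = \1_D y * Im (h (cis y *: z)).
Proof. by rewrite /g ImM /= mul0r addr0. Qed.

Let sec2 z : cintegrable leb (fun y : measurableTypeR R => g (y, z)).
Proof.
have m2 : cmeas (fun y : measurableTypeR R => g (y, z)).
  exact: (cmeasT_comp mg (pair2_measurable z)).
have [/integrableP[mr ir] _] := seg_indic (@continuous_circle_Re R n h z entire_h).
have [/integrableP[mi ii] _] := seg_indic (@continuous_circle_Im R n h z entire_h).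
pose G (y : measurableTypeR R) := `|\1_D y * Re (h (cis y *: z))| + `|\1_D y * Im (h (cis y *: z))|.
have mG1 : measurable_fun setT (fun y : measurableTypeR R => `|\1_D y * Re (h (cis y *: z))|).
  by apply: measurableT_comp => //; exact/measurable_EFinP.
have mG2 : measurable_fun setT (fun y : measurableTypeR R => `|\1_D y * Im (h (cis y *: z))|).
  by apply: measurableT_comp => //; exact/measurable_EFinP.
have gG y : normc (g (y, z)) <= G y by rewrite /G -Re_g -Im_g; exact: normc_le_ReIm.
apply: (cintegrable_le m2 (measurable_funD mG1 mG2) gG).
exact: (ge0_integral_ltyD mG1 mG2).
Qed.

(** The double integral of g is computed in both orders. Integrating over C^n inside gives 2 pi
    times the mean of h, by rotation invariance; integrating over the angle inside gives 2 pi h(0)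
    for each z, by the circle means, and mu has mass 1. *)
Lemma mean_value : cint mu h = h 0.
Proof.
have fin_g : (\int[leb]_y \int[gauss t0]_z (normc (g (y, z)))%:E < +oo)%E.
  under eq_integral do rewrite int_g.
  rewrite ge0_integralZr//; last 2 first.
  - by apply/measurable_EFinP; exact: measurable_indic.
  - by apply: integral_ge0 => z _; rewrite lee_fin normc_ge0.
  rewrite int_indic_D lte_mul_pinfty//; last exact: ih.2.
  by rewrite lee_fin mulr_ge0// pi_ge0.
have := @cint_fubini _ _ _ _ R leb (gauss t0) g mg fin_g sec1 sec2.
have -> : cint leb (fun y => cint (gauss t0) (fun z => g (y, z))) =
    (2 * pi)%:C * cint mu h.
  transitivity (cint leb (fun y => cint mu h * (\1_D y)%:C)).
    apply: eq_cint => y; rewrite /g /=; have [Dy|nDy] := pselect (D y).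
      rewrite indicE mem_set//= mulr1; under eq_cint do rewrite mul1r.
      have := @cint_transfer _ _ _ _ R mu mu (fun=> 1) (fun z => cis y *: z) _ _ h mh.
      move=> <-//.
      - by apply: eq_cint => z; rewrite mulr1.
      - move=> phi mphi phi0; under eq_integral do rewrite mule1.
        by rewrite -(ge0_integral_gauss_rotation _ (normc_cis y) (cis_neqN1 Dy)).
    rewrite indicE memNset//= mulr0 -[RHS](cint0 mu); apply: eq_cint => z.
    by rewrite mul0r.
  rewrite cintZ; last first.
    split=> //; under eq_integral do rewrite normc_real ger0_norm//.
    by rewrite int_indic_D ltry.
  rewrite mulrC; congr (_ * _); apply: complexP; rewrite /cint /= /Rintegral.
    by rewrite int_indic_D.
  by rewrite integral0.
have -> : cint (gauss t0) (fun z => cint leb (fun y => g (y, z))) = (2 * pi)%:C * h 0.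
  transitivity (cint (gauss t0) (fun _ : Cn => (2 * pi)%:C * h 0)).
    apply: eq_cint => z; apply: complexP; rewrite ?ReM ?ImM /cint /= mul0r ?subr0 ?addr0.
      rewrite -(circle_mean_Re z entire_h) -(seg_indic (@continuous_circle_Re R n h z entire_h)).2.
      by apply: eq_Rintegral => y _; rewrite Re_g.
    rewrite -(circle_mean_Im z entire_h) -(seg_indic (@continuous_circle_Im R n h z entire_h)).2.
    by apply: eq_Rintegral => y _; rewrite Im_g.
  apply: complexP; rewrite /cint /= Rintegral_cst//= gauss_measureT//= mulr1//.
apply: mulfI; apply/eqP => /(congr1 (@complex.Re R)) /=; have := pi_gt0 R; lra.
Qed.

End mean_value.

(** * The reproducing formula *)

Section coordinate_forms.
Context {R : realType} {n : nat}.
Local Notation Cn := 'rV[R[i]]_n.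

Definition coord_form (c : 'I_n -> R[i]) (v : Cn) : R[i] := \sum_j v ord0 j * c j.

Lemma coord_form_is_linear c : linear (coord_form c).
Proof.
move=> a u v; rewrite /coord_form scaler_sumr -big_split; apply: eq_bigr => j _ /=.
by rewrite !mxE mulrDl -mulrA.
Qed.

HB.instance Definition _ c := GRing.isLinear.Build R[i] Cn R[i] _ (coord_form c)
  (coord_form_is_linear c).

Lemma continuous_coord_form c : continuous (coord_form c).
Proof.
move=> x; apply: (@differentiable_continuous R[i] Cn R[i]).
rewrite (_ : coord_form c = \sum_j (fun v : Cn => v ord0 j * c j)); last first.
  by apply/funext => v; rewrite fct_sumE.
apply: differentiable_sum => j.
by apply: differentiableM => //; exact: differentiable_coord.
Qed.

(** A quadratic remainder with an explicit constant can be integrated against a measure, which a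
    mere little-o cannot; this is how integrals of kernels are shown to be entire. *)
Lemma differentiable_quadratic (h : Cn -> R[i]) z c (K : R) :
  (forall v, rnorm v <= 1 ->
    normc (h (z + v) - h z - coord_form c v) <= K * rnorm v ^+ 2) ->
  differentiable h z.
Proof.
move=> H; apply: (@differentiable_taylor1 _ _ _ _ (coord_form c)).
  exact: continuous_coord_form.
move=> e e0.
have K0 : 0 < `|K| + 1 by rewrite ltr_wpDl.
exists (Num.min 1 (e / (`|K| + 1))); first by rewrite lt_min ltr01 divr_gt0.
move=> v; rewrite lt_min => /andP[v1 ve]; apply: (le_trans (H v (ltW v1))).
rewrite expr2 mulrA ler_wpM2r ?rnorm_ge0//.
apply: (@le_trans _ _ ((`|K| + 1) * rnorm v)).
  by rewrite ler_wpM2r ?rnorm_ge0// (le_trans (ler_norm _))// lerDl.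
by rewrite -ler_pdivlMl// mulrC ltW.
Qed.

End coordinate_forms.

(** * Kernel estimates, differentiation under the integral, reproducing formula *)

Section kernel_estimates.
Context {R : realType} {n : nat}.
Local Notation Cn := 'rV[R[i]]_n.
Variable t : R.
Hypothesis t0 : 0 < t.
Implicit Types z v w : Cn.
Local Notation mu := (@gauss_measure R n t).
Local Notation kern := (kern t).

Let t4 : 0 < 4 * t. Proof. by rewrite mulr_gt0. Qed.

(** The l^1 norm divided by 4t, dual to the sup norm [rnorm]: |<z, w>| / 4t <= rnorm z * ell w. *)
Let ell w : R := (4 * t)^-1 * \sum_j normc (w ord0 j).

Let ell_ge0 w : 0 <= ell w.
Proof.
by rewrite mulr_ge0 ?invr_ge0 ?(ltW t4)// sumr_ge0// => j _; exact: normc_ge0.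
Qed.

Let measurable_ell : measurable_fun setT ell.
Proof.
apply: measurable_funM => //; apply: measurable_sum => j.
by apply: measurable_normc; exact: cmeas_coord.
Qed.

Let normc_dot_le z w : normc ((4 * t)^-1%:C * dot z w) <= rnorm z * ell w.
Proof.
rewrite ComplexField.Normc.normcM normc_real ger0_norm ?invr_ge0 ?(ltW t4)//.
rewrite /ell mulrCA ler_wpM2l ?invr_ge0 ?(ltW t4)//.
apply: (le_trans (normc_sum _)); rewrite mulr_sumr; apply: ler_sum => j _.
rewrite ComplexField.Normc.normcM normc_conj ler_wpM2r ?normc_ge0//.
exact: normc_coord_le.
Qed.

Lemma kernDl z v w : kern (z + v) w = kern z w * kern v w.
Proof. by rewrite /kern dotDl mulrDr cexpD. Qed.

Let normc_kern_le z w : normc (kern z w) <= expR (rnorm z * ell w).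
Proof.
rewrite normc_cexp ler_expR; apply: le_trans (normc_dot_le z w).
exact: le_trans (ler_norm _) (normr_Re_le _).
Qed.

(** Uses K(z + v, w) = K(z, w) e^b with b = <v, w> / 4t. The 2 in rnorm z + 2 pays for the
    exponential in the Taylor bound, as |b| <= ell w, and for (ell w)^2 <= 2 exp(ell w), which also
    turns the constant 4 into 8. *)
Let kern_taylor z v w : rnorm v <= 1 ->
  normc (kern (z + v) w - kern z w - kern z w * ((4 * t)^-1%:C * dot v w)) <=
  8 * expR ((rnorm z + 2) * ell w) * rnorm v ^+ 2.
Proof.
move=> v1; set b := (4 * t)^-1%:C * dot v w.
have -> : kern (z + v) w - kern z w - kern z w * b = kern z w * (cexp b - 1 - b).
  by rewrite kernDl /kern -/b; ring.
have l0 := ell_ge0 w; have r0 := rnorm_ge0 v.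
have bl : normc b <= rnorm v * ell w := normc_dot_le v w.
have b0 := normc_ge0 b.
rewrite ComplexField.Normc.normcM.
apply: (@le_trans _ _ (expR (rnorm z * ell w) *
    (4 * (rnorm v * ell w) ^+ 2 * expR (ell w)))).
  apply: ler_pM; rewrite ?normc_ge0//.
  apply: (le_trans (cexp_taylor1 b)); apply: ler_pM.
  - by rewrite mulr_ge0// sqr_ge0.
  - exact: expR_ge0.
  - by rewrite ler_wpM2l// lerXn2r// nnegrE// mulr_ge0.
  - by rewrite ler_expR (le_trans bl)// ler_piMl.
have l2 : ell w ^+ 2 <= 2 * expR (ell w).
  by have := @expR_ge1Dxn R (ell w) 1 l0; rewrite (_ : 2`!%:R = 2 :> R)//; lra.
have -> : expR ((rnorm z + 2) * ell w) = expR (rnorm z * ell w) * (expR (ell w) * expR (ell w)).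
  by rewrite -!expRD; congr expR; ring.
set E := expR (ell w) in l2 *; set e := expR (rnorm z * ell w).
have k0 : 0 <= e * (4 * rnorm v ^+ 2 * E).
  by rewrite !mulr_ge0 ?expR_ge0 ?sqr_ge0.
have := ler_wpM2l k0 l2.
have -> : e * (4 * rnorm v ^+ 2 * E) * (2 * E) = 8 * (e * (E * E)) * rnorm v ^+ 2 by ring.
by congr (_ <= _); ring.
Qed.

Lemma entire_kern w : entire (kern ^~ w).
Proof.
move=> z; pose c (j : 'I_n) := kern z w * ((4 * t)^-1%:C * (w ord0 j)^*).
apply: (@differentiable_quadratic _ _ _ _ c (8 * expR ((rnorm z + 2) * ell w))) => v v1.
have -> : coord_form c v = kern z w * ((4 * t)^-1%:C * dot v w).
  rewrite /coord_form /dot !mulr_sumr; apply: eq_bigr => j _; rewrite /c; ring.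
exact: kern_taylor.
Qed.

(** Coordinatewise a s <= 4t a^2 + s^2 / 16t, by completing the square. The exponent 1 / 16t is
    chosen so that the square of the right-hand side, with exponent 1 / 8t, is still integrable. *)
Let expR_ell_le (B : R) : 0 <= B -> exists2 C : R, 0 <= C &
  forall w, expR (B * ell w) <= C * expR (sqnorm w / (16 * t)).
Proof.
move=> B0; pose a := B / (4 * t).
exists (expR (\sum_(j < n) 4 * t * a ^+ 2)); first exact: expR_ge0.
move=> w; rewrite -expRD ler_expR /ell mulrA -/a mulr_sumr /sqnorm mulr_suml -big_split /=.
apply: ler_sum => j _; set s := normc _.
rewrite -subr_ge0.
have -> : 4 * t * a ^+ 2 + s ^+ 2 / (16 * t) - a * s = (s - 8 * t * a) ^+ 2 / (16 * t).
  by field; rewrite gt_eqF.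
by rewrite divr_ge0 ?sqr_ge0// mulr_ge0// ltW.
Qed.

Let gauss8 : (\int[mu]_w (expR (sqnorm w / (8 * t)))%:E < +oo)%E.
Proof.
have E : (8 * t)^-1 = (4 * t)^-1 - (4 * 2%:R * t)^-1 by field; rewrite gt_eqF.
under eq_integral do rewrite mulrC.
by rewrite (gauss_measure_expR t0 _ E)// ltry.
Qed.

(** From |u| x <= |u|^2 + x^2 with x = exp(B ell), whose square is dominated by a multiple of
    exp(|w|^2 / 8t). *)
Let L2_expR_ell (u : Cn -> R[i]) (B : R) : 0 <= B -> cmeas u ->
  (\int[mu]_w (normc (u w) ^+ 2)%:E < +oo)%E ->
  (\int[mu]_w (normc (u w) * expR (B * ell w))%:E < +oo)%E.
Proof.
move=> B0 mu_ iu; have [C C0 CP] := expR_ell_le B0.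
have mn : measurable_fun setT (fun w => normc (u w)) by exact: measurable_normc.
have mE : measurable_fun setT (fun w : Cn => expR (sqnorm w / (8 * t))).
  by apply: measurableT_comp => //; apply: measurable_funM => //; exact: measurable_sqnorm.
have mn2 : measurable_fun setT (fun w => normc (u w) ^+ 2) by exact: measurable_funX.
have mCE : measurable_fun setT (fun w : Cn => C ^+ 2 * expR (sqnorm w / (8 * t))).
  exact: measurable_funM.
apply: (@ge0_integral_lty_le _ _ _ _ _
  (fun w => normc (u w) ^+ 2 + C ^+ 2 * expR (sqnorm w / (8 * t)))).
- apply: measurable_funM => //; apply: measurableT_comp => //.
  exact: measurable_funM.
- exact: measurable_funD.
- move=> w; rewrite mulr_ge0 ?normc_ge0 ?expR_ge0//=.
  have := CP w; have -> : expR (sqnorm w / (8 * t)) = expR (sqnorm w / (16 * t)) ^+ 2.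
    rewrite expr2 -expRD; congr expR; by field; rewrite gt_eqF.
  set x := expR (B * _); set y := expR (sqnorm w / _); set s := normc _ => xy.
  have x0 : 0 <= x by exact: expR_ge0.
  have s0 : 0 <= s by exact: normc_ge0.
  have : x * x <= (C * y) * (C * y) by apply: ler_pM.
  have := sqr_ge0 (s - x); nra.
- apply: ge0_integral_ltyD => //.
  + by move=> w; rewrite sqr_ge0.
  + by move=> w; rewrite mulr_ge0 ?sqr_ge0 ?expR_ge0.
  + apply: ge0_integral_ltyZ => //; rewrite ?sqr_ge0// => w; exact: expR_ge0.
Qed.

Lemma cintegrable_kern (u : Cn -> R[i]) z : cmeas u ->
  (\int[mu]_w (normc (u w) ^+ 2)%:E < +oo)%E ->
  cintegrable mu (fun w => u w * kern z w).
Proof.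
move=> mu_ iu; apply: (cintegrable_le _ _ _ (L2_expR_ell (rnorm_ge0 z) mu_ iu)).
- by apply: cmeasM => //; exact: cmeas_kern.
- apply: measurable_funM; first exact: measurable_normc.
  by apply: measurableT_comp => //; exact: measurable_funM.
- move=> w; rewrite ComplexField.Normc.normcM ler_wpM2l ?normc_ge0//.
Qed.

Lemma kern_L2 z : (\int[mu]_w (normc (kern z w) ^+ 2)%:E < +oo)%E.
Proof.
have [C C0 CP] := expR_ell_le (rnorm_ge0 z).
have mE : measurable_fun setT (fun w : Cn => expR (sqnorm w / (8 * t))).
  by apply: measurableT_comp => //; apply: measurable_funM => //; exact: measurable_sqnorm.
apply: (@ge0_integral_lty_le _ _ _ _ _ (fun w => C ^+ 2 * expR (sqnorm w / (8 * t)))).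
- by apply: measurable_funX; apply: measurable_normc; exact: cmeas_kern.
- exact: measurable_funM.
- move=> w; rewrite sqr_ge0 /=.
  have -> : expR (sqnorm w / (8 * t)) = expR (sqnorm w / (16 * t)) ^+ 2.
    rewrite expr2 -expRD; congr expR; by field; rewrite gt_eqF.
  rewrite -exprMn lerXn2r ?nnegrE ?normc_ge0 ?mulr_ge0 ?expR_ge0//.
  exact: le_trans (normc_kern_le z w) (CP w).
- by apply: ge0_integral_ltyZ => //; rewrite ?sqr_ge0// => w; exact: expR_ge0.
Qed.

(** Differentiation under the integral: the pointwise quadratic remainder of [kern_taylor] is
    integrated against |u|, with [I2] the finite integral of |u| exp((rnorm z + 2) ell). The leading
    2 is the loss in [normc_cint_le]. *)
Lemma entire_cint_kern (u : Cn -> R[i]) : cmeas u ->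
  (\int[mu]_w (normc (u w) ^+ 2)%:E < +oo)%E ->
  entire (fun z => cint mu (fun w => u w * kern z w)).
Proof.
move=> mu_ iu z.
have ik z' := cintegrable_kern z' mu_ iu.
have mn : measurable_fun setT (fun w => normc (u w)) by exact: measurable_normc.
have mE B : measurable_fun setT (fun w => expR (B * ell w)).
  by apply: measurableT_comp => //; exact: measurable_funM.
have z2 : 0 <= rnorm z + 2 by rewrite addr_ge0// rnorm_ge0.
have fin2 := L2_expR_ell z2 mu_ iu.
set I2 := (\int[mu]_w _)%E in fin2.
have I20 : (0 <= I2)%E.
  by apply: integral_ge0 => w _; rewrite lee_fin mulr_ge0 ?normc_ge0 ?expR_ge0.
have idj j : cintegrable mu (fun w => u w * (kern z w * ((4 * t)^-1%:C * (w ord0 j)^*))).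
  apply: (cintegrable_le _ _ _ fin2).
  - apply: cmeasM => //; apply: cmeasM; first exact: cmeas_kern.
    by apply: cmeasM; [exact: cmeas_cst|apply: cmeas_conj; exact: cmeas_coord].
  - exact: measurable_funM.
  - move=> w; rewrite 3!ComplexField.Normc.normcM ler_wpM2l ?normc_ge0//.
    have l0 := ell_ge0 w.
    have -> : expR ((rnorm z + 2) * ell w) = expR (rnorm z * ell w) * expR (2 * ell w).
      by rewrite -expRD mulrDl.
    apply: ler_pM; rewrite ?mulr_ge0 ?normc_ge0//.
    rewrite normc_real ger0_norm ?invr_ge0 ?(ltW t4)// normc_conj.
    apply: (@le_trans _ _ (ell w)).
      rewrite /ell ler_wpM2l ?invr_ge0 ?(ltW t4)//.
      rewrite (bigD1 j)//= lerDl sumr_ge0// => k _; exact: normc_ge0.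
    have := expR_ge1Dx (2 * ell w); lra.
pose c (j : 'I_n) := cint mu (fun w => u w * (kern z w * ((4 * t)^-1%:C * (w ord0 j)^*))).
apply: (@differentiable_quadratic _ _ _ _ c (2 * (8 * fine I2))) => v v1.
have cE : coord_form c v = cint mu (fun w => u w * (kern z w * ((4 * t)^-1%:C * dot v w))).
  transitivity (cint mu (fun w => \sum_j v ord0 j *
      (u w * (kern z w * ((4 * t)^-1%:C * (w ord0 j)^*))))).
    rewrite cint_sum; last by move=> j; exact: cintegrableZ.
    by apply: eq_bigr => j _; rewrite cintZ.
  by apply: eq_cint => w; rewrite /dot !mulr_sumr; apply: eq_bigr => j _; ring.
have iD : cintegrable mu (fun w => u w * (kern z w * ((4 * t)^-1%:C * dot v w))).
  have : cintegrable mu (fun w => \sum_j v ord0 j *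
      (u w * (kern z w * ((4 * t)^-1%:C * (w ord0 j)^*)))).
    by apply: cintegrable_sum => j; exact: cintegrableZ.
  congr cintegrable; apply/funext => w.
  by rewrite /dot !mulr_sumr; apply: eq_bigr => j _; ring.
rewrite cE -cintB// -cintB//; last exact: cintegrableB.
have iR := cintegrableB (cintegrableB (ik (z + v)) (ik z)) iD.
rewrite -lee_fin; apply: (le_trans (normc_cint_le iR)).
rewrite -mulrA EFinM lee_wpmul2l ?lee_fin//.
apply: (@le_trans _ _ (\int[mu]_w ((8 * rnorm v ^+ 2) *
    (normc (u w) * expR ((rnorm z + 2) * ell w)))%:E)%E).
  apply: ge0_le_integral => //.
  - by move=> w _; rewrite lee_fin normc_ge0.
  - by apply/measurable_EFinP/measurable_normc; case: iR.
  - by apply/measurable_EFinP; apply: measurable_funM => //; exact: measurable_funM.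
  - move=> w _; rewrite lee_fin -!mulrBr ComplexField.Normc.normcM.
    rewrite [leRHS]mulrCA ler_wpM2l ?normc_ge0// mulrAC.
    exact: kern_taylor.
under eq_integral do rewrite EFinM.
rewrite ge0_integralZl//; last 3 first.
- by apply/measurable_EFinP; exact: measurable_funM.
- by move=> w _; rewrite lee_fin mulr_ge0 ?normc_ge0 ?expR_ge0.
- by rewrite lee_fin mulr_ge0// sqr_ge0.
rewrite -/I2 -[leLHS]/(_ * I2)%E -[in leLHS](@fineK _ I2) ?ge0_fin_numE//.
by rewrite -EFinM lee_fin mulrAC.
Qed.

(** A Weyl translation by z turns the integrand q(w) K(z, w) into q(w + z) K(w, -z), which is entire
    in w with value q(z) at 0; the mean value property concludes. *)
Lemma reproducing (q : Cn -> R[i]) z : entire q -> cmeas q ->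
  (\int[mu]_w (normc (q w) ^+ 2)%:E < +oo)%E ->
  cint mu (fun w => q w * kern z w) = q z.
Proof.
move=> eq mq iq.
pose d := expR (sqnorm z / (4 * t)).
(* Solves u(w) |K(z, w)|^2 exp(-|z|^2 / 4t) = q(w) K(z, w), where |K(z, w)|^2 = K(z, w) K(w, z) and
   K(-w, z) K(w, z) = 1. *)
pose u w := q w * kern (- w) z * d%:C.
have mN : measurable_fun setT (fun w : Cn => - w).
  have := @measurable_Cn_scale R n (-1); by under eq_fun do rewrite scaleN1r.
have mu_ : cmeas u.
  apply: cmeasM; last exact: cmeas_cst.
  apply: cmeasM => //; exact: (cmeasT_comp (cmeas_kernr t z) mN).
have nk w : kern (- w) z * (normc (kern z w) ^+ 2)%:C = kern z w.
  have e : (normc (kern z w) ^+ 2)%:C = kern z w * kern w z.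
    rewrite -(kern_conj t z w) sqr_normcE.
    by apply: complexP; rewrite ?ReM ?ImM Re_conj Im_conj /=; ring.
  rewrite e mulrCA -kernDl addNr.
  have -> : kern 0 z = 1.
    by rewrite /kern /dot big1 ?mulr0 ?cexp0// => j _; rewrite mxE mul0r.
  by rewrite mulr1.
have ud w : u w * (normc (kern z w) ^+ 2 * expR (- sqnorm z / (4 * t)))%:C = q w * kern z w.
  have dd : d%:C * (expR (- sqnorm z / (4 * t)))%:C = 1 :> R[i].
    by rewrite -rmorphM /= /d mulNr -expRD subrr expR0.
  rewrite /u rmorphM /= -[RHS]mulr1 -dd -[in RHS]nk; ring.
have uz w : u (w + z) = q (w + z) * kern w (- z).
  rewrite /u -mulrA; congr (_ * _).
  rewrite opprD kernDl.
  have -> : kern (- w) z = kern w (- z).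
    rewrite /kern; congr cexp; congr (_ * _); apply: eq_bigr => j _.
    by rewrite !mxE rmorphN mulrN mulNr.
  have -> : kern (- z) z = (expR (- sqnorm z / (4 * t)))%:C.
    rewrite /kern -scaleN1r.
    have -> : dot (-1 *: z) z = (- sqnorm z)%:C.
      rewrite rmorphN /= -dot_self /dot -sumrN; apply: eq_bigr => j _.
      by rewrite mxE mulN1r mulNr.
    by rewrite -rmorphM /= /cexp /= cos0 sin0 mulr1 mulr0 mulrC.
  by rewrite -mulrA -rmorphM /= /d mulNr -expRD addNr expR0 mulr1.
transitivity (cint mu (fun w => u (w + z))).
  rewrite -(cint_weyl t0 z mu_); apply: eq_cint => w; exact/esym/ud.
under eq_cint do rewrite uz.
rewrite (mean_value t0).
- by rewrite add0r /kern /dot big1 ?mulr0 ?cexp0 ?mulr1// => j _; rewrite mxE mul0r.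
- move=> w; apply: (@differentiableM _ _ (fun w => q (w + z)) (kern ^~ (- z))).
    apply: (@differentiable_comp _ _ _ _ (fun w => w + z) q); last exact: eq.
    by apply: differentiableD.
  exact: entire_kern.
- split.
    apply: cmeasM; last exact: cmeas_kernr.
    exact: (cmeasT_comp mq (measurable_translation z)).
  under eq_integral do rewrite -uz.
  (* The same translation, applied to |u|, brings integrability back to that of q K(z, .). *)
  rewrite -(@ge0_integral_weyl _ _ t t0 z (fun w => (normc (u w))%:E)).
  + under eq_integral => w _.
      rewrite -EFinM -[X in (_ * X)%:E]ger0_norm; last by rewrite mulr_ge0 ?sqr_ge0 ?expR_ge0.
      rewrite -normc_real -ComplexField.Normc.normcM ud; over.
    by have [] := cintegrable_kern z mq iq.
  + exact/measurable_EFinP/measurable_normc.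
  + by move=> w; rewrite lee_fin normc_ge0.
Qed.

End kernel_estimates.

(** * Schur bounds on the Fock space *)

Section fock_space.
Context {R : realType} {n : nat}.
Local Notation Cn := 'rV[R[i]]_n.
Variable t : R.
Hypothesis t0 : 0 < t.
Implicit Types (z w : Cn) (u v h p q : Cn -> R[i]).
Local Notation mu := (@gauss_measure R n t).
Local Notation kern := (kern t).

Let t4 : 0 < 4 * t. Proof. by rewrite mulr_gt0. Qed.

(** The square of [norm2], in which Schur's test is stated without roots. *)
Definition sqint u : \bar R := (\int[mu]_z (normc (u z) ^+ 2)%:E)%E.

Lemma sqint_ge0 u : (0 <= sqint u)%E.
Proof. by apply: integral_ge0 => z _; rewrite lee_fin sqr_ge0. Qed.

Lemma norm2E u : norm2 t u = sqrte (sqint u).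
Proof.
rewrite /norm2 /cLnorm unlock poweR12_sqrt; last first.
  by apply: integral_ge0 => x _; exact: poweR_ge0.
congr sqrte; apply: eq_integral => x _ /=.
by rewrite powR_mulrn// real_normK// num_real.
Qed.

Lemma norm2_lty u : (norm2 t u < +oo)%E = (sqint u < +oo)%E.
Proof.
rewrite norm2E -!ge0_fin_numE ?sqint_ge0 ?sqrte_ge0//.
by rewrite sqrte_fin_num// sqint_ge0.
Qed.

Lemma L2tP u : L2t t u <-> cmeas u /\ (sqint u < +oo)%E.
Proof. by rewrite -norm2_lty. Qed.

Lemma norm2_le (C : R) u v : 0 <= C -> (sqint v <= (C ^+ 2)%:E * sqint u)%E ->
  (norm2 t v <= C%:E * norm2 t u)%E.
Proof.
move=> C0 H; rewrite !norm2E.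
have -> : C%:E = sqrte (C ^+ 2)%:E by rewrite /= sqrtr_sqr ger0_norm.
rewrite -sqrteM ?lee_fin ?sqr_ge0// lee_sqrt// mule_ge0 ?sqint_ge0//.
by rewrite lee_fin sqr_ge0.
Qed.

Lemma cintegrable_mul u v : cmeas u -> cmeas v ->
  (sqint u < +oo)%E -> (sqint v < +oo)%E -> cintegrable mu (fun z => u z * v z).
Proof.
move=> mu_ mv iu iv.
have m2 q : cmeas q -> measurable_fun setT (fun z => normc (q z) ^+ 2).
  by move=> mq; apply: measurable_funX; exact: measurable_normc.
apply: (@cintegrable_le _ _ _ _ _ (fun z => normc (u z) ^+ 2 + normc (v z) ^+ 2)).
- exact: cmeasM.
- by apply: measurable_funD; exact: m2.
- move=> z; rewrite ComplexField.Normc.normcM.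
  have := sqr_ge0 (normc (u z) - normc (v z)).
  have := normc_ge0 (u z); have := normc_ge0 (v z); nra.
- by apply: ge0_integral_ltyD => //; try exact: m2; move=> z; exact: sqr_ge0.
Qed.

Lemma sqintB_le u v : cmeas u -> cmeas v ->
  (sqint (fun z => u z - v z)%R <= 2%:E * (sqint u + sqint v))%E.
Proof.
move=> mu_ mv.
have m2 q : cmeas q -> measurable_fun setT (fun z => (normc (q z) ^+ 2)%:E).
  by move=> mq; apply/measurable_EFinP; apply: measurable_funX; exact: measurable_normc.
have p2 q z : (0 <= (normc (q z) ^+ 2)%:E)%E by rewrite lee_fin sqr_ge0.
rewrite /sqint -ge0_integralD//; try exact: m2.
rewrite -ge0_integralZl//; last 2 first.
- by apply: emeasurable_funD; exact: m2.
- by move=> z _; exact: adde_ge0.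
apply: ge0_le_integral => //.
- by move=> z _; exact: (p2 (fun z => u z - v z)).
- exact: (m2 _ (cmeasB mu_ mv)).
- by apply: measurable_funeM; apply: emeasurable_funD; exact: m2.
- move=> z _; rewrite -EFinD -EFinM lee_fin.
  have h1 : normc (u z - v z) <= normc (u z) + normc (v z).
    by apply: (le_trans (le_normcD _ _)); rewrite normcN.
  apply: (@le_trans _ _ ((normc (u z) + normc (v z)) ^+ 2)).
    by rewrite lerXn2r ?nnegrE ?addr_ge0 ?normc_ge0.
  have := sqr_ge0 (normc (u z) - normc (v z)); lra.
Qed.

(* Upper bound for |f z - f w| as a function of z - w that is integrable against
   the Gaussian weights of the Schur test below. *)
Definition growth (a b : R) z : R := a + b * expR (sqnorm z / (16 * t)).

Lemma measurable_growth a b : measurable_fun setT (growth a b).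
Proof.
apply: measurable_funD => //; apply: measurable_funM => //.
by apply: measurableT_comp => //; apply: measurable_funM => //; exact: measurable_sqnorm.
Qed.

Lemma growth_ge0 a b z : 0 <= a -> 0 <= b -> 0 <= growth a b z.
Proof. by move=> a0 b0; rewrite addr_ge0// mulr_ge0// expR_ge0. Qed.

(** 2^n and 4^n are the integrals against mu of exp(|w|^2 / 8t) and exp(3 |w|^2 / 16t), Gaussians of
    2 and 4 times the variance of mu; neither depends on t. *)
Definition schur_cst (a b : R) : R := 2 ^+ n * a + 4 ^+ n * b.

Lemma schur_cst_ge0 a b : 0 <= a -> 0 <= b -> 0 <= schur_cst a b.
Proof. by move=> a0 b0; rewrite addr_ge0// mulr_ge0// exprn_ge0. Qed.

Let measurable_weight (c : R) : measurable_fun setT (fun w : Cn => expR (sqnorm w / c)).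
Proof.
by apply: measurableT_comp => //; apply: measurable_funM => //; exact: measurable_sqnorm.
Qed.

Let integral_growth (a b : R) : 0 <= a -> 0 <= b ->
  (\int[mu]_w (growth a b w * expR (sqnorm w / (8 * t)))%:E = (schur_cst a b)%:E)%E.
Proof.
move=> a0 b0.
have E1 : (8 * t)^-1 = (4 * t)^-1 - (4 * 2%:R * t)^-1 by field; rewrite gt_eqF.
have E2 : (16 * t)^-1 + (8 * t)^-1 = (4 * t)^-1 - (4 * 4%:R * t)^-1.
  by field; rewrite gt_eqF.
have mE c : measurable_fun setT (fun w : Cn => (expR (c * sqnorm w))%:E).
  apply/measurable_EFinP; apply: measurableT_comp => //.
  by apply: measurable_funM => //; exact: measurable_sqnorm.
transitivity (\int[mu]_w (a%:E * (expR ((8 * t)^-1 * sqnorm w))%:E +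
    b%:E * (expR (((16 * t)^-1 + (8 * t)^-1) * sqnorm w))%:E))%E.
  apply: eq_integral => w _; rewrite -!EFinM -EFinD; congr EFin.
  rewrite /growth mulrDl -mulrA -expRD; congr (_ * expR _ + _ * expR _); ring.
rewrite ge0_integralD//; try by apply: measurable_funeM.
- rewrite !ge0_integralZl ?lee_fin//; try by move=> w _; rewrite lee_fin expR_ge0.
  rewrite (gauss_measure_expR t0 _ E1)// (gauss_measure_expR t0 _ E2)//.
  by rewrite -!EFinM -EFinD /schur_cst mulrC [b * _]mulrC.
- by move=> w _; rewrite -EFinM lee_fin mulr_ge0// expR_ge0.
- by move=> w _; rewrite -EFinM lee_fin mulr_ge0// expR_ge0.
Qed.

Let growth_kernel (a b : R) (pr : Cn * Cn) : R :=
  growth a b (pr.1 - pr.2) * normc (kern pr.1 pr.2).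

Let measurable_sub : measurable_fun setT (fun pr : Cn * Cn => pr.1 - pr.2).
Proof.
have mj j : cmeas (fun pr : Cn * Cn => pr.1 ord0 j - pr.2 ord0 j).
  apply: cmeasB; first exact: (cmeasT_comp (cmeas_coord j) measurable_fst).
  exact: (cmeasT_comp (cmeas_coord j) measurable_snd).
by apply: measurable_fun_Cn => j; under eq_fun do rewrite !mxE; [exact: (mj j).1|exact: (mj j).2].
Qed.

Let measurable_growth_kernel a b : measurable_fun setT (growth_kernel a b).
Proof.
apply: measurable_funM; first exact: (measurableT_comp (measurable_growth a b) measurable_sub).
exact/measurable_normc/cmeas_kern2.
Qed.

Let growth_kernel_ge0 a b pr : 0 <= a -> 0 <= b -> 0 <= growth_kernel a b pr.
Proof. by move=> a0 b0; rewrite mulr_ge0 ?normc_ge0// growth_ge0. Qed.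

Let growth_kernelC a b z w : growth_kernel a b (z, w) = growth_kernel a b (w, z).
Proof.
rewrite -[LHS]/(growth a b (z - w) * normc (kern z w)).
rewrite -[RHS]/(growth a b (w - z) * normc (kern w z)).
by rewrite normc_kernC /growth -(sqnormN (z - w)) opprB.
Qed.

(** The Schur weight is an exact eigenfunction of the growth kernel: after the Weyl translation by z
    the exponents collapse to |w|^2 / 8t + |z|^2 / 8t and the growth factor depends on w alone. *)
Let growth_row (a b : R) z : 0 <= a -> 0 <= b ->
  (\int[mu]_w (growth_kernel a b (z, w) * expR (sqnorm w / (8 * t)))%:E =
   (schur_cst a b * expR (sqnorm z / (8 * t)))%:E)%E.
Proof.
move=> a0 b0.
(* The integrand divided by the density |K(z, w)|^2 exp(-|z|^2 / 4t) of the Weyl translation. *)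
pose phi w : \bar R := (growth a b (z - w) * expR (sqnorm w / (8 * t)) *
  expR (sqnorm z / (4 * t)) * expR (- Re (dot z w) / (4 * t)))%:E.
have mphi : measurable_fun setT phi.
  apply/measurable_EFinP; apply: measurable_funM; last first.
    apply: measurableT_comp => //; apply: measurable_funM => //; apply: measurableT_comp => //.
    exact: (cmeasT_comp cmeas_dot (pair1_measurable z)).1.
  apply: measurable_funM => //; apply: measurable_funM => //.
  apply: (measurableT_comp (measurable_growth a b)).
  exact: (measurableT_comp measurable_sub (pair1_measurable z)).
have phi0 w : (0 <= phi w)%E by rewrite lee_fin !mulr_ge0 ?expR_ge0// growth_ge0.
have key w : (phi w * (normc (kern z w) ^+ 2 * expR (- sqnorm z / (4 * t)))%:E =
    (growth_kernel a b (z, w) * expR (sqnorm w / (8 * t)))%:E)%E.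
  rewrite -EFinM; congr EFin.
  rewrite -[growth_kernel a b (z, w)]/(growth a b (z - w) * normc (kern z w)).
  rewrite normc_kern !mulNr !expRN.
  have := expR_gt0 (sqnorm z / (4 * t)); have := expR_gt0 (Re (dot z w) / (4 * t)).
  set x := expR (Re _ / _); set y := expR (sqnorm z / (4 * t)) => x0 y0; field.
  by rewrite !gt_eqF.
have := ge0_integral_weyl t0 z mphi phi0.
under eq_integral do rewrite key.
move=> ->; rewrite mulrC EFinM -(integral_growth a0 b0) -ge0_integralZl//.
- apply: eq_integral => w _; rewrite /phi -EFinM; congr EFin.
  have -> : growth a b (z - (w + z)) = growth a b w.
    by rewrite /growth opprD addrCA subrr addr0 sqnormN.
  rewrite mulrCA -!mulrA; congr (_ * _); rewrite -!expRD; congr expR.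
  by rewrite sqnormD dotDr ReD dot_self /= (Re_dotC w z); field; rewrite gt_eqF.
- apply/measurable_EFinP; apply: measurable_funM => //; exact: measurable_growth.
- by move=> w _; rewrite lee_fin mulr_ge0 ?expR_ge0// growth_ge0.
Qed.

(** The kernel is symmetric in z and w, so the row identity gives the column bound as well. *)
Lemma fock_schur (a b : R) (r : Cn -> R) : 0 <= a -> 0 <= b ->
  measurable_fun setT r -> (forall w, 0 <= r w) ->
  (\int[mu]_z (\int[mu]_w (growth a b (z - w) * normc (kern z w) * r w)%:E) ^+ 2 <=
   (schur_cst a b ^+ 2)%:E * \int[mu]_w (r w ^+ 2)%:E)%E.
Proof.
move=> a0 b0 mr r0.
apply: (@schur_test _ _ _ (gauss t0) (growth_kernel a b) (fun w => sqnorm w / (8 * t))) => //.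
- by apply: measurable_funM => //; exact: measurable_sqnorm.
- by move=> pr; exact: growth_kernel_ge0.
- exact: schur_cst_ge0.
- by move=> z; rewrite [leLHS](growth_row z a0 b0).
- move=> w; rewrite -(growth_row w a0 b0) le_eqVlt; apply/orP; left; apply/eqP.
  by apply: eq_integral => z _; rewrite growth_kernelC.
Qed.

Lemma sqint_schur_le (a b : R) (r : Cn -> R) v : 0 <= a -> 0 <= b ->
  measurable_fun setT r -> (forall w, 0 <= r w) -> cmeas v ->
  (forall z, ((normc (v z))%:E <= 2%:E *
    \int[mu]_w (growth a b (z - w) * normc (kern z w) * r w)%:E)%E) ->
  (sqint v <= ((2 * schur_cst a b) ^+ 2)%:E * \int[mu]_w (r w ^+ 2)%:E)%E.
Proof.
move=> a0 b0 mr r0 mv H.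
have mI : measurable_fun setT (fun z =>
    \int[gauss t0]_w (growth a b (z - w) * normc (kern z w) * r w)%:E)%E.
  apply: (measurable_fun_fubini_tonelli_F
    (fun pr : Cn * Cn => (growth_kernel a b pr * r pr.2)%:E)) => [|pr].
    apply/measurable_EFinP; apply: measurable_funM => //.
    exact: (measurableT_comp mr measurable_snd).
  by rewrite lee_fin mulr_ge0// growth_kernel_ge0.
have I0 z : (0 <= \int[mu]_w (growth a b (z - w) * normc (kern z w) * r w)%:E)%E.
  by apply: integral_ge0 => w _; rewrite lee_fin !mulr_ge0 ?normc_ge0// growth_ge0.
rewrite exprMn EFinM -muleA.
apply: (le_trans _ (lee_wpmul2l _ (fock_schur a0 b0 mr r0))); last by rewrite lee_fin sqr_ge0.
rewrite -ge0_integralZl//.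
- apply: ge0_le_integral => //.
  + by move=> z _; rewrite lee_fin sqr_ge0.
  + by apply/measurable_EFinP; apply: measurable_funX; exact: measurable_normc.
  + by apply: measurable_funeM; under eq_fun do rewrite expe2; exact: emeasurable_funM.
  + move=> z _; rewrite expr2 EFinM expr2 EFinM expe2 muleACA.
    by apply: lee_pmul; rewrite ?lee_fin ?normc_ge0.
- by under eq_fun do rewrite expe2; exact: emeasurable_funM.
- by move=> z _; exact: sqre_ge0.
Qed.

End fock_space.

(** * The projection and the commutators *)

Section bergman_projection.
Context {R : realType} {n : nat}.
Local Notation Cn := 'rV[R[i]]_n.
Variable t : R.
Hypothesis t0 : 0 < t.
Implicit Types (z w : Cn) (u v h p q f g : Cn -> R[i]).
Local Notation mu := (@gauss_measure R n t).
Local Notation kern := (kern t).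
Local Notation sqint := (sqint t).

(** The explicit formula for the projection, identified with [fock_proj] below. *)
Definition kern_transform u z : R[i] := cint mu (fun w => u w * kern z w).

Let growth10 z : growth t 1 0 z = 1.
Proof. by rewrite /growth mul0r addr0. Qed.

Let fock_schur1 (r : Cn -> R) : measurable_fun setT r -> (forall w, 0 <= r w) ->
  (\int[mu]_z (\int[mu]_w (normc (kern z w) * r w)%:E) ^+ 2 <=
   (@schur_cst R n 1 0 ^+ 2)%:E * \int[mu]_w (r w ^+ 2)%:E)%E.
Proof.
move=> mr r0; have := fock_schur t0 ler01 (lexx 0) mr r0; apply: le_trans.
rewrite le_eqVlt; apply/orP; left; apply/eqP; apply: eq_integral => z _.
by congr (_ ^+ 2)%E; apply: eq_integral => w _; rewrite growth10 mul1r.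
Qed.

(** With V the inner integral of |K| r, one has s V <= s^2 + V^2, also where V is infinite, and
    Schur's test makes V square integrable. *)
Let kern_form_lty (s r : Cn -> R) :
  measurable_fun setT s -> (forall w, 0 <= s w) ->
  measurable_fun setT r -> (forall w, 0 <= r w) ->
  (\int[mu]_w (s w ^+ 2)%:E < +oo)%E -> (\int[mu]_w (r w ^+ 2)%:E < +oo)%E ->
  (\int[mu]_z \int[mu]_w (s z * (normc (kern z w) * r w))%:E < +oo)%E.
Proof.
move=> ms s0 mr r0 fs fr.
have mk : measurable_fun setT (fun pr : Cn * Cn => normc (kern pr.1 pr.2)).
  exact/measurable_normc/cmeas_kern2.
have mkr : measurable_fun setT (fun pr : Cn * Cn => (normc (kern pr.1 pr.2) * r pr.2)%:E).
  apply/measurable_EFinP; apply: measurable_funM => //.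
  exact: (measurableT_comp mr measurable_snd).
have kr0 (pr : Cn * Cn) : (0 <= (normc (kern pr.1 pr.2) * r pr.2)%:E)%E.
  by rewrite lee_fin mulr_ge0 ?normc_ge0.
have mskr : measurable_fun setT (fun pr : Cn * Cn => (s pr.1 * (normc (kern pr.1 pr.2) * r pr.2))%:E).
  apply/measurable_EFinP; apply: measurable_funM; last exact/measurable_EFinP.
  exact: (measurableT_comp ms measurable_fst).
have skr0 (pr : Cn * Cn) : (0 <= (s pr.1 * (normc (kern pr.1 pr.2) * r pr.2))%:E)%E.
  by rewrite lee_fin !mulr_ge0 ?normc_ge0.
pose V z := (\int[gauss t0]_w (normc (kern z w) * r w)%:E)%E.
have V0 z : (0 <= V z)%E by apply: integral_ge0 => w _; exact: (kr0 (z, w)).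
have mV : measurable_fun setT V.
  exact: (measurable_fun_fubini_tonelli_F (m2 := gauss t0) _ mkr kr0).
have mV2 : measurable_fun setT (fun z => V z ^+ 2)%E.
  by under eq_fun do rewrite expe2; exact: emeasurable_funM.
have ms2 : measurable_fun setT (fun z => (s z ^+ 2)%:E).
  by apply/measurable_EFinP; exact: measurable_funX.
apply: (@le_lt_trans _ _ (\int[mu]_z ((s z ^+ 2)%:E + V z ^+ 2))%E).
  apply: ge0_le_integral => //.
  - by move=> z _; apply: integral_ge0 => w _; exact: (skr0 (z, w)).
  - exact: (measurable_fun_fubini_tonelli_F (m2 := gauss t0) _ mskr skr0).
  - exact: emeasurable_funD.
  - move=> z _.
    have -> : (\int[mu]_w (s z * (normc (kern z w) * r w))%:E = (s z)%:E * V z)%E.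
      rewrite -ge0_integralZl//.
      + exact: (measurable_fun_pair2 z mkr).
      + by move=> w _; exact: (kr0 (z, w)).
      + by rewrite lee_fin.
    have := V0 z; case: (V z) => [x| |] //.
      rewrite lee_fin => x0; rewrite -EFin_expe -EFinM -EFinD lee_fin.
      have := sqr_ge0 (s z - x); have := s0 z; nra.
    by move=> _; rewrite expe2 mulyy addey// leey.
rewrite ge0_integralD//; last 2 first.
- by move=> z _; rewrite lee_fin sqr_ge0.
- by move=> z _; exact: sqre_ge0.
apply: lte_add_pinfty => //; apply: le_lt_trans (fock_schur1 mr r0) _.
rewrite lte_mul_pinfty// lee_fin sqr_ge0 //.
Qed.

Lemma cmeas_kern_transform u : cmeas u -> (sqint u < +oo)%E -> cmeas (kern_transform u).
Proof.
move=> mu_ iu.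
have mG : cmeas (fun pr : Cn * Cn => u pr.2 * kern pr.1 pr.2).
  apply: cmeasM; last exact: cmeas_kern2.
  exact: (cmeasT_comp mu_ measurable_snd).
apply: (@cmeas_cint _ _ _ _ R (gauss t0) (gauss t0) _ mG).
(* mu has mass 1, so the constant 1 may serve as the outer factor and leaves the bare double
   integral. *)
have one : (\int[mu]_w ((1 : R) ^+ 2)%:E < +oo)%E.
  by rewrite integral_cst//= expr1n mul1e gauss_measureT// ltry.
have := @kern_form_lty (fun=> 1) (fun w => normc (u w)) (measurable_cst _)
  (fun=> ler01) (measurable_normc mu_) (fun w => normc_ge0 _) one iu.
apply: le_lt_trans; rewrite le_eqVlt; apply/orP; left; apply/eqP.
apply: eq_integral => z _; apply: eq_integral => w _.
by rewrite /= ComplexField.Normc.normcM mul1r mulrC.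
Qed.

Lemma normc_kern_transform_le u z : cmeas u -> (sqint u < +oo)%E ->
  ((normc (kern_transform u z))%:E <=
   2%:E * \int[mu]_w (normc (kern z w) * normc (u w))%:E)%E.
Proof.
move=> mu_ iu; apply: (le_trans (normc_cint_le (cintegrable_kern t0 z mu_ iu))).
rewrite le_eqVlt; apply/orP; left; apply/eqP; congr (_ * _)%E.
by apply: eq_integral => w _; rewrite ComplexField.Normc.normcM mulrC.
Qed.

Lemma sqint_kern_transform u : cmeas u -> (sqint u < +oo)%E ->
  (sqint (kern_transform u) <= ((2 * @schur_cst R n 1 0) ^+ 2)%:E * sqint u)%E.
Proof.
move=> mu_ iu.
apply: (sqint_schur_le t0 ler01 (lexx 0) (measurable_normc mu_)).
- by move=> w; exact: normc_ge0.
- exact: cmeas_kern_transform.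
- move=> z; under eq_integral do rewrite growth10 mul1r.
  exact: normc_kern_transform_le.
Qed.

Lemma kern_transform_H2t u : L2t t u -> H2t t (kern_transform u).
Proof.
move=> /L2tP[mu_ iu]; split; first exact: entire_cint_kern.
apply/L2tP; split; first exact: cmeas_kern_transform.
apply: le_lt_trans (sqint_kern_transform mu_ iu) _.
by rewrite lte_mul_pinfty// lee_fin sqr_ge0.
Qed.

Lemma innerE u v : inner t u v = cint mu (fun z => u z * conjc (v z)).
Proof. by []. Qed.

Lemma sqint_conj u : sqint (fun z => conjc (u z)) = sqint u.
Proof. by apply: eq_integral => z _; rewrite normc_conj. Qed.

(** Fubini and the Hermitian symmetry of K move the kernel onto q, where the reproducing formula
    removes it. *)
Lemma inner_kern_transform u q : L2t t u -> H2t t q ->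
  inner t (kern_transform u) q = inner t u q.
Proof.
move=> /L2tP[mu_ iu] [entire_q /L2tP[mq iq]]; rewrite !innerE.
have mqc := cmeas_conj mq.
have mG : cmeas (fun pr : Cn * Cn => (u pr.2 * kern pr.1 pr.2) * conjc (q pr.1)).
  apply: cmeasM; last exact: (cmeasT_comp mqc measurable_fst).
  apply: cmeasM; last exact: cmeas_kern2.
  exact: (cmeasT_comp mu_ measurable_snd).
have iG : (\int[gauss t0]_z \int[gauss t0]_w
    (normc ((u w * kern z w) * conjc (q z)))%:E < +oo)%E.
  have := kern_form_lty (measurable_normc mq) (fun w => normc_ge0 _) (measurable_normc mu_)
    (fun w => normc_ge0 _) iq iu.
  apply: le_lt_trans; rewrite le_eqVlt; apply/orP; left; apply/eqP.
  apply: eq_integral => z _; apply: eq_integral => w _.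
  rewrite !ComplexField.Normc.normcM normc_conj; congr EFin; ring.
have ik z := cintegrable_kern t0 z mu_ iu.
have iqk w : cintegrable mu (fun z => q z * kern w z) by exact: cintegrable_kern.
have conjE z w : u w * kern z w * conjc (q z) = u w * conjc (q z * kern w z).
  have -> : conjc (q z * kern w z) = conjc (q z) * conjc (kern w z) := rmorphM _ _ _.
  by rewrite kern_conj; ring.
transitivity (cint (gauss t0) (fun z => cint (gauss t0) (fun w => (u w * kern z w) * conjc (q z)))).
  apply: eq_cint => z; rewrite /kern_transform mulrC -cintZ//.
  by apply: eq_cint => w; rewrite mulrC.
rewrite (cint_fubini mG iG).
- apply: eq_cint => w /=; under eq_cint do rewrite conjE.
  rewrite cintZ; last first.
    split; first by apply: cmeas_conj; case: (iqk w).
    by under eq_integral do rewrite normc_conj; case: (iqk w).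
  by rewrite cint_conj// reproducing.
- move=> z /=; have := cintegrableZ (conjc (q z)) (ik z).
  by congr cintegrable; apply/funext => w; rewrite mulrC.
- move=> w /=; have ic : cintegrable mu (fun z => conjc (q z * kern w z)).
    split; first by apply: cmeas_conj; case: (iqk w).
    by under eq_integral do rewrite normc_conj; case: (iqk w).
  have := cintegrableZ (u w) ic.
  by congr cintegrable; apply/funext => z; rewrite conjE.
Qed.

Lemma is_orth_proj_kern_transform u : L2t t u -> is_orth_proj t u (kern_transform u).
Proof.
move=> L2u; split; first exact: kern_transform_H2t.
move=> q Hq; have /L2tP[mu_ iu] := L2u; have [_ /L2tP[mp ip]] := kern_transform_H2t L2u.
have [_ /L2tP[mq iq]] := Hq.
rewrite innerE; under eq_cint do rewrite /= mulrBl.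
rewrite cintB; last 2 first.
- by apply: cintegrable_mul; rewrite ?sqint_conj//; exact: cmeas_conj.
- by apply: cintegrable_mul; rewrite ?sqint_conj//; exact: cmeas_conj.
by rewrite -!innerE inner_kern_transform// subrr.
Qed.

Lemma kern_H2t z : H2t t (kern ^~ z).
Proof.
split; first exact: entire_kern.
apply/L2tP; split; first exact: cmeas_kernr.
have := @kern_L2 R n t t0 z; congr (_ < _)%E; apply: eq_integral => w _.
by rewrite normc_kernC.
Qed.

(** Any orthogonal projection p of u, in particular the chosen one, is tested against the entire
    function K(., z): the inner product of u - p with it is [kern_transform u z] minus p(z). *)
Lemma fock_projE u : L2t t u -> fock_proj t u = kern_transform u.
Proof.
move=> L2u; rewrite /fock_proj.
have : is_orth_proj t u (xget (fun=> 0) [set p | is_orth_proj t u p]).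
  by apply: xgetPex; exists (kern_transform u); exact: is_orth_proj_kern_transform.
move: (xget _ _) => p [Hp orthp].
have /L2tP[mu_ iu] := L2u; have [entire_p /L2tP[mp ip]] := Hp.
apply/funext => z; have := orthp _ (kern_H2t z); rewrite innerE.
under eq_cint do rewrite kern_conj /= mulrBl.
rewrite cintB; try exact: cintegrable_kern.
by rewrite (reproducing t0 z entire_p mp ip) => /eqP; rewrite subr_eq0 eq_sym => /eqP.
Qed.

Lemma L2tB u v : L2t t u -> L2t t v -> L2t t (u \- v).
Proof.
move=> /L2tP[mu_ iu] /L2tP[mv iv]; apply/L2tP; split; first exact: cmeasB.
apply: le_lt_trans (sqintB_le t mu_ mv) _.
by rewrite lte_mul_pinfty// ?adde_ge0 ?sqint_ge0// lte_add_pinfty.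
Qed.

(* The commutator of multiplication by f and the projection: its kernel
   (f z - f w) K(z, w) is small near the diagonal. *)
Lemma norm2_commutator_le (a b : R) f u v : 0 <= a -> 0 <= b ->
  (forall z w, normc (f z - f w) <= growth t a b (z - w)) ->
  L2t t u -> L2t t (f \* u) -> cmeas v ->
  (forall z, v z = f z * kern_transform u z - kern_transform (f \* u) z) ->
  (norm2 t v <= (2 * @schur_cst R n a b)%:E * norm2 t u)%E.
Proof.
move=> a0 b0 fle /L2tP[mu_ iu] /L2tP[mfu ifu] mv vE.
apply: norm2_le; first by rewrite mulr_ge0// schur_cst_ge0.
apply: (sqint_schur_le t0 a0 b0 (measurable_normc mu_)) => //.
  by move=> w; exact: normc_ge0.
move=> z; have ik := cintegrable_kern t0 z mu_ iu.
have ifk := cintegrable_kern t0 z mfu ifu.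
rewrite vE /kern_transform -cintZ// -cintB//; last exact: cintegrableZ.
have id := cintegrableB (cintegrableZ (f z) ik) ifk.
apply: (le_trans (normc_cint_le id)); rewrite lee_wpmul2l ?lee_fin//.
have mk : measurable_fun setT (fun w => normc (kern z w)).
  exact/measurable_normc/cmeas_kern.
apply: ge0_le_integral => //.
- by move=> w _; rewrite lee_fin normc_ge0.
- by apply/measurable_EFinP/measurable_normc; case: id.
- apply/measurable_EFinP; apply: measurable_funM; last exact: measurable_normc.
  apply: measurable_funM => //; apply: (measurableT_comp (measurable_growth t a b)).
  have mN := @measurable_Cn_scale R n (-1).
  apply: (eq_measurable_fun (fun w => (-1 *: w) + z)) => [w _|].
    by rewrite scaleN1r addrC.
  exact: (measurableT_comp (measurable_translation z) mN).
- move=> w _; rewrite lee_fin /=.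
  have -> : f z * (u w * kern z w) - f w * u w * kern z w =
      (f z - f w) * kern z w * u w by ring.
  rewrite !ComplexField.Normc.normcM ler_wpM2r ?normc_ge0// ler_wpM2r ?normc_ge0//.
Qed.

Lemma norm2_hankel_le (a b : R) f h : 0 <= a -> 0 <= b ->
  (forall z w, normc (f z - f w) <= growth t a b (z - w)) ->
  mult_dom t f h ->
  (norm2 t (hankel t f h) <= (2 * @schur_cst R n a b)%:E * norm2 t h)%E.
Proof.
move=> a0 b0 fle [[entire_h L2h] L2fh].
have [_ L2p] := kern_transform_H2t L2fh.
have /L2tP[mh ih] := L2h.
apply: (norm2_commutator_le a0 b0 fle L2h L2fh).
  by have [] := L2tB L2fh L2p; rewrite /hankel fock_projE.
move=> z; rewrite /hankel fock_projE//=; congr (_ * _ - _).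
exact/esym/(reproducing t0 z entire_h mh ih).
Qed.

Lemma norm2_semicommutator_le (a b : R) f g h : 0 <= a -> 0 <= b ->
  (forall z w, normc (f z - f w) <= growth t a b (z - w)) ->
  semicommutator_dom t f g h ->
  (norm2 t (semicommutator t f g h) <=
   (2 * @schur_cst R n a b)%:E * norm2 t (hankel t g h))%E.
Proof.
move=> a0 b0 fle [[entire_h L2h] L2gh L2fp L2fgh].
have [entire_p L2p] := kern_transform_H2t L2gh.
have /L2tP[mgh igh] := L2gh; have /L2tP[mp ip] := L2p.
rewrite fock_projE// in L2fp.
have uE : hankel t g h = (g \* h) \- kern_transform (g \* h).
  by rewrite /hankel fock_projE.
have L2u : L2t t (hankel t g h) by rewrite uE; exact: L2tB.
(* Both terms are square integrable by the definition of the domain; this makes f u square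
   integrable although f may be unbounded. *)
have fuE : f \* hankel t g h = (f \* g \* h) \- (f \* kern_transform (g \* h)).
  by rewrite uE; apply/funext => z /=; ring.
have L2fu : L2t t (f \* hankel t g h) by rewrite fuE; exact: L2tB.
have /L2tP[mfp ifp] := L2fp; have /L2tP[mfgh ifgh] := L2fgh.
have [_ L2pfp] := kern_transform_H2t L2fp.
have [_ L2pfgh] := kern_transform_H2t L2fgh.
apply: (norm2_commutator_le a0 b0 fle L2u L2fu).
  rewrite /semicommutator /toeplitz (fock_projE L2gh) (fock_projE L2fp) (fock_projE L2fgh).
  by have [] := L2tB L2pfp L2pfgh.
move=> z; rewrite /semicommutator /toeplitz (fock_projE L2gh) (fock_projE L2fp) (fock_projE L2fgh).
have -> : kern_transform (hankel t g h) z = 0.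
  rewrite uE /kern_transform; under eq_cint do rewrite /= mulrBl.
  rewrite cintB; try exact: cintegrable_kern.
  by rewrite (reproducing t0 z entire_p)// subrr.
rewrite mulr0 sub0r fuE /kern_transform; under [in RHS]eq_cint do rewrite /= mulrBl.
rewrite cintB; try exact: cintegrable_kern.
by rewrite opprB.
Qed.

(** Triangle inequality with the Schur bound 2 * 2^n for the projection. In squared form the
    constant must dominate 2 (1 + (2 * 2^n)^2), and (2 + 4 * 2^n)^2 does. *)
Lemma norm2_hankel_bounded_le g h : mult_dom t g h ->
  (norm2 t (hankel t g h) <= (2 + 4 * 2 ^+ n)%:E * norm2 t (g \* h)%R)%E.
Proof.
move=> [[entire_h L2h] L2gh]; have /L2tP[mgh igh] := L2gh.
have [_ /L2tP[mp ip]] := kern_transform_H2t L2gh.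
have s0 : 0 <= 2 ^+ n :> R by rewrite exprn_ge0.
apply: norm2_le; first by rewrite addr_ge0// mulr_ge0.
rewrite /hankel fock_projE//; apply: (le_trans (sqintB_le t mgh mp)).
apply: (@le_trans _ _ (2%:E * (sqint (g \* h)%R + ((2 * @schur_cst R n 1 0) ^+ 2)%:E * sqint (g \* h)%R))%E).
  by rewrite lee_wpmul2l ?lee_fin// leeD2l// sqint_kern_transform.
rewrite -[X in (X + _)%E]mul1e -ge0_muleDl ?lee_fin ?sqr_ge0//.
rewrite muleA -EFinD -EFinM lee_wpmul2r ?sqint_ge0// lee_fin /schur_cst.
nra.
Qed.

End bergman_projection.

(** * Uniform continuity and the limit *)

Section modulus_of_continuity.
Context {R : realType} {n : nat}.
Local Notation Cn := 'rV[R[i]]_n.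
Implicit Types (z w : Cn) (f : Cn -> R[i]).

Lemma rnorm_sqr_le z : rnorm z ^+ 2 <= sqnorm z.
Proof.
rewrite -(sqr_sqrtr (sqnorm_ge0 z)) lerXn2r ?nnegrE ?rnorm_ge0 ?sqrtr_ge0//.
apply/ler_addgt0Pr => e e0; apply/ltW/rnorm_lt; first by rewrite ltr_wpDl ?sqrtr_ge0.
move=> j; apply: (@le_lt_trans _ _ (Num.sqrt (sqnorm z))); last by rewrite ltrDl.
rewrite -[leLHS]ger0_norm ?normc_ge0// -sqrtr_sqr ler_sqrt ?sqnorm_ge0//.
rewrite /sqnorm (bigD1 j)//= lerDl sumr_ge0// => k _; exact: sqr_ge0.
Qed.

Lemma unif_continuous_rnorm f : unif_continuous f -> forall e : R, 0 < e ->
  exists2 d : R, 0 < d & forall z w, rnorm (z - w) < d -> normc (f z - f w) < e.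
Proof.
move=> fuc e e0.
have : entourage [set xy : R[i] * R[i] | ball xy.1 e%:C xy.2].
  by apply: (entourage_ball _ (PosNum (_ : 0 < e%:C))); rewrite ltcR.
move=> /fuc; rewrite /nbhs/= -entourage_from_ballE => -[d /= d0 dP].
have dE : d = (Re d)%:C by case: d d0 {dP} => a b; rewrite ltcE/= => /andP[/eqP ->].
exists (Re d); first by rewrite -ltcR -dE.
move=> z w zw; have := dP (z, w); rewrite /= mx_norm_ball /ball_ /= => H.
have : ball (f z) e%:C (f w) by apply: H; rewrite rnormE dE ltcR.
by rewrite /ball /= normrE ltcR.
Qed.

(** The segment from w to z is cut into equal steps shorter than d, on each of which f moves by at
    most e. The slope M = e / d depends on e but on neither z nor w. *)
Lemma unif_continuous_modulus f : unif_continuous f -> forall e : R, 0 < e ->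
  exists2 M : R, 0 <= M & forall z w, normc (f z - f w) <= e + M * rnorm (z - w).
Proof.
move=> fuc e e0; have [d d0 dP] := unif_continuous_rnorm fuc e0.
have chain (m : nat) z w : rnorm (z - w) < m%:R * d -> normc (f z - f w) <= m%:R * e.
  elim: m z w => [|m ih] z w.
    by rewrite mul0r ltNge rnorm_ge0.
  (* The last of m + 1 equal steps goes from x = w + c (z - w) to z; the others form a chain of m
     steps from w to x. *)
  move=> zw; pose c : R := m%:R / m.+1%:R.
  have m1 : 0 < m.+1%:R :> R by rewrite ltr0n.
  have c0 : 0 <= c by rewrite divr_ge0.
  have c1 : 1 - c = m.+1%:R^-1.
    by rewrite /c -[X in X - _](mulfV (lt0r_neq0 m1)) -mulrBl -natrB// subSnn mul1r.
  pose x := w + c%:C *: (z - w).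
  have xw : normc (f x - f w) <= m%:R * e.
    have [m0|m0] := eqVneq m 0%N.
      have -> : x = w by rewrite /x /c m0 mul0r scale0r addr0.
      by rewrite subrr ComplexField.Normc.normc0 mulr_ge0// ltW.
    apply: ih; rewrite /x addrC addKr rnormZ normc_real ger0_norm// /c.
    rewrite -mulrA ltr_pM2l ?ltr0n ?lt0n// mulrC ltr_pdivrMr// mulrC //.
  have zx : normc (f z - f x) <= e.
    apply/ltW/dP; have -> : z - x = (m.+1%:R^-1)%:C *: (z - w).
      by rewrite -c1 rmorphB /= scalerBl scale1r /x opprD addrA.
    by rewrite rnormZ normc_real ger0_norm ?invr_ge0 ?(ltW m1)// mulrC ltr_pdivrMr// mulrC.
  have -> : f z - f w = (f z - f x) + (f x - f w) by rewrite addrA subrK.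
  apply: (le_trans (le_normcD _ _)); rewrite -natr1 mulrDl mul1r addrC.
  exact: lerD.
exists (e / d) => [|z w]; first by rewrite divr_ge0// ltW.
have q0 : 0 <= rnorm (z - w) / d by rewrite divr_ge0 ?rnorm_ge0// ltW.
(* One step more than the integer part of |z - w| / d: the extra step accounts for the additive
   e. *)
apply: (le_trans (chain (Num.truncn (rnorm (z - w) / d)).+1 z w _)).
  by rewrite -ltr_pdivrMr// truncnS_gt.
rewrite -natr1 mulrDl mul1r addrC lerD2l mulrAC -[leRHS]mulrA mulrC ler_wpM2l ?(ltW e0)//.
by rewrite truncn_le.
Qed.

(** In the scale s = rnorm (z - w) / sqrt t, the linear term is dominated by a Gaussian with a
    constant independent of t. M is fixed before t, so the second coefficient vanishes with t. *)
Lemma unif_continuous_growth f : unif_continuous f -> forall e : R, 0 < e ->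
  exists2 M : R, 0 <= M & forall t, 0 < t -> forall z w,
    normc (f z - f w) <= growth t e (M * Num.sqrt t) (z - w).
Proof.
move=> fuc e e0; have [M M0 MP] := unif_continuous_modulus fuc e0.
exists (4 * M) => [|t t0 z w]; first by rewrite mulr_ge0.
apply: (le_trans (MP z w)); rewrite /growth lerD2l.
have s0 : 0 < Num.sqrt t by rewrite sqrtr_gt0.
rewrite [4 * M]mulrC -!mulrA ler_wpM2l//.
set x := z - w; pose s := rnorm x / Num.sqrt t.
have xs : rnorm x = s * Num.sqrt t by rewrite /s divfK// gt_eqF.
have s2 : s ^+ 2 / 16 <= sqnorm x / (16 * t).
  rewrite /s exprMn exprVn sqr_sqrtr ?(ltW t0)//.
  rewrite (_ : sqnorm x / (16 * t) = sqnorm x / t / 16); last by field; rewrite gt_eqF.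
  by rewrite ler_wpM2r// ler_wpM2r ?invr_ge0 ?(ltW t0)// rnorm_sqr_le.
(* From s <= 4 + s^2 / 4, a consequence of (s - 2)^2 >= 0 and s^2 >= 0, and 1 + x <= exp x. *)
have h1 : s <= 4 * expR (sqnorm x / (16 * t)).
  have := expR_ge1Dx (sqnorm x / (16 * t)).
  have := sqr_ge0 (s - 2); have := sqr_ge0 s; lra.
rewrite xs; have := ler_wpM2r (ltW s0) h1; congr (_ <= _); ring.
Qed.

End modulus_of_continuity.

(** * From norm estimates to limits of operator norms *)

Section operator_norm.
Context {R : realType} {n : nat}.
Local Notation Cn := 'rV[R[i]]_n.
Local Notation fn := (Cn -> R[i]).

Lemma opnorm_le (t : R) (D : set fn) (X : fn -> fn) (C : R) : 0 <= C ->
  (forall h, D h -> (norm2 t (X h) <= C%:E * norm2 t h)%E) ->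
  (opnorm t D X <= C%:E)%E.
Proof.
move=> C0 H; apply: ge_ereal_sup => _ [->|[h [Dh _] <-]]; first by rewrite lee_fin.
have Xh0 : (0 <= norm2 t (X h))%E by rewrite norm2E sqrte_ge0.
have h0 : (0 <= norm2 t h)%E by rewrite norm2E sqrte_ge0.
have := H h Dh; case: (norm2 t h) h0 => [r| |] // r0.
  have {}r0 : 0 <= r by rewrite -lee_fin.
  (* For h of norm 0 the bound forces [X h] to have norm 0 as well, so the quotient is 0; for h of
     infinite norm, treated last, the inverse is 0. *)
  have [<-|r1] := eqVneq 0 r.
    rewrite mule0 => Xh; have -> : norm2 t (X h) = 0%E by apply/eqP; rewrite eq_le Xh.
    by rewrite mul0e lee_fin.
  have {}r0 : 0 < r by rewrite lt_def eq_sym r1.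
  by rewrite inver gt_eqF// lee_pdivrMr.
by rewrite invey mule0 lee_fin.
Qed.

Lemma opnorm_cvg0 (D : R -> set fn) (X : R -> fn -> fn) :
  (forall e, 0 < e -> exists2 K, 0 <= K & forall t, 0 < t -> t < 1 -> forall h,
    D t h -> (norm2 t (X t h) <= (e + K * Num.sqrt t)%:E * norm2 t h)%E) ->
  opnorm t (D t) (X t) @[t --> (0 : R)^'+] --> 0%E.
Proof.
move=> H.
have ge0 t : (0 <= opnorm t (D t) (X t))%E by apply: ereal_sup_ubound; left.
have small (e : R) : 0 < e -> \forall t \near (0 : R)^'+, (opnorm t (D t) (X t) <= e%:E)%E.
  move=> e0; have e2 : 0 < e / 2 by rewrite divr_gt0.
  have [K K0 KP] := H _ e2.
  have k0 : 0 < (e / 2 / (K + 1)) ^+ 2.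
    by rewrite exprn_gt0// divr_gt0// ltr_wpDl.
  near=> t.
  have t0 : 0 < t by near: t; exact: nbhs_right_gt.
  have t1 : t < 1 by near: t; exact: nbhs_right_lt.
  have tk : t < (e / 2 / (K + 1)) ^+ 2 by near: t; exact: nbhs_right_lt.
  have sk : Num.sqrt t <= e / 2 / (K + 1).
    rewrite -[leRHS]ger0_norm; last by rewrite divr_ge0 ?(ltW e2)// addr_ge0.
    by rewrite -sqrtr_sqr ler_sqrt ?ltW.
  apply: opnorm_le; first exact: ltW.
  move=> h Dh; apply: (le_trans (KP t t0 t1 h Dh)).
  rewrite lee_wpmul2r ?norm2E ?sqrte_ge0// lee_fin.
  have : K * Num.sqrt t <= (K + 1) * (e / 2 / (K + 1)).
    by apply: ler_pM; rewrite ?sqrtr_ge0// lerDl.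
  have -> : (K + 1) * (e / 2 / (K + 1)) = e / 2.
    by rewrite mulrC divfK// gt_eqF// ltr_wpDl.
  lra.
have fin (t e : R) : (opnorm t (D t) (X t) <= e%:E)%E -> opnorm t (D t) (X t) \is a fin_num.
  by move=> te; rewrite ge0_fin_numE// (le_lt_trans te)// ltry.
apply/fine_cvgP; split.
  near=> t; apply: (fin t 1); near: t; exact: small.
apply/cvgrPdist_le => e e0; near=> t.
have te : (opnorm t (D t) (X t) <= e%:E)%E by near: t; exact: small.
by rewrite sub0r normrN ger0_norm ?fine_ge0// -lee_fin fineK// (fin t e).
Unshelve. all: by end_near.
Qed.

End operator_norm.

(** * The two limits *)

Section main.
Context {R : realType} {n : nat}.
Local Notation Cn := 'rV[R[i]]_n.
Implicit Types (f g h : Cn -> R[i]).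

Lemma schur_cst_growthE (e M s : R) :
  2 * @schur_cst R n e (M * s) = 2 * 2 ^+ n * e + 2 * 4 ^+ n * M * s.
Proof. by rewrite /schur_cst; ring. Qed.

(** Combines the modulus of continuity with the Schur constant: dividing e by 2 * 2^n beforehand
    leaves exactly e in front, and K depends on e but not on t. *)
Lemma unif_continuous_schur f : unif_continuous f -> forall e : R, 0 < e ->
  exists2 K, 0 <= K & forall t, 0 < t -> exists a b, [/\ 0 <= a, 0 <= b,
    (forall z w, normc (f z - f w) <= growth t a b (z - w)) &
    2 * @schur_cst R n a b = e + K * Num.sqrt t].
Proof.
move=> fuc e e0.
have c0 : 0 < 2 * 2 ^+ n :> R by rewrite mulr_gt0// exprn_gt0.
have e'0 : 0 < e / (2 * 2 ^+ n) by rewrite divr_gt0.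
have [M M0 MP] := unif_continuous_growth fuc e'0.
exists (2 * 4 ^+ n * M) => [|t t0]; first by rewrite !mulr_ge0// exprn_ge0.
exists (e / (2 * 2 ^+ n)), (M * Num.sqrt t); split.
- exact: ltW.
- by rewrite mulr_ge0 ?sqrtr_ge0.
- exact: MP.
- by rewrite schur_cst_growthE mulrC divfK// gt_eqF.
Qed.

(** All that the semicommutator estimate asks of the second symbol. B does not depend on t, and t <
    1 serves to bound sqrt t when g is uniformly continuous. *)
Definition hankel_bounded g := exists2 B : R, 0 <= B & forall t, 0 < t -> t < 1 ->
  forall h, mult_dom t g h -> (norm2 t (hankel t g h) <= B%:E * norm2 t h)%E.

Lemma unif_continuous_hankel_bounded g : unif_continuous g -> hankel_bounded g.
Proof.
move=> guc; have [K K0 KP] := unif_continuous_schur guc ltr01.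
exists (1 + K) => [|t t0 t1 h gh]; first by rewrite addr_ge0.
have [a [b [a0 b0 gle E]]] := KP t t0.
apply: (le_trans (norm2_hankel_le t0 a0 b0 gle gh)).
rewrite lee_wpmul2r ?norm2E ?sqrte_ge0// lee_fin E lerD2l ler_piMr//.
by rewrite -sqrtr1 ler_sqrt// ltW.
Qed.

(** The L^infinity norm unfolds to an essential supremum only for a measure of positive mass. Were
    this mass 0, the Gaussian measure would vanish instead of having mass 1. *)
Lemma lebesgue_Cn_gt0 : (0 < @lebesgue_Cn R n setT)%E.
Proof.
rewrite lt_neqAle measure_ge0 andbT eq_sym; apply/eqP => lam0.
have mg : measurable_fun setT (fun z : Cn => (gauss_density 1 z)%:E).
  by apply/measurable_EFinP; exact: measurable_gauss_density.
have := @gauss_measureT R n 1 ltr01; rewrite /gauss_measure.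
by rewrite (null_set_integral measurableT mg lam0) => /eqP; rewrite eq_sym onee_eq0.
Qed.

(** The essential bound holds almost everywhere for Lebesgue measure; integrating with the Gaussian
    density against that measure makes M the same for all t. *)
Lemma Linfty_bound g : Linfty g -> exists2 M : R, 0 <= M &
  forall t h, L2t t h -> cmeas (g \* h) ->
    (norm2 t (g \* h)%R <= M%:E * norm2 t h)%E.
Proof.
move=> [mg]; rewrite /cLnorm unlock lebesgue_Cn_gt0; set y := ess_sup _ _ => yoo.
(* The maximum with 0 excludes the value -oo, so that [fine] keeps the bound, and makes M
   nonnegative. *)
pose M := fine (maxe y 0).
have M0 : 0 <= M by rewrite fine_ge0// le_max lexx orbT.
have yM : (y <= M%:E)%E.
  rewrite /M fineK ?le_max ?lexx// ge0_fin_numE ?le_max ?lexx ?orbT//.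
  by rewrite gt_max yoo ltry.
exists M => // t h /L2tP[mh ih] mgh; apply: norm2_le => //.
have mn (q : Cn -> R[i]) : cmeas q -> measurable_fun setT (fun z => (normc (q z) ^+ 2)%:E).
  by move=> mq; apply/measurable_EFinP; apply: measurable_funX; exact: measurable_normc.
have md : measurable_fun setT (fun z : Cn => (gauss_density t z)%:E).
  by apply/measurable_EFinP; exact: measurable_gauss_density.
have p0 (q : Cn -> R[i]) z : (0 <= (normc (q z) ^+ 2)%:E)%E by rewrite lee_fin sqr_ge0.
rewrite /sqint -(ge0_integralZl _ measurableT (mn h mh) (fun z _ => p0 h z)); last first.
  by rewrite lee_fin sqr_ge0.
have mMh : measurable_fun setT (fun z => (M ^+ 2)%:E * (normc (h z) ^+ 2)%:E)%E.
  by apply: measurable_funeM; exact: mn.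
have Mh0 z : (0 <= (M ^+ 2)%:E * (normc (h z) ^+ 2)%:E)%E.
  by rewrite mule_ge0// lee_fin sqr_ge0.
rewrite (ge0_integral_gauss_measure t (mn _ mgh) (p0 (g \* h))).
rewrite (ge0_integral_gauss_measure t mMh Mh0).
apply: ae_ge0_le_integral => //.
- by move=> z _; rewrite mule_ge0// lee_fin ?sqr_ge0 ?gauss_density_ge0.
- by apply: emeasurable_funM => //; exact: (mn _ mgh).
- by move=> z _; rewrite mule_ge0// lee_fin gauss_density_ge0.
- exact: emeasurable_funM.
have := ess_sup_ge (@lebesgue_Cn R n) (abse \o (EFin \o (@ComplexField.Normc.normc R \o g))).
apply: filterS => z /= gz _.
have {}gz : normc (g z) <= M.
  rewrite -lee_fin -[normc (g z)]ger0_norm ?normc_ge0//; exact: le_trans gz yM.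
rewrite -!EFinM lee_fin ler_wpM2r ?gauss_density_ge0//.
rewrite ComplexField.Normc.normcM exprMn ler_wpM2r ?sqr_ge0//.
by rewrite lerXn2r// nnegrE ?normc_ge0.
Qed.

Lemma Linfty_hankel_bounded g : Linfty g -> hankel_bounded g.
Proof.
move=> /Linfty_bound[M M0 MP].
have s0 : 0 <= 2 + 4 * 2 ^+ n :> R by rewrite addr_ge0// mulr_ge0// exprn_ge0.
exists ((2 + 4 * 2 ^+ n) * M) => [|t t0 _ h gh]; first by rewrite mulr_ge0.
apply: (le_trans (norm2_hankel_bounded_le t0 gh)).
rewrite EFinM -muleA lee_wpmul2l ?lee_fin//.
case: gh => [[_ L2h] L2gh]; apply: MP => //.
by have /L2tP[] := L2gh.
Qed.

Lemma hankel_opnorm_cvg0 f : unif_continuous f ->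
  opnorm t (mult_dom t f) (hankel t f) @[t --> (0 : R)^'+] --> 0%E.
Proof.
move=> fuc; apply: opnorm_cvg0 => e e0.
have [K K0 KP] := unif_continuous_schur fuc e0.
exists K => // t t0 _ h fh; have [a [b [a0 b0 fle <-]]] := KP t t0.
exact: norm2_hankel_le.
Qed.

Lemma semicommutator_opnorm_cvg0 f g : unif_continuous f -> hankel_bounded g ->
  opnorm t (semicommutator_dom t f g) (semicommutator t f g) @[t --> (0 : R)^'+]
    --> 0%E.
Proof.
move=> fuc [B B0 BP]; apply: opnorm_cvg0 => e e0.
have B1 : 0 < B + 1 by rewrite ltr_wpDl.
(* The oscillation of f is made small relative to the bound B on H_g; the + 1 covers B = 0. *)
have e'0 : 0 < e / (B + 1) by rewrite divr_gt0.
have [K K0 KP] := unif_continuous_schur fuc e'0.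
exists (K * (B + 1)) => [|t t0 t1 h sh]; first by rewrite mulr_ge0// ltW.
have [a [b [a0 b0 fle E]]] := KP t t0.
have gh : mult_dom t g h by case: sh.
have s0 : 0 <= Num.sqrt t by exact: sqrtr_ge0.
apply: (le_trans (norm2_semicommutator_le t0 a0 b0 fle sh)); rewrite E.
have c0 : 0 <= e / (B + 1) + K * Num.sqrt t by rewrite addr_ge0 ?(ltW e'0)// mulr_ge0.
apply: (le_trans (lee_wpmul2l _ (BP t t0 t1 h gh))); first by rewrite lee_fin.
rewrite muleA lee_wpmul2r ?norm2E ?sqrte_ge0// -EFinM lee_fin.
apply: (@le_trans _ _ ((e / (B + 1) + K * Num.sqrt t) * (B + 1))).
  by rewrite ler_wpM2l// lerDl.
by rewrite mulrDl divfK ?gt_eqF// lerD2l mulrAC.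
Qed.

End main.

Local Close Scope complex_scope.
Unset Implicit Arguments.

Theorem theorem3p4 (R : realType) (n : nat) (f : 'rV[R[i]]_n -> R[i])
    (f_uc : unif_continuous f) :
  (opnorm t (mult_dom t f) (hankel t f) @[t --> (0 : R)^'+] --> 0%E) /\
  (forall g : 'rV[R[i]]_n -> R[i], Linfty g \/ unif_continuous g ->
    opnorm t (semicommutator_dom t f g) (semicommutator t f g)
      @[t --> (0 : R)^'+] --> 0%E).
Proof.
split; first exact: hankel_opnorm_cvg0.
move=> g [gb|guc]; apply: semicommutator_opnorm_cvg0 => //.
  exact: Linfty_hankel_bounded.
exact: unif_continuous_hankel_bounded.
Qed.
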